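(* Under the standing hypotheses (H1)–(H6) below, the deficiency index of the minimal relation satisfies $n(T_{\min})=0$ if $\tau$ is in the limit-circle case at no endpoint, $n(T_{\min})=1$ if $\tau$ is in the limit-circle case at exactly one endpoint, and $n(T_{\min})=2$ if $\tau$ is in the limit-circle case at both endpoints.
   Context: Let $-\infty\le a<b\le\infty$ and $\varrho,\varsigma,\chi$ locally finite Borel measures on $(a,b)$ with: (H1) $\varrho$ positive; (H2) $\chi$ real-valued; (H3) $\varsigma$ real-valued with $\operatorname{supp}\varsigma=(a,b)$; (H4) $\varsigma(\{x\})\chi(\{x\})=\varsigma(\{x\})\varrho(\{x\})=0$ for all $x$; (H5) for every gap $(\alpha,\beta)$ of $\operatorname{supp}\varrho$ (open interval in the complement with $\alpha,\beta\in\operatorname{supp}\varrho$) and every $f\in\mathfrak{D}_\tau$ with $f(\alpha-)=f(\beta+)=0$ one has $f=0$ on $(\alpha,\beta)$; (H6) $\operatorname{supp}\varrho$ has more than one point. Notation: $\int_c^x h\,d\mu=\int_{[c,x)}h\,d\mu$ ($x>c$), $0$ ($x=c$), $-\int_{[x,c)}h\,d\mu$ ($x<c$); $AC_{loc}((a,b);\mu)$: functions $f(x)=f(c)+\int_c^x h\,d\mu$, $h=\frac{df}{d\mu}\in L^1_{loc}$. $\mathfrak{D}_\tau$: $f\in AC_{loc}((a,b);\varsigma)$ for which there is $F\in AC_{loc}((a,b);\varrho)$ with $F=-\frac{df}{d\varsigma}+\int_c^{\cdot}f\,d\chi$ $|\varsigma|$-a.e.; $\tau f:=\frac{dF}{d\varrho}$.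 In $L^2((a,b);\varrho)$: $T_{\max}=\{(f,\tau f): f\in\mathfrak{D}_\tau,\ f,\tau f\in L^2\}$, $T_0=\{(f,\tau f)\in T_{\max}: f\text{ compactly supported in }(a,b)\}$, $T_{\min}=\overline{T_0}$, and $n(T_{\min})=\dim\operatorname{ran}(T_{\min}-\mathrm{i})^\perp$ (which equals $\dim\operatorname{ran}(T_{\min}+\mathrm{i})^\perp$). $\tau$ is in the limit-circle (l.c.) case at $a$ if for every $z\in\mathbb{C}$ all solutions $u\in\mathfrak{D}_\tau$ of $\tau u=zu$ lie in $L^2((a,c);\varrho)$ for every $c\in(a,b)$; otherwise it is in the limit-point case at $a$. Similarly at $b$. *)

(* Defs.v *)
From HB Require Import structures.
From mathcomp Require Import all_boot all_order all_algebra.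
From mathcomp Require Import all_classical all_reals all_analysis.
From mathcomp Require Import complex.

Set Implicit Arguments.
Unset Strict Implicit.
Unset Printing Implicit Defensive.

Import Order.TTheory GRing.Theory Num.Theory.
Import numFieldNormedType.Exports.

Local Open Scope classical_set_scope.
Local Open Scope ring_scope.

Section SturmLiouvilleMeasures.
Variable R : realType.
Local Notation C := (R[i]).
Local Notation Msr := {measure set R -> \bar R}.

Definition Iab (a b : \bar R) : set R := [set x | (a < x%:E)%E /\ (x%:E < b)%E].

Definition Icc (c d : R) : set R := [set y | c <= y <= d].
Definition Ico (c d : R) : set R := [set y | c <= y < d].
Definition Ioo (c d : R) : set R := [set y | c < y < d].

Definition Cint (mu : Msr) (D : set R) (h : R -> C) : C :=
  ((Rintegral mu D (fun x => complex.Re (h x))) +i*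
   (Rintegral mu D (fun x => complex.Im (h x))))%C.

Definition Cintegrable (mu : Msr) (D : set R) (h : R -> C) : Prop :=
  mu.-integrable D (fun x => (complex.Re (h x))%:E) /\
  mu.-integrable D (fun x => (complex.Im (h x))%:E).

Definition oint (mu : Msr) (c x : R) (h : R -> C) : C :=
  if c <= x then Cint mu (Ico c x) h
  else - Cint mu (Ico x c) h.

(* a real-valued locally finite measure given by its Jordan decomposition
   (mup, mum): \int_c^x h d(mup - mum) *)
Definition soint (mup mum : Msr) (c x : R) (h : R -> C) : C :=
  oint mup c x h - oint mum c x h.

Definition loc_int (a b : \bar R) (mu : Msr) (h : R -> C) : Prop :=
  forall c d, Iab a b c -> Iab a b d -> c <= d ->
    Cintegrable mu (Icc c d) h.

(* locally finite Borel measure on (a,b) (extended by 0 outside (a,b)) *)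
Definition loc_finite_on (a b : \bar R) (mu : Msr) : Prop :=
  (forall c d, Iab a b c -> Iab a b d -> (mu (Icc c d) < +oo)%E) /\
  mu (~` Iab a b) = 0%E.

Definition jordan_pair (mup mum : Msr) : Prop :=
  exists P : set R, measurable P /\ mup (~` P) = 0%E /\ mum P = 0%E.

Definition supp (a b : \bar R) (mu : Msr) : set R :=
  [set x | Iab a b x /\ forall e : R, 0 < e -> (0 < mu (Ioo (x - e) (x + e)))%E].

(* the relation tau f = g : f in D_tau and g is (a representative of) tau f *)
Definition tau_rel (a b : \bar R) (rho sp sm cp cm : Msr) (f g : R -> C) : Prop :=
  exists c, Iab a b c /\
  exists (h : R -> C) (F : R -> C),
    (* f in AC_loc((a,b); varsigma), with df/dvarsigma = h *)
    loc_int a b sp h /\ loc_int a b sm h /\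
    (forall x, Iab a b x -> f x = f c + soint sp sm c x h) /\
    (* F in AC_loc((a,b); rho), with dF/drho = g *)
    loc_int a b rho g /\
    (forall x, Iab a b x -> F x = F c + oint rho c x g) /\
    {ae measure_add sp sm, forall x, Iab a b x ->
        F x = - h x + soint cp cm c x f}.

Definition D_tau (a b : \bar R) (rho sp sm cp cm : Msr) (f : R -> C) : Prop :=
  exists g, tau_rel a b rho sp sm cp cm f g.

Definition sqn (f : R -> C) (x : R) : R :=
  complex.Re (f x) ^+ 2 + complex.Im (f x) ^+ 2.

Definition L2on (mu : Msr) (D : set R) (f : R -> C) : Prop :=
  measurable_fun D (fun x => complex.Re (f x)) /\
  measurable_fun D (fun x => complex.Im (f x)) /\
  (\int[mu]_(x in D) (sqn f x)%:E < +oo)%E.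

Definition dist2 (a b : \bar R) (rho : Msr) (u f : R -> C) : R :=
  Rintegral rho (Iab a b) (sqn (fun x => u x - f x)).

Definition ip (a b : \bar R) (rho : Msr) (u w : R -> C) : C :=
  Cint rho (Iab a b) (fun x => u x * (w x)^*%C).

Definition T0 (a b : \bar R) (rho sp sm cp cm : Msr) (f g : R -> C) : Prop :=
  tau_rel a b rho sp sm cp cm f g /\
  L2on rho (Iab a b) f /\ L2on rho (Iab a b) g /\
  exists c d, Iab a b c /\ Iab a b d /\
    forall x, Iab a b x -> ~ (c <= x <= d) -> f x = 0.

Definition Tmin (a b : \bar R) (rho sp sm cp cm : Msr) (u v : R -> C) : Prop :=
  L2on rho (Iab a b) u /\ L2on rho (Iab a b) v /\
  forall e : R, 0 < e -> exists f g, T0 a b rho sp sm cp cm f g /\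
     dist2 a b rho u f < e /\ dist2 a b rho v g < e.

Definition defect_space (a b : \bar R) (rho sp sm cp cm : Msr) (w : R -> C) : Prop :=
  L2on rho (Iab a b) w /\
  forall u v, Tmin a b rho sp sm cp cm u v ->
    ip a b rho (fun x => v x - 'i%C * u x) w = 0.

Definition ae_eq (a b : \bar R) (rho : Msr) (f g : R -> C) : Prop :=
  {ae rho, forall x, Iab a b x -> f x = g x}.

Definition has_dim (a b : \bar R) (rho : Msr) (P : (R -> C) -> Prop) (n : nat) : Prop :=
  exists ws : 'I_n -> (R -> C),
    (forall k, P (ws k)) /\
    (forall cs : 'I_n -> C,
        ae_eq a b rho (fun x => \sum_(k < n) cs k * ws k x) (fun _ => 0) ->
        forall k, cs k = 0) /\
    (forall w, P w -> exists cs : 'I_n -> C,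
        ae_eq a b rho w (fun x => \sum_(k < n) cs k * ws k x)).

Definition deficiency_index (a b : \bar R) (rho sp sm cp cm : Msr) (n : nat) : Prop :=
  has_dim a b rho (defect_space a b rho sp sm cp cm) n.

Definition lc_at_a (a b : \bar R) (rho sp sm cp cm : Msr) : Prop :=
  forall (z : C) (u : R -> C), tau_rel a b rho sp sm cp cm u (fun x => z * u x) ->
    forall c, Iab a b c -> L2on rho [set x | (a < x%:E)%E /\ x < c] u.

Definition lc_at_b (a b : \bar R) (rho sp sm cp cm : Msr) : Prop :=
  forall (z : C) (u : R -> C), tau_rel a b rho sp sm cp cm u (fun x => z * u x) ->
    forall c, Iab a b c -> L2on rho [set x | c < x /\ (x%:E < b)%E] u.

Definition gap_hyp (a b : \bar R) (rho sp sm cp cm : Msr) : Prop :=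
  forall al be : R, al < be ->
    supp a b rho al -> supp a b rho be ->
    (forall x, al < x < be -> ~ supp a b rho x) ->
    forall f, D_tau a b rho sp sm cp cm f ->
      (fun x => complex.Re (f x)) @ al^'- --> 0 ->
      (fun x => complex.Im (f x)) @ al^'- --> 0 ->
      (fun x => complex.Re (f x)) @ be^'+ --> 0 ->
      (fun x => complex.Im (f x)) @ be^'+ --> 0 ->
      forall x, al < x < be -> f x = 0.

End SturmLiouvilleMeasures.

(* Main.v *)
Require Import Defs.
From HB Require Import structures.
From mathcomp Require Import all_boot all_order all_algebra.
From mathcomp Require Import all_classical all_reals all_analysis.
From mathcomp Require Import complex.
From mathcomp Require Import measurable_realfun.
From mathcomp Require Import ring lra.
Import Order.TTheory GRing.Theory Num.Theory.
Import numFieldNormedType.Exports.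
Local Open Scope classical_set_scope.
Local Open Scope ring_scope.

Set Implicit Arguments.
Unset Strict Implicit.
Unset Printing Implicit Defensive.

(** tau f = g is the first order system df = p dsigma, dp = f dchi - g drho for f and its
quasi-derivative p.  By (H4) no two integrators share an atom where it matters, so integration by
parts yields the Lagrange identity for the Wronskian; Picard iteration forward together with its
constancy solves tau u = z u with arbitrary data at any point.  By (H5) and (H6) a solution that
vanishes rho-a.e. on a large enough interval vanishes identically.

The deficiency space is the space of L2 solutions of tau w = -i w: subtract from w on [al, be) its
orthogonal projection onto these solutions; the remainder g, cut off outside [al, be), is of the
form tau f - i f with f compactly supported, hence orthogonal to w and therefore zero.

For solutions of tau u = -i u the form J(x) = Im (u conj(p))(x) satisfies J(y) = J(x) minus the
integral of |u|^2 over [x, y).  Compactness of the sphere of initial data gives a nonzero solution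
with J >= 0 everywhere, which is L2 near b, and one with J <= 0, which is L2 near a.  A solution L2
near b with J negative somewhere forces all solutions (for every z, by variation of constants) to be
L2 near b, because J is then bounded away from 0 and u, conj(u) are independent solutions for -i and
i.  Hence if no endpoint is limit-circle an L2 solution has J = 0, so it vanishes; the other two
cases are linear algebra in the two-dimensional solution space. *)

(** All integrals run over half-open intervals [[c, x)]. Going forward, the equation is explicit at
    an atom, so iteration converges whatever the size of the atoms. What replaces it is the
    invertibility of the forward transfer matrix, whose determinant is the Wronskian of two basic
    solutions and equals 1. The same convention makes solutions left continuous with possible jumps
    on the right, so local arguments differ on the two sides of a point.

    Since rho may vanish on whole intervals, vanishing rho-a.e. does not at once give a zero of the
    solution. Two points of supp rho strictly inside the interval suffice. Either a gap lies between
    them, and (H5) applies once the limits from outside the gap are shown to be 0, or every point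
    between them lies in the support and zeros accumulate everywhere.

    The spectral parameter is -i because orthogonality to ran(T_min - i) moves i across a
    conjugate-linear pairing. The Lagrange identity itself is bilinear, and the sesquilinear form
    arises by inserting a conjugate solution, whose parameter is i. *)

(** * Tonelli on the two sides of the diagonal *)

Section RealIntegrals.
Variable R : realType.
Local Notation Msr := {measure set R -> \bar R}.

Lemma measurable_le (s : R) : measurable [set t : R | t <= s].
Proof. by rewrite -set_itvNyc; exact: measurable_itv. Qed.

Lemma measurable_lt (s : R) : measurable [set t : R | t < s].
Proof. by rewrite -set_itvNyo; exact: measurable_itv. Qed.

Lemma Rint_EFin (mu : Msr) (D : set R) (f : R -> R) :
  measurable D -> mu.-integrable D (EFin \o f) ->
  (\int[mu]_(x in D) (f x)%:E = (Rintegral mu D f)%:E)%E.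
Proof. by move=> mD fi; rewrite /Rintegral fineK//; exact: integrable_fin_num. Qed.

(** Fubini for [A s * B t], cut into [t <= s] and [s < t]. The diagonal goes to the first term, and
    this asymmetry is all that atoms common to [mu] and [nu] leave behind. *)
Lemma tonelli_split_le (mu nu : {finite_measure set R -> \bar R}) (A B : R -> R) :
  mu.-integrable setT (EFin \o A) -> nu.-integrable setT (EFin \o B) ->
  Rintegral mu setT A * Rintegral nu setT B =
  Rintegral mu setT (fun s => A s * Rintegral nu [set t : R | (t <= s)%R] B) +
  Rintegral nu setT (fun t => B t * Rintegral mu [set s : R | (s < t)%R] A).
Proof.
move=> Ai Bi.
have mA : measurable_fun setT A by apply/measurable_EFinP; exact: measurable_int Ai.
have mB : measurable_fun setT B by apply/measurable_EFinP; exact: measurable_int Bi.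
pose G := fun z : R * R => (A z.1 * B z.2)%:E.
pose L := [set z : R * R | z.2 <= z.1].
have mL : measurable L.
  have := @measurable_fun_ler _ (R * R)%type R setT snd fst.
  move=> /(_ (@measurable_snd _ _ _ _) (@measurable_fst _ _ _ _)).
  move=> /(_ measurableT [set true] I); rewrite setTI.
  by congr measurable; apply/seteqP; split => z /=.
have mG : measurable_fun setT G.
  apply/measurable_EFinP; apply: measurable_funM.
    by apply: measurableT_comp => //; exact: measurable_fst.
  by apply: measurableT_comp => //; exact: measurable_snd.
have iG : (mu \x nu)%E.-integrable setT G.
  apply/integrable12ltyP => //.
  under eq_integral.
    move=> s _; under eq_integral do rewrite /G/= normrM EFinM.
    rewrite integralZl//; last exact: integrable_norm.
    over.
  rewrite /=.
  have -> : (fun x => `|A x|%:E * \int[nu]_x0 `|B x0|%:E)%E =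
     (fun x => `|A x|%:E * (Rintegral nu setT (fun t => `|B t|))%:E)%E.
    by apply/funext => s; rewrite Rint_EFin//; exact: integrable_norm.
  rewrite integralZr//; last exact: integrable_norm.
  rewrite Rint_EFin//; last exact: integrable_norm.
  by rewrite -EFinM ltry.
pose F1 := G \_ L.
pose F2 := G \_ (~` L).
have iF1 : (mu \x nu)%E.-integrable setT F1.
  rewrite /F1 -integrable_mkcond//; exact: integrableS iG.
have mLC : measurable (~` L) by exact: measurableC.
have iF2 : (mu \x nu)%E.-integrable setT F2.
  rewrite /F2 -integrable_mkcond//; exact: integrableS iG.
have GE : (\int[mu \x nu]_z G z = \int[mu \x nu]_z F1 z + \int[mu \x nu]_z F2 z)%E.
  rewrite -integralD//; apply: eq_integral => z _; rewrite /F1 /F2 !patchE.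
  rewrite in_setC; case: ifP => _; rewrite ?adde0 ?add0e//.
have HG : (\int[mu \x nu]_z G z = (Rintegral mu setT A * Rintegral nu setT B)%:E)%E.
  rewrite -integral12_prod_meas1//.
  under eq_integral.
    move=> s _; rewrite /fubini_F; under eq_integral do rewrite /G/= EFinM.
    rewrite integralZl// Rint_EFin//.
    over.
  by rewrite integralZr// Rint_EFin.
have F1E : fubini_F nu F1 = EFin \o (fun s => A s * Rintegral nu [set t : R | (t <= s)%R] B).
  apply/funext => s; rewrite /fubini_F.
  transitivity (\int[nu]_(t in [set t : R | (t <= s)%R]) (A s * B t)%:E)%E.
    rewrite [RHS]integral_mkcond; apply: eq_integral => t _.
    rewrite /F1 !patchE.
    have -> : ((s, t) \in L) = (t \in [set t : R | (t <= s)%R]).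
      by apply/idP/idP; rewrite !inE.
    by [].
  under eq_integral do rewrite EFinM.
  have ml : measurable [set t : R | (t <= s)%R] by exact: measurable_le.
  have il : nu.-integrable [set t : R | (t <= s)%R] (EFin \o B).
    exact: integrableS Bi.
  by rewrite integralZl// Rint_EFin.
have F2E : fubini_G mu F2 = EFin \o (fun t => B t * Rintegral mu [set s : R | (s < t)%R] A).
  apply/funext => t; rewrite /fubini_G.
  transitivity (\int[mu]_(s in [set s : R | (s < t)%R]) (B t * A s)%:E)%E.
    rewrite [RHS]integral_mkcond; apply: eq_integral => s _.
    rewrite /F2 !patchE; rewrite /G/= [in LHS]mulrC.
    have -> : ((s, t) \in ~` L) = (s \in [set s : R | (s < t)%R]).
      apply/idP/idP; rewrite !inE /L/=; first by move/negP; rewrite -ltNge.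
      by rewrite ltNge => /negP.
    by [].
  under eq_integral do rewrite EFinM.
  have ml : measurable [set t' : R | (t' < t)%R] by exact: measurable_lt.
  have il : mu.-integrable [set t' : R | (t' < t)%R] (EFin \o A).
    exact: integrableS Ai.
  by rewrite integralZl// Rint_EFin.
have i1 := integrable_fubini_F iF1.
have mF2 := measurable_int _ iF2.
have i2 : nu.-integrable setT (fubini_G mu F2).
  apply/integrableP; split; first exact: (measurable_fubini_G iF2).
  apply: le_lt_trans ((integrable21ltyP mu nu mF2).1 iF2).
  apply: ge0_le_integral => //.
  - by apply: measurableT_comp => //; exact: (measurable_fubini_G iF2).
  - apply: (measurable_fun_fubini_tonelli_G (abse \o F2)) => //=.
    exact: measurableT_comp.
  - move=> t _; apply: le_abse_integral => //; exact: measurableT_comp.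
rewrite F1E in i1; rewrite F2E in i2.
apply: EFin_inj; rewrite -HG GE -integral12_prod_meas1// -integral21_prod_meas1//.
by rewrite F1E F2E EFinD -!Rint_EFin.
Qed.

End RealIntegrals.

(** * Integration by parts *)

Section IntervalIntegrals.
Variable R : realType.
Local Notation Msr := {measure set R -> \bar R}.
Implicit Types (mu nu : Msr) (D E : set R) (f g h : R -> R).

Lemma measurable_Ico (x y : R) : measurable (Ico x y).
Proof.
by have := @measurable_itv R `[x, y[; rewrite set_itvco.
Qed.

Lemma measurable_Icc (x y : R) : measurable (Icc x y).
Proof.
by have := @measurable_itv R `[x, y]; rewrite set_itvcc.
Qed.

Lemma measurable_Ioo (x y : R) : measurable (Ioo x y).
Proof.
by have := @measurable_itv R `]x, y[; rewrite set_itvoo.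
Qed.

Lemma Ico_sub_Icc (x y : R) : Ico x y `<=` Icc x y.
Proof. by move=> t /andP[xt ty]; rewrite /Icc/= xt ltW. Qed.

Lemma IcoS (x y x' y' : R) : x' <= x -> y <= y' -> Ico x y `<=` Ico x' y'.
Proof.
by move=> xx yy t /andP[xt ty]; rewrite /Ico/= (le_trans xx)// (lt_le_trans ty).
Qed.

Lemma Ico_empty (x y : R) : y <= x -> Ico x y = set0.
Proof.
move=> yx; apply/seteqP; split => // t /andP[xt ty].
by have := lt_le_trans ty (le_trans yx xt); rewrite ltxx.
Qed.

Lemma Ico_setU (x y z : R) : x <= y -> y <= z -> Ico x z = Ico x y `|` Ico y z.
Proof.
move=> xy yz; apply/seteqP; split => t; rewrite /Ico/=.
  by move=> /andP[xt tz]; have [ty|yt] := ltP t y; [left; rewrite xt|right].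
move=> [/andP[xt ty]|/andP[yt tz]]; first by rewrite xt (lt_le_trans ty).
by rewrite tz (le_trans xy).
Qed.

Lemma Ico_disj (x y z : R) : [disjoint Ico x y & Ico y z].
Proof.
apply/disj_setPS => t [/andP[_ ty] /andP[yt _]].
by have := lt_le_trans ty yt; rewrite ltxx.
Qed.

Lemma integrable_bounded mu D f (M : R) : measurable D -> (mu D < +oo)%E ->
  measurable_fun D f -> (forall x, D x -> `|f x| <= M) ->
  mu.-integrable D (EFin \o f).
Proof.
move=> mD Dfin mf fM; apply: measurable_bounded_integrable => //.
by exists M; split; [exact: num_real|move=> N MN x Dx /=; rewrite (le_trans (fM _ Dx))// ltW].
Qed.

Lemma integrable_mul_bounded mu D f g (M : R) : measurable D ->
  mu.-integrable D (EFin \o f) ->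
  measurable_fun D g -> (forall x, D x -> `|g x| <= M) ->
  mu.-integrable D (EFin \o (fun x => f x * g x)).
Proof.
move=> mD fi mg gM.
have := @integrableMl _ _ _ mu D mD (EFin \o f) g fi mg.
apply => //.
by exists M; split; [exact: num_real|move=> N MN x Dx /=; rewrite (le_trans (gM _ Dx))// ltW].
Qed.

Lemma integrable_measurable mu D f : mu.-integrable D (EFin \o f) -> measurable_fun D f.
Proof. by move=> fi; apply/measurable_EFinP; exact: measurable_int fi. Qed.

Lemma le_Rintegral_set mu D E f : measurable D -> measurable E -> D `<=` E ->
  mu.-integrable E (EFin \o f) -> (forall x, E x -> 0 <= f x) ->
  Rintegral mu D f <= Rintegral mu E f.
Proof.
move=> mD mE DE fi f0; have fiD := integrableS mE mD DE fi.
rewrite -lee_fin -!Rint_EFin//; apply: ge0_subset_integral => //.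
exact: measurable_int fi.
Qed.

(** For a nonnegative integrand the integral over increasing sets is monotone in [s], hence
    measurable. Writing [f] as [(|f| + f) - |f|] reduces to that case. *)
Lemma measurable_Rintegral_mono mu D f (G : R -> set R) : measurable D ->
  mu.-integrable D (EFin \o f) -> (forall s, measurable (G s)) ->
  (forall s t, s <= t -> G s `<=` G t) ->
  measurable_fun setT (fun s : R => Rintegral mu (D `&` G s) f).
Proof.
move=> mD fi mG Gmono.
have mDs s : measurable (D `&` G s) by exact: measurableI.
have sub s : D `&` G s `<=` D by move=> t [].
have ni := integrable_norm fi.
have pi : mu.-integrable D (EFin \o (fun x => `|f x| + f x)).
  by have := integrableD mD ni fi; apply.
rewrite (_ : (fun s => _) = (fun s =>
   Rintegral mu (D `&` G s) (fun x => `|f x| + f x)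
   - Rintegral mu (D `&` G s) (fun x => `|f x|))); last first.
  apply/funext => s; rewrite RintegralD//; last 2 first.
  - exact: (integrableS mD (mDs s) (sub s)).
  - exact: (integrableS mD (mDs s) (sub s)).
  by rewrite addrAC subrr add0r.
apply: measurable_funB; apply: nondecreasing_measurable => // s t st.
- apply: le_Rintegral_set => //.
  + by move=> u [Du us]; split => //=; exact: Gmono us.
  + exact: (integrableS mD (mDs t) (sub t)).
  + by move=> u _; rewrite -lerBlDr sub0r -normrN ler_norm.
- apply: le_Rintegral_set => //.
  + by move=> u [Du us]; split => //=; exact: Gmono us.
  + exact: (integrableS mD (mDs t) (sub t)).
Qed.

Lemma Ico_lt (x y s : R) : s <= y -> Ico x y `&` [set t : R | (t < s)%R] = Ico x s.
Proof.
move=> sy; apply/seteqP; split => t; rewrite /Ico/=.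
  by move=> [/andP[-> _] ->].
by move=> /andP[-> ts]; split => //; rewrite (lt_le_trans ts).
Qed.

Lemma measurable_Rintegral_Ico mu x y f : mu.-integrable (Ico x y) (EFin \o f) ->
  measurable_fun (Icc x y) (fun s => Rintegral mu (Ico x s) f).
Proof.
move=> fi.
apply: (eq_measurable_fun (fun s => Rintegral mu (Ico x y `&` [set t : R | (t < s)%R]) f)).
  by move=> s; rewrite inE => /andP[_ sy]; rewrite Ico_lt.
apply: measurable_funTS.
apply: measurable_Rintegral_mono => //; first exact: measurable_Ico.
  by move=> t; exact: measurable_lt.
by move=> u v uv t/= /lt_le_trans; apply.
Qed.

Lemma measurable_Rintegral_Icc mu x y f : mu.-integrable (Ico x y) (EFin \o f) ->
  measurable_fun (Ico x y) (fun s => Rintegral mu (Icc x s) f).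
Proof.
move=> fi.
apply: (eq_measurable_fun (fun s => Rintegral mu (Ico x y `&` [set t : R | (t <= s)%R]) f)).
  move=> s; rewrite inE => /andP[xs sy]; congr Rintegral.
  apply/seteqP; split => t; rewrite /Ico/Icc/=; first by move=> [/andP[-> _] ->].
  by move=> /andP[-> ts]; split => //; rewrite (le_lt_trans ts).
apply: measurable_funTS.
apply: measurable_Rintegral_mono => //; first exact: measurable_Ico.
  by move=> t; exact: measurable_le.
by move=> u v uv t/= /le_trans; apply.
Qed.

(** Restricting to a set of finite mass turns a locally finite measure into a finite one, to which
    the Tonelli identity applies. *)
Lemma Rintegral_mfrestr mu D E f (mD : measurable D) (Dfin : (mu D < +oo)%E) :
  measurable E ->
  Rintegral (mfrestr mD Dfin) E (f \_ D) = Rintegral mu (D `&` E) f.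
Proof.
move=> mE; rewrite -Rintegral_mkcondr /Rintegral; congr fine.
rewrite [in RHS]setIC; apply: eq_measure_integral => A mA AE.
by rewrite /= /mfrestr /mrestr setIidl// => t /AE [].
Qed.

Lemma integrable_mfrestr mu D f (mD : measurable D) (Dfin : (mu D < +oo)%E) :
  mu.-integrable D (EFin \o f) ->
  (mfrestr mD Dfin).-integrable setT (EFin \o (f \_ D)).
Proof.
move=> /integrableP[mf fi].
have -> : EFin \o f \_ D = (EFin \o f) \_ D.
  by rewrite restrict_EFin.
apply/(integrable_mkcond (EFin \o f) mD).
apply/integrableP; split => //; apply: le_lt_trans fi.
rewrite le_eqVlt; apply/orP; left; apply/eqP.
apply: eq_measure_integral => A mA AD.
by rewrite /= /mfrestr /mrestr setIidl.
Qed.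

Lemma Rintegral_product_Icc mu nu x y f g :
  (mu (Ico x y) < +oo)%E -> (nu (Ico x y) < +oo)%E ->
  mu.-integrable (Ico x y) (EFin \o f) -> nu.-integrable (Ico x y) (EFin \o g) ->
  Rintegral mu (Ico x y) f * Rintegral nu (Ico x y) g =
  Rintegral mu (Ico x y) (fun s => f s * Rintegral nu (Icc x s) g) +
  Rintegral nu (Ico x y) (fun t => g t * Rintegral mu (Ico x t) f).
Proof.
move=> mufin nufin fi gi; have mD := measurable_Ico x y.
have fi' := integrable_mfrestr mD mufin fi.
have gi' := integrable_mfrestr mD nufin gi.
have := tonelli_split_le fi' gi'.
rewrite !Rintegral_mfrestr// setIT => ->.
have -> : (fun s => (f \_ (Ico x y)) s *
    Rintegral (mfrestr mD nufin) [set t : R | t <= s] (g \_ (Ico x y))) =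
  (fun s => f s * Rintegral nu (Icc x s) g) \_ (Ico x y).
  apply/funext => s; rewrite !patchE; case: ifPn => [|_]; last by rewrite mul0r.
  rewrite inE => /andP[xs sy]; congr (_ * _).
  rewrite Rintegral_mfrestr//; last exact: measurable_le.
  congr Rintegral; apply/seteqP; split => t; rewrite /Ico/Icc/=.
    by move=> [/andP[-> _] ->].
  by move=> /andP[-> ts]; split => //; rewrite (le_lt_trans ts).
have -> : (fun s => (g \_ (Ico x y)) s *
    Rintegral (mfrestr mD mufin) [set t : R | t < s] (f \_ (Ico x y))) =
  (fun s => g s * Rintegral mu (Ico x s) f) \_ (Ico x y).
  apply/funext => s; rewrite !patchE; case: ifPn => [|_]; last by rewrite mul0r.
  rewrite inE => /andP[xs sy]; congr (_ * _).
  rewrite Rintegral_mfrestr//; last exact: measurable_lt.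
  by rewrite Ico_lt// ltW.
by rewrite !Rintegral_mfrestr// setIT.
Qed.

(** Only finitely many points of [D] carry mass above [1/(n+1)], since infinitely many would exceed
    the finite mass of [D]. *)
Lemma countable_atoms nu D : measurable D -> (nu D < +oo)%E ->
  countable [set t | D t /\ (0 < nu [set t])%E].
Proof.
move=> mD Dfin.
have fin t : D t -> nu [set t] \is a fin_num.
  move=> Dt; rewrite ge0_fin_numE//; apply: le_lt_trans Dfin.
  by apply: le_measure; rewrite ?inE// => ? ->.
rewrite (_ : [set t | _] =
    \bigcup_n [set t | D t /\ ((n.+1%:R^-1)%:E < nu [set t])%E]); last first.
  apply/seteqP; split=> [t/= [Dt]|t/= [k _ [Dt kt]]]; last first.
    by split => //; apply: lt_trans kt; rewrite lte_fin invr_gt0.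
  rewrite -(fineK (fin _ Dt)) lte_fin => /ltr_add_invr[k /[!add0r] kXr].
  by exists k => //; split => //; rewrite -(fineK (fin _ Dt)) lte_fin.
apply: bigcup_countable => // n _; apply: finite_set_countable.
apply: contrapT => /infiniteP/pcard_leP/injfunPex[/= q q_fun q_inj].
have qD k : D (q k) by have [] := q_fun k I.
have qn k : ((n.+1%:R^-1)%:E < nu [set q k])%E by have [] := q_fun k I.
have : (nu (\bigcup_k [set q k]) <= nu D)%E.
  apply: le_measure; rewrite ?inE//; first exact: bigcup_measurable.
  by move=> t [k _ ->].
rewrite measure_bigcup//; last first.
  by move=> i j _ _ [t [-> /= qij]]; apply: q_inj; rewrite ?inE.
have [N hN] : exists N : nat, (nu D < (N%:R * n.+1%:R^-1)%:E)%E.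
  have Df : nu D \is a fin_num by rewrite ge0_fin_numE.
  exists (Num.truncn (fine (nu D) * n.+1%:R)).+1.
  rewrite -(fineK Df) lte_fin ltr_pdivlMr//; exact: truncnS_gt.
move=> le1; have := le_lt_trans le1 hN.
rewrite ltNge => /negP; apply.
apply: (le_trans _ (nneseries_lim_ge N _)) => //.
under eq_bigr do rewrite -(fineK (fin _ (qD _))).
rewrite sumEFin lee_fin mulr_natl -(subn0 N) -sumr_const_nat subn0.
rewrite [leRHS](eq_bigl xpredT); last by move=> k; rewrite in_setT.
by apply: ler_sum => k _; rewrite ltW// -lte_fin fineK ?fin.
Qed.

Lemma countable_null mu (N : set R) : countable N ->
  (forall t, N t -> mu [set t] = 0%E) -> mu N = 0%E.
Proof.
move=> cN N0.
have mN : measurable N by apply: countable_measurable => // t; exact: measurable_set1.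
apply/negligibleP => //; move: cN => /countable_injP[i injf].
apply: (@negligibleS _ _ _ mu (\bigcup_k (N `&` i @^-1` [set k]))).
  by move=> t Nt; exists (i t).
apply: negligible_bigcup => k.
have [[t [Nt ik]]|] := pselect (exists t, N t /\ i t = k); last first.
  move=> nk; rewrite (_ : _ `&` _ = set0); first exact: negligible_set0.
  by apply/seteqP; split => // t [Nt it]; apply: nk; exists t.
apply: (@negligibleS _ _ _ mu [set t]); last by apply/negligibleP => //; exact: N0.
by move=> u [Nu iu]; apply: injf; rewrite ?inE// ik.
Qed.

(** The inner integrals over [Icc x s] and [Ico x s] differ only when [s] is an atom of [nu]. These
    atoms are countably many and, by hypothesis, none of them has [mu] mass, so they form a
    [mu]-null set. *)
Lemma Rintegral_by_parts mu nu x y f g :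
  (mu (Ico x y) < +oo)%E -> (nu (Ico x y) < +oo)%E ->
  (forall t, Ico x y t -> mu [set t] = 0%E \/ nu [set t] = 0%E) ->
  mu.-integrable (Ico x y) (EFin \o f) -> nu.-integrable (Ico x y) (EFin \o g) ->
  Rintegral mu (Ico x y) f * Rintegral nu (Ico x y) g =
  Rintegral mu (Ico x y) (fun s => f s * Rintegral nu (Ico x s) g) +
  Rintegral nu (Ico x y) (fun t => g t * Rintegral mu (Ico x t) f).
Proof.
move=> mufin nufin na fi gi; rewrite (Rintegral_product_Icc mufin nufin fi gi).
suff -> : Rintegral mu (Ico x y) (fun s => f s * Rintegral nu (Icc x s) g) =
  Rintegral mu (Ico x y) (fun s => f s * Rintegral nu (Ico x s) g) by [].
have mD := measurable_Ico x y.
pose N := [set t | Ico x y t /\ (0 < nu [set t])%E].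
have cN : countable N by exact: countable_atoms.
have mN : measurable N by apply: countable_measurable => // t; exact: measurable_set1.
have N0 : mu N = 0%E.
  apply: countable_null => // t [Dt nut].
  by have [//|nu0] := na _ Dt; rewrite nu0 ltxx in nut.
have mf := integrable_measurable fi.
have mh1 : measurable_fun (Ico x y) (fun s => f s * Rintegral nu (Icc x s) g).
  apply: measurable_funM => //; exact: measurable_Rintegral_Icc.
have mh2 : measurable_fun (Ico x y) (fun s => f s * Rintegral nu (Ico x s) g).
  apply: measurable_funM => //.
  apply: measurable_funS (measurable_Rintegral_Ico gi); first exact: measurable_Icc.
  exact: Ico_sub_Icc.
rewrite /Rintegral (@ae_eq_integral _ _ _ mu (Ico x y)
  (fun s => (f s * Rintegral nu (Ico x s) g)%:E)
  (fun s => (f s * Rintegral nu (Icc x s) g)%:E))//.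
- exact/measurable_EFinP.
- exact/measurable_EFinP.
exists N; split => // s /= /not_implyP[Ds neq]; split => //.
rewrite lt_neqAle measure_ge0 andbT eq_sym; apply/eqP => nu0; apply: neq.
suff -> : Rintegral nu (Icc x s) g = Rintegral nu (Ico x s) g by [].
have -> : Icc x s = Ico x s `|` [set s].
  apply/seteqP; split => t; rewrite /Icc/Ico/=.
    by move=> /andP[xt]; rewrite le_eqVlt => /orP[/eqP ->|ts]; [right|left; rewrite xt].
  move: Ds => /andP[xs _].
  by move=> [/andP[-> /ltW ->]//|->]; rewrite xs lexx.
have sub : Ico x s `|` [set s] `<=` Ico x y.
  move: Ds => /andP[xs sy] t [/andP[xt ts]|->]; rewrite /Ico/=.
    by rewrite xt (lt_trans ts).
  by rewrite xs.
have mIs := measurable_Ico x s.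
rewrite Rintegral_setU//.
- rewrite [X in _ + X](_ : _ = 0) ?addr0//.
  rewrite /Rintegral null_set_integral//.
  apply: measurable_funS (measurable_int _ gi) => //.
  by move=> t ->; apply: sub; right.
- apply: integrableS sub gi => //; exact: measurableU.
- by apply/disj_setPS => t [/andP[_ ts] /= te]; rewrite te ltxx in ts.
Qed.

End IntervalIntegrals.

(** * Complex-valued integrals *)

Section ComplexIntegral.
Variable R : realType.
Local Notation C := (R[i]).
Local Notation Msr := {measure set R -> \bar R}.
Implicit Types (mu nu : Msr) (D E : set R) (f g h : R -> C) (z w : C).

Lemma Cext z w : complex.Re z = complex.Re w -> complex.Im z = complex.Im w -> z = w.
Proof. by case: z w => [a b] [c d] /= -> ->. Qed.

Lemma cReD z w : complex.Re (z + w) = complex.Re z + complex.Re w.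
Proof. by case: z w => [a b] [c d]. Qed.
Lemma cImD z w : complex.Im (z + w) = complex.Im z + complex.Im w.
Proof. by case: z w => [a b] [c d]. Qed.
Lemma cReN z : complex.Re (- z) = - complex.Re z.
Proof. by case: z. Qed.
Lemma cImN z : complex.Im (- z) = - complex.Im z.
Proof. by case: z. Qed.
Lemma cReM z w :
  complex.Re (z * w) = complex.Re z * complex.Re w - complex.Im z * complex.Im w.
Proof. by case: z w => [a b] [c d]. Qed.
Lemma cImM z w :
  complex.Im (z * w) = complex.Re z * complex.Im w + complex.Im z * complex.Re w.
Proof. by case: z w => [a b] [c d]. Qed.
Lemma cReJ z : complex.Re z^*%C = complex.Re z.
Proof. by case: z. Qed.
Lemma cImJ z : complex.Im z^*%C = - complex.Im z.
Proof. by case: z. Qed.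
Definition cE := (cReD, cImD, cReN, cImN, cReM, cImM, cReJ, cImJ).

Lemma cRe_sum (I : Type) (r : seq I) (P : pred I) (F : I -> C) :
  complex.Re (\sum_(i <- r | P i) F i) = \sum_(i <- r | P i) complex.Re (F i).
Proof. by elim/big_rec2: _ => // i x y _ <-; rewrite cReD. Qed.
Lemma cIm_sum (I : Type) (r : seq I) (P : pred I) (F : I -> C) :
  complex.Im (\sum_(i <- r | P i) F i) = \sum_(i <- r | P i) complex.Im (F i).
Proof. by elim/big_rec2: _ => // i x y _ <-; rewrite cImD. Qed.

(** The l1 norm of the complex plane: real-valued, submultiplicative, equivalent to the modulus, and
    directly compatible with estimates on real and imaginary parts. *)
Definition n1 z : R := `|complex.Re z| + `|complex.Im z|.

Lemma n1_ge0 z : 0 <= n1 z. Proof. by rewrite addr_ge0. Qed.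
Lemma n1D z w : n1 (z + w) <= n1 z + n1 w.
Proof.
rewrite /n1 !cE addrACA; apply: lerD; exact: ler_normD.
Qed.
Lemma n1N z : n1 (- z) = n1 z. Proof. by rewrite /n1 !cE !normrN. Qed.
Lemma n1B z w : n1 (z - w) <= n1 z + n1 w.
Proof. by rewrite (le_trans (n1D _ _))// n1N. Qed.
Lemma n1J z : n1 z^*%C = n1 z. Proof. by rewrite /n1 !cE !normrN. Qed.
Lemma n10 : n1 0 = 0. Proof. by rewrite /n1/= normr0 addr0. Qed.
Lemma n1M z w : n1 (z * w) <= n1 z * n1 w.
Proof.
rewrite /n1 !cE mulrDl !mulrDr -!normrM addrACA [leRHS]addrACA.
rewrite [leRHS](_ : _ = (`|complex.Re z * complex.Re w| + `|complex.Im z * complex.Im w|)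
  + (`|complex.Re z * complex.Im w| + `|complex.Im z * complex.Re w|)); last by ring.
by apply: lerD; [rewrite (le_trans (ler_normB _ _))|rewrite (le_trans (ler_normD _ _))].
Qed.
Lemma n1_eq0 z : n1 z = 0 -> z = 0.
Proof.
move=> /eqP; rewrite paddr_eq0// => /andP[/eqP/normr0_eq0 a /eqP/normr0_eq0 b].
exact: Cext.
Qed.
Lemma n1_sum (I : Type) (r : seq I) (P : pred I) (F : I -> C) :
  n1 (\sum_(i <- r | P i) F i) <= \sum_(i <- r | P i) n1 (F i).
Proof.
elim/big_rec2: _ => [|i x y _ le]; first by rewrite n10.
by rewrite (le_trans (n1D _ _))// lerD2l.
Qed.
Lemma Re_le_n1 z : `|complex.Re z| <= n1 z. Proof. by rewrite lerDl. Qed.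
Lemma Im_le_n1 z : `|complex.Im z| <= n1 z. Proof. by rewrite lerDr. Qed.

Definition cmeas D f := measurable_fun D (fun x => complex.Re (f x)) /\
  measurable_fun D (fun x => complex.Im (f x)).

Lemma cmeasS D E f : measurable E -> D `<=` E -> cmeas E f -> cmeas D f.
Proof. by move=> mE DE [a b]; split; apply: measurable_funS; eassumption. Qed.
Lemma cmeasD D f g : cmeas D f -> cmeas D g -> cmeas D (fun x => f x + g x).
Proof.
move=> [a b] [c d]; split; under eq_fun do rewrite cE; exact: measurable_funD.
Qed.
Lemma cmeasM D f g : cmeas D f -> cmeas D g -> cmeas D (fun x => f x * g x).
Proof.
move=> [a b] [c d]; split; under eq_fun do rewrite cE.
  by apply: measurable_funB; exact: measurable_funM.
by apply: measurable_funD; exact: measurable_funM.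
Qed.
Lemma cmeas_cst D z : cmeas D (fun => z).
Proof. by split; exact: measurable_cst. Qed.
Lemma cmeasJ D f : cmeas D f -> cmeas D (fun x => (f x)^*%C).
Proof.
move=> [a b]; split; under eq_fun do rewrite cE; first exact: a.
exact: measurable_funN.
Qed.
Lemma cmeas_ext D f g : (forall x, D x -> f x = g x) -> cmeas D f -> cmeas D g.
Proof.
by move=> e [a b]; split; apply: eq_measurable_fun;
  [|exact: a| |exact: b] => x; rewrite inE => Dx; rewrite /= e.
Qed.
Lemma cmeas_n1 D f : cmeas D f -> measurable_fun D (fun x => n1 (f x)).
Proof.
by move=> [a b]; apply: measurable_funD; exact: measurableT_comp.
Qed.

Lemma Cintegrable_cmeas mu D h : Cintegrable mu D h -> cmeas D h.
Proof. by move=> [a b]; split; [exact: integrable_measurable a|exact: integrable_measurable b]. Qed.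

Lemma CintegrableS mu D E h : measurable D -> measurable E -> D `<=` E ->
  Cintegrable mu E h -> Cintegrable mu D h.
Proof. by move=> mD mE DE [a b]; split; [exact: integrableS a|exact: integrableS b]. Qed.

Lemma Cintegrable_ext mu D f g : measurable D -> (forall x, D x -> f x = g x) ->
  Cintegrable mu D f -> Cintegrable mu D g.
Proof.
move=> mD e [a b]; split.
  by apply: eq_integrable a => // x; rewrite inE => Dx; rewrite /= e.
by apply: eq_integrable b => // x; rewrite inE => Dx; rewrite /= e.
Qed.

Lemma integrableDr mu D (u v : R -> R) : measurable D ->
  mu.-integrable D (EFin \o u) -> mu.-integrable D (EFin \o v) ->
  mu.-integrable D (EFin \o (fun x => u x + v x)).
Proof. by move=> mD ui vi; have := integrableD mD ui vi; apply. Qed.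

Lemma integrableBr mu D (u v : R -> R) : measurable D ->
  mu.-integrable D (EFin \o u) -> mu.-integrable D (EFin \o v) ->
  mu.-integrable D (EFin \o (fun x => u x - v x)).
Proof. by move=> mD ui vi; have := integrableB mD ui vi; apply. Qed.

Lemma integrableZr' mu D (c : R) (u : R -> R) : measurable D ->
  mu.-integrable D (EFin \o u) ->
  mu.-integrable D (EFin \o (fun x => c * u x)).
Proof. by move=> mD ui; have := integrableZl mD c ui; apply. Qed.

Lemma integrableNr mu D (u : R -> R) : measurable D ->
  mu.-integrable D (EFin \o u) ->
  mu.-integrable D (EFin \o (fun x => - u x)).
Proof. by move=> mD ui; have := integrableN ui; apply. Qed.

Lemma CintegrableD mu D f g : measurable D ->
  Cintegrable mu D f -> Cintegrable mu D g -> Cintegrable mu D (fun x => f x + g x).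
Proof.
move=> mD [a b] [c d]; split; under eq_fun do rewrite cE.
  exact: integrableDr a c.
exact: integrableDr b d.
Qed.

Lemma CintegrableN mu D f : measurable D ->
  Cintegrable mu D f -> Cintegrable mu D (fun x => - f x).
Proof.
move=> mD [a b]; split; under eq_fun do rewrite cE; exact: integrableNr.
Qed.

Lemma CintegrableB mu D f g : measurable D ->
  Cintegrable mu D f -> Cintegrable mu D g -> Cintegrable mu D (fun x => f x - g x).
Proof. by move=> mD fi gi; apply: CintegrableD => //; exact: CintegrableN. Qed.

Lemma CintegrableZl mu D f z : measurable D ->
  Cintegrable mu D f -> Cintegrable mu D (fun x => z * f x).
Proof.
move=> mD [a b]; split; under eq_fun do rewrite cE.
  by apply: integrableBr => //; exact: integrableZr'.
by apply: integrableDr => //; exact: integrableZr'.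
Qed.

Lemma CintegrableJ mu D f : measurable D ->
  Cintegrable mu D f -> Cintegrable mu D (fun x => (f x)^*%C).
Proof.
move=> mD [a b]; split; under eq_fun do rewrite cE; first exact: a.
exact: integrableNr.
Qed.

Lemma Cintegrable0 mu D : measurable D -> Cintegrable mu D (fun => 0).
Proof. by move=> mD; split; exact: integrable0. Qed.

Lemma Cintegrable_sum mu D (I : Type) (r : seq I) (F : I -> R -> C) : measurable D ->
  (forall i, Cintegrable mu D (F i)) -> Cintegrable mu D (fun x => \sum_(i <- r) F i x).
Proof.
move=> mD Fi; elim: r => [|i r IH].
  under eq_fun do rewrite big_nil; exact: Cintegrable0.
under eq_fun do rewrite big_cons; exact: CintegrableD.
Qed.

Lemma Cintegrable_n1 mu D f : measurable D ->
  Cintegrable mu D f -> mu.-integrable D (EFin \o (fun x => n1 (f x))).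
Proof.
by move=> mD [a b]; apply: integrableDr => //; exact: integrable_norm.
Qed.

Lemma Cintegrable_le mu D f (g : R -> R) : measurable D -> cmeas D f ->
  mu.-integrable D (EFin \o g) -> (forall x, D x -> n1 (f x) <= g x) ->
  Cintegrable mu D f.
Proof.
move=> mD [a b] gi fg; split; apply: le_integrable gi => //.
- exact/measurable_EFinP.
- move=> x Dx; rewrite /= lee_fin (le_trans (Re_le_n1 _))// (le_trans (fg _ Dx))//.
  exact: ler_norm.
- exact/measurable_EFinP.
- move=> x Dx; rewrite /= lee_fin (le_trans (Im_le_n1 _))// (le_trans (fg _ Dx))//.
  exact: ler_norm.
Qed.

Lemma Cintegrable_bounded mu D f (M : R) : measurable D -> (mu D < +oo)%E ->
  cmeas D f -> (forall x, D x -> n1 (f x) <= M) -> Cintegrable mu D f.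
Proof.
move=> mD Dfin mf fM; apply: (Cintegrable_le mD mf (g := fun=> M)) => //.
apply: (integrable_bounded (M := `|M|)) => //.
Qed.

Lemma CintegrableMb mu D f g (M : R) : measurable D -> Cintegrable mu D f ->
  cmeas D g -> (forall x, D x -> n1 (g x) <= M) -> Cintegrable mu D (fun x => f x * g x).
Proof.
move=> mD fi mg gM; apply: (Cintegrable_le mD (g := fun x => M * n1 (f x))).
- by apply: cmeasM => //; exact: Cintegrable_cmeas fi.
- by apply: integrableZr' => //; exact: Cintegrable_n1.
- move=> x Dx; rewrite (le_trans (n1M _ _))// mulrC ler_wpM2r ?n1_ge0//.
  exact: gM.
Qed.

Lemma eq_Cint mu D f g : (forall x, D x -> f x = g x) -> Cint mu D f = Cint mu D g.
Proof.
move=> e; apply: Cext => /=; apply: eq_Rintegral => x; rewrite inE => Dx;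
by rewrite e.
Qed.

Lemma CintD mu D f g : measurable D -> Cintegrable mu D f -> Cintegrable mu D g ->
  Cint mu D (fun x => f x + g x) = Cint mu D f + Cint mu D g.
Proof.
move=> mD [a b] [c d]; apply: Cext; rewrite cE /=.
  under eq_Rintegral do rewrite cE; exact: RintegralD.
under eq_Rintegral do rewrite cE; exact: RintegralD.
Qed.

Lemma CintZl mu D f z : measurable D -> Cintegrable mu D f ->
  Cint mu D (fun x => z * f x) = z * Cint mu D f.
Proof.
move=> mD [a b]; apply: Cext; rewrite cE /=.
  under eq_Rintegral do rewrite cE.
  rewrite RintegralB ?RintegralZl//; exact: integrableZr'.
under eq_Rintegral do rewrite cE.
rewrite RintegralD ?RintegralZl//; exact: integrableZr'.
Qed.

Lemma CintZr mu D f z : measurable D -> Cintegrable mu D f ->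
  Cint mu D (fun x => f x * z) = Cint mu D f * z.
Proof.
move=> mD fi; rewrite mulrC -CintZl//; apply: eq_Cint => x _; exact: mulrC.
Qed.

Lemma CintN mu D f : measurable D -> Cintegrable mu D f ->
  Cint mu D (fun x => - f x) = - Cint mu D f.
Proof.
move=> mD fi; rewrite -mulN1r -CintZl//; apply: eq_Cint => x _.
by rewrite mulN1r.
Qed.

Lemma CintB mu D f g : measurable D -> Cintegrable mu D f -> Cintegrable mu D g ->
  Cint mu D (fun x => f x - g x) = Cint mu D f - Cint mu D g.
Proof.
by move=> mD fi gi; rewrite CintD ?CintN//; exact: CintegrableN.
Qed.

Lemma CintJ mu D f : measurable D -> Cintegrable mu D f ->
  Cint mu D (fun x => (f x)^*%C) = ((Cint mu D f)^*)%C.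
Proof.
move=> mD [a b]; apply: Cext => /=; under eq_Rintegral do rewrite cE; first by [].
rewrite -mulN1r -RintegralZl//; apply: eq_Rintegral => x _.
by rewrite mulN1r.
Qed.

Lemma Cint0 mu D : Cint mu D (fun => 0) = 0.
Proof. by rewrite /Cint /= /Rintegral integral0. Qed.

Lemma Cint_set0 mu f : Cint mu set0 f = 0.
Proof. by rewrite /Cint /= !Rintegral_set0. Qed.

Lemma Cint_sum mu D (I : Type) (r : seq I) (F : I -> R -> C) : measurable D ->
  (forall i, Cintegrable mu D (F i)) ->
  Cint mu D (fun x => \sum_(i <- r) F i x) = \sum_(i <- r) Cint mu D (F i).
Proof.
move=> mD Fi; elim: r => [|i r IH].
  rewrite big_nil -[RHS](Cint0 mu D); apply: eq_Cint => x _; by rewrite big_nil.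
rewrite big_cons -IH -CintD//; last exact: Cintegrable_sum.
by apply: eq_Cint => x _; rewrite big_cons.
Qed.

Lemma Cint_setU mu D E f : measurable D -> measurable E ->
  Cintegrable mu (D `|` E) f -> [disjoint D & E] ->
  Cint mu (D `|` E) f = Cint mu D f + Cint mu E f.
Proof.
by move=> mD mE [a b] DE; apply: Cext; rewrite cE /= Rintegral_setU.
Qed.

Lemma Cint_Ico_split mu (x y t : R) f : x <= y -> y <= t -> Cintegrable mu (Ico x t) f ->
  Cint mu (Ico x t) f = Cint mu (Ico x y) f + Cint mu (Ico y t) f.
Proof.
move=> xy yt fi; rewrite (Ico_setU xy yt) Cint_setU//.
- exact: measurable_Ico.
- exact: measurable_Ico.
- by rewrite -(Ico_setU xy yt).
- exact: Ico_disj.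
Qed.

Lemma n1_Cint mu D f : measurable D -> Cintegrable mu D f ->
  n1 (Cint mu D f) <= Rintegral mu D (fun x => n1 (f x)).
Proof.
move=> mD [a b]; rewrite /n1 /= RintegralD//; [|exact: integrable_norm..].
by apply: lerD; exact: le_normr_Rintegral.
Qed.

Lemma Rintegral_le_cst mu D (f : R -> R) (M : R) : measurable D -> (mu D < +oo)%E ->
  mu.-integrable D (EFin \o f) -> (forall x, D x -> f x <= M) ->
  Rintegral mu D f <= M * fine (mu D).
Proof.
move=> mD Dfin fi fM; rewrite -Rintegral_cst//; apply: le_Rintegral => //.
by apply: (integrable_bounded (M := `|M|)) => //; exact: measurable_cst.
Qed.

Lemma n1_Cint_bounded mu D f (M : R) : measurable D -> (mu D < +oo)%E ->
  Cintegrable mu D f -> (forall x, D x -> n1 (f x) <= M) ->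
  n1 (Cint mu D f) <= M * fine (mu D).
Proof.
move=> mD Dfin fi fM; rewrite (le_trans (n1_Cint mD fi))//.
by apply: Rintegral_le_cst => //; exact: Cintegrable_n1.
Qed.

Lemma measurable_Cint_Ico mu x y f : Cintegrable mu (Ico x y) f ->
  cmeas (Icc x y) (fun s => Cint mu (Ico x s) f).
Proof. by move=> [a b]; split; exact: measurable_Rintegral_Ico. Qed.

Lemma Cint_Ico_bound mu x y f s : Cintegrable mu (Ico x y) f -> s <= y ->
  n1 (Cint mu (Ico x s) f) <= Rintegral mu (Ico x y) (fun x => n1 (f x)).
Proof.
move=> fi sy; have mI := @measurable_Ico R; have sub := IcoS (lexx x) sy.
rewrite (le_trans (n1_Cint (mI x s) (CintegrableS (mI x s) (mI x y) sub fi)))//.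
apply: le_Rintegral_set => //; first exact: Cintegrable_n1.
by move=> t _; exact: n1_ge0.
Qed.

Lemma Cint_by_parts mu nu x y f g :
  (mu (Ico x y) < +oo)%E -> (nu (Ico x y) < +oo)%E ->
  (forall t, Ico x y t -> mu [set t] = 0%E \/ nu [set t] = 0%E) ->
  Cintegrable mu (Ico x y) f -> Cintegrable nu (Ico x y) g ->
  Cint mu (Ico x y) f * Cint nu (Ico x y) g =
  Cint mu (Ico x y) (fun s => f s * Cint nu (Ico x s) g) +
  Cint nu (Ico x y) (fun t => g t * Cint mu (Ico x t) f).
Proof.
move=> mufin nufin na [f1 f2] [g1 g2].
have mI := measurable_Ico x y.
have I1 (u v : R -> R) : mu.-integrable (Ico x y) (EFin \o u) ->
    nu.-integrable (Ico x y) (EFin \o v) ->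
    mu.-integrable (Ico x y) (EFin \o (fun s => u s * Rintegral nu (Ico x s) v)).
  move=> ui vi; apply: (integrable_mul_bounded (M := Rintegral nu (Ico x y) (fun x => `|v x|))) => //.
    apply: measurable_funS (measurable_Rintegral_Ico vi); first exact: measurable_Icc.
    exact: Ico_sub_Icc.
  move=> t /andP[xt ty].
  have sub := IcoS (lexx x) (ltW ty).
  have vit := integrableS mI (measurable_Ico x t) sub vi.
  rewrite (le_trans (le_normr_Rintegral (measurable_Ico x t) vit))//.
  apply: le_Rintegral_set => //; first exact: measurable_Ico.
  exact: integrable_norm.
have I2 (u v : R -> R) : mu.-integrable (Ico x y) (EFin \o u) ->
    nu.-integrable (Ico x y) (EFin \o v) ->
    nu.-integrable (Ico x y) (EFin \o (fun s => v s * Rintegral mu (Ico x s) u)).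
  move=> ui vi; apply: (integrable_mul_bounded (M := Rintegral mu (Ico x y) (fun x => `|u x|))) => //.
    apply: measurable_funS (measurable_Rintegral_Ico ui); first exact: measurable_Icc.
    exact: Ico_sub_Icc.
  move=> t /andP[xt ty].
  have sub := IcoS (lexx x) (ltW ty).
  have uit := integrableS mI (measurable_Ico x t) sub ui.
  rewrite (le_trans (le_normr_Rintegral (measurable_Ico x t) uit))//.
  apply: le_Rintegral_set => //; first exact: measurable_Ico.
  exact: integrable_norm.
have P11 := Rintegral_by_parts mufin nufin na f1 g1.
have P12 := Rintegral_by_parts mufin nufin na f1 g2.
have P21 := Rintegral_by_parts mufin nufin na f2 g1.
have P22 := Rintegral_by_parts mufin nufin na f2 g2.
apply: Cext; rewrite !cE /=.
  rewrite P11 P22 opprD addrACA -(RintegralB mI (I1 _ _ f1 g1) (I1 _ _ f2 g2)).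
  rewrite -(RintegralB mI (I2 _ _ f1 g1) (I2 _ _ f2 g2)).
  by congr (_ + _); apply: eq_Rintegral => s _; rewrite cE.
rewrite P12 P21 addrACA [X in _ + X]addrC.
rewrite -(RintegralD mI (I1 _ _ f1 g2) (I1 _ _ f2 g1)).
rewrite -(RintegralD mI (I2 _ _ f2 g1) (I2 _ _ f1 g2)).
by congr (_ + _); apply: eq_Rintegral => s _; rewrite cE.
Qed.

End ComplexIntegral.

(** * Absolute continuity with respect to several measures, and the product rule *)

Section AbsolutelyContinuous.
Variable R : realType.
Local Notation C := (R[i]).
Local Notation Msr := {measure set R -> \bar R}.
Variables (K : finType) (m : K -> Msr).
Implicit Types (D : set R) (f g h : R -> C) (z w : C).

(** Order convexity and finiteness on compact intervals. The definition covers both (a, b) and its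
    parts [c, b), on which the forward problem is solved. *)
Definition admissible D :=
  (forall x y t, D x -> D y -> x <= t -> t <= y -> D t) /\
  (forall k x y, D x -> D y -> (m k (Icc x y) < +oo)%E).

(** Locally bounded and measurable. This is the regularity that survives jumps, and it is enough for
    integrating one function against every [m k]. *)
Definition lbm D f := forall c d, D c -> D d ->
  cmeas (Icc c d) f /\ exists M, forall x, Icc c d x -> n1 (f x) <= M.

(** The densities are carried as data, one for each measure, so that [f] and its quasi-derivative
    are treated alike although different measures drive them. *)
Definition abscont D (F : R -> C) (F' : K -> R -> C) :=
  (forall k x y, D x -> D y -> x <= y -> Cintegrable (m k) (Ico x y) (F' k)) /\
  (forall x y, D x -> D y -> x <= y ->
     F y = F x + \sum_k Cint (m k) (Ico x y) (F' k)).

Lemma admissible_Ico D k x y : admissible D -> D x -> D y -> (m k (Ico x y) < +oo)%E.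
Proof.
move=> [_ fin] Dx Dy; apply: le_lt_trans (fin k _ _ Dx Dy).
by apply: le_measure; rewrite ?inE; [exact: measurable_Ico|exact: measurable_Icc|exact: Ico_sub_Icc].
Qed.

Lemma lbm_cst D z : lbm D (fun => z).
Proof. by move=> c d _ _; split; [exact: cmeas_cst|exists (n1 z)]. Qed.

Lemma lbmD D f g : lbm D f -> lbm D g -> lbm D (fun x => f x + g x).
Proof.
move=> lf lg c d Dc Dd; have [mf [M fM]] := lf _ _ Dc Dd.
have [mg [N gN]] := lg _ _ Dc Dd; split; first exact: cmeasD.
exists (M + N) => x xcd; rewrite (le_trans (n1D _ _))// lerD//; [exact: fM|exact: gN].
Qed.

Lemma lbmM D f g : lbm D f -> lbm D g -> lbm D (fun x => f x * g x).
Proof.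
move=> lf lg c d Dc Dd; have [mf [M fM]] := lf _ _ Dc Dd.
have [mg [N gN]] := lg _ _ Dc Dd; split; first exact: cmeasM.
exists (M * N) => x xcd; rewrite (le_trans (n1M _ _))// ler_pM ?n1_ge0//;
  [exact: fM|exact: gN].
Qed.

Lemma lbmZ D f z : lbm D f -> lbm D (fun x => z * f x).
Proof. by move=> lf; apply: lbmM => //; exact: lbm_cst. Qed.

Lemma lbm_int D f k x y : admissible D -> lbm D f -> D x -> D y ->
  Cintegrable (m k) (Ico x y) f.
Proof.
move=> aD lf Dx Dy; have [mf [M fM]] := lf _ _ Dx Dy.
apply: (Cintegrable_bounded (M := M)).
- exact: measurable_Ico.
- exact: (admissible_Ico k aD).
- apply: cmeasS mf; [exact: measurable_Icc|exact: Ico_sub_Icc].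
- by move=> t /Ico_sub_Icc; exact: fM.
Qed.

Lemma int_mul_lbm D f g k x y : lbm D g -> D x -> D y ->
  Cintegrable (m k) (Ico x y) f -> Cintegrable (m k) (Ico x y) (fun t => f t * g t).
Proof.
move=> lg Dx Dy fi; have [mg [M gM]] := lg _ _ Dx Dy.
apply: (CintegrableMb (M := M)) => //.
- exact: measurable_Ico.
- apply: cmeasS mg; [exact: measurable_Icc|exact: Ico_sub_Icc].
- by move=> t /Ico_sub_Icc; exact: gM.
Qed.

Lemma AC_lbm D (F : R -> C) (F' : K -> R -> C) : admissible D -> abscont D F F' -> lbm D F.
Proof.
move=> [cv _] [Fi FE] c d Dc Dd.
have [cd|dc] := leP c d; last first.
  have e : Icc c d = set0.
    apply/seteqP; split => // t /andP[ct td].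
    by have := lt_le_trans dc (le_trans ct td); rewrite ltxx.
  rewrite e; split; last by exists 0.
  by split; exact: measurable_fun_set0.
have e x : Icc c d x -> F c + \sum_k Cint (m k) (Ico c x) (F' k) = F x.
  move=> /andP[cx xd]; rewrite -FE//; exact: (cv c d).
split.
  apply: cmeas_ext e _; apply: cmeasD; first exact: cmeas_cst.
  elim: (index_enum K) => [|k r IH].
    under eq_fun do rewrite big_nil; exact: cmeas_cst.
  under eq_fun do rewrite big_cons; apply: cmeasD => //.
  by apply: measurable_Cint_Ico; exact: Fi.
exists (n1 (F c) + \sum_k Rintegral (m k) (Ico c d) (fun x => n1 (F' k x))) => x xcd.
rewrite -e// (le_trans (n1D _ _))// lerD2l (le_trans (n1_sum _ _ _))// ler_sum// => k _.
by apply: Cint_Ico_bound; [exact: Fi|move: xcd => /andP[]].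
Qed.

Lemma ACD D (F : R -> C) (F' : K -> R -> C) (G : R -> C) (G' : K -> R -> C) : abscont D F F' -> abscont D G G' ->
  abscont D (fun x => F x + G x) (fun k x => F' k x + G' k x).
Proof.
move=> [Fi FE] [Gi GE]; have mI := @measurable_Ico R; split => [k x y Dx Dy xy|x y Dx Dy xy].
  by apply: CintegrableD; [exact: mI|exact: Fi|exact: Gi].
rewrite (FE _ _ Dx Dy xy) (GE _ _ Dx Dy xy) addrACA -big_split/=; congr (_ + _).
by apply: eq_bigr => k _; rewrite CintD//; [exact: Fi|exact: Gi].
Qed.

Lemma ACZ D (F : R -> C) (F' : K -> R -> C) z : abscont D F F' -> abscont D (fun x => z * F x) (fun k x => z * F' k x).
Proof.
move=> [Fi FE]; have mI := @measurable_Ico R; split => [k x y Dx Dy xy|x y Dx Dy xy].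
  by apply: CintegrableZl; [exact: mI|exact: Fi].
rewrite (FE _ _ Dx Dy xy) mulrDr mulr_sumr; congr (_ + _).
by apply: eq_bigr => k _; rewrite CintZl//; exact: Fi.
Qed.

Lemma ACJ D (F : R -> C) (F' : K -> R -> C) : abscont D F F' ->
  abscont D (fun x => (F x)^*%C) (fun k x => (F' k x)^*%C).
Proof.
move=> [Fi FE]; have mI := @measurable_Ico R; split => [k x y Dx Dy xy|x y Dx Dy xy].
  by apply: CintegrableJ; [exact: mI|exact: Fi].
rewrite (FE _ _ Dx Dy xy) rmorphD rmorph_sum; congr (_ + _).
by apply: eq_bigr => k _; exact: esym (CintJ (mI x y) (Fi k _ _ Dx Dy xy)).
Qed.

Lemma AC_ext D (F : R -> C) (F' : K -> R -> C) (G : R -> C) (G' : K -> R -> C) : admissible D -> abscont D F F' -> (forall x, D x -> F x = G x) ->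
  (forall k x, D x -> F' k x = G' k x) -> abscont D G G'.
Proof.
move=> [cv _] [Fi FE] e e'.
have sub x y : D x -> D y -> forall t, Ico x y t -> D t.
  by move=> Dx Dy t /andP[xt /ltW ty]; exact: (cv x y).
split => [k x y Dx Dy xy|x y Dx Dy xy].
  apply: Cintegrable_ext (Fi k _ _ Dx Dy xy); first exact: measurable_Ico.
  by move=> t /(sub _ _ Dx Dy) Dt; rewrite e'.
rewrite -(e _ Dx) -(e _ Dy) (FE _ _ Dx Dy xy); congr (_ + _); apply: eq_bigr => k _.
by apply: eq_Cint => t /(sub _ _ Dx Dy) Dt; rewrite e'.
Qed.

Lemma ACS D E (F : R -> C) (F' : K -> R -> C) : E `<=` D -> abscont D F F' -> abscont E F F'.
Proof.
move=> ED [Fi FE]; split => [k x y /ED Dx /ED Dy xy|x y /ED Dx /ED Dy xy].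
  exact: Fi.
exact: FE.
Qed.

(** When one of the densities vanishes on [D], both sides are 0 whatever the atoms, so common atoms
    are excluded only for pairs of measures that really interact. *)
Lemma Cint_by_parts' D k l x y f g : admissible D -> D x -> D y ->
  (forall t, D t -> f t = 0) \/ (forall t, D t -> g t = 0) \/
    (forall t, D t -> m k [set t] = 0%E \/ m l [set t] = 0%E) ->
  Cintegrable (m k) (Ico x y) f -> Cintegrable (m l) (Ico x y) g ->
  Cint (m k) (Ico x y) f * Cint (m l) (Ico x y) g =
  Cint (m k) (Ico x y) (fun s => f s * Cint (m l) (Ico x s) g) +
  Cint (m l) (Ico x y) (fun t => g t * Cint (m k) (Ico x t) f).
Proof.
move=> aD Dx Dy; have [cv _] := aD.
have sub s : s <= y -> forall t, Ico x s t -> D t.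
  by move=> sy t /andP[xt /ltW ty]; apply: (cv x y) => //; exact: le_trans sy.
have z (k' : K) (h : R -> C) s : (forall t, D t -> h t = 0) -> s <= y ->
    Cint (m k') (Ico x s) h = 0.
  move=> h0 sy; rewrite -(Cint0 (m k') (Ico x s)); apply: eq_Cint => t /(sub _ sy).
  exact: h0.
have z' (k' : K) (h h' : R -> C) : (forall t, D t -> h t = 0) ->
    Cint (m k') (Ico x y) (fun t => h t * h' t) = 0.
  move=> h0; rewrite -(Cint0 (m k') (Ico x y)); apply: eq_Cint => t /(sub _ (lexx _)) Dt.
  by rewrite h0// mul0r.
have z'' (k' k'' : K) (h h' : R -> C) : (forall t, D t -> h t = 0) ->
    Cint (m k') (Ico x y) (fun t => h' t * Cint (m k'') (Ico x t) h) = 0.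
  move=> h0; rewrite -(Cint0 (m k') (Ico x y)); apply: eq_Cint => t /andP[xt /ltW ty].
  by rewrite z// mulr0.
move=> [f0|[g0|na]] fi gi.
- by rewrite (z k f y f0 (lexx y)) (z' k f _ f0) (z'' l k f g f0) addr0 mul0r.
- by rewrite (z l g y g0 (lexx y)) (z' l g _ g0) (z'' k l g f g0) addr0 mulr0.
- apply: Cint_by_parts => //; try exact: (admissible_Ico _ aD).
  by move=> t /(sub _ (lexx _)); exact: na.
Qed.

(** A common atom of two integrators would contribute the product of the jumps, and [na] excludes
    it. Integration by parts, for every pair of densities, is applied to the increments from [x];
    the terms with [F x] and [G x] are restored at the end. *)
Lemma AC_mul D (F : R -> C) (F' : K -> R -> C) (G : R -> C) (G' : K -> R -> C) : admissible D -> abscont D F F' -> abscont D G G' ->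
  (forall k l, (forall t, D t -> F' k t = 0) \/ (forall t, D t -> G' l t = 0) \/
    (forall t, D t -> m k [set t] = 0%E \/ m l [set t] = 0%E)) ->
  abscont D (fun x => F x * G x) (fun k x => F' k x * G x + G' k x * F x).
Proof.
move=> aD ACF ACG na; have mI := @measurable_Ico R.
have lF := AC_lbm aD ACF; have lG := AC_lbm aD ACG.
have [Fi FE] := ACF; have [Gi GE] := ACG.
have F'Gi k x y : D x -> D y -> x <= y -> Cintegrable (m k) (Ico x y) (fun t => F' k t * G t).
  by move=> Dx Dy xy; exact: (int_mul_lbm lG Dx Dy (Fi k _ _ Dx Dy xy)).
have G'Fi k x y : D x -> D y -> x <= y -> Cintegrable (m k) (Ico x y) (fun t => G' k t * F t).
  by move=> Dx Dy xy; exact: (int_mul_lbm lF Dx Dy (Gi k _ _ Dx Dy xy)).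
split => [k x y Dx Dy xy|x y Dx Dy xy].
  by apply: CintegrableD; [exact: mI|exact: F'Gi|exact: G'Fi].
have sub t : Ico x y t -> D t.
  by move=> /andP[xt /ltW ty]; apply: (aD.1 x y).
under eq_bigr => k _ do rewrite (CintD (mI x y) (F'Gi k _ _ Dx Dy xy) (G'Fi k _ _ Dx Dy xy)).
rewrite big_split/=.
have key : (F y - F x) * (G y - G x) =
    \sum_k Cint (m k) (Ico x y) (fun t => F' k t * (G t - G x)) +
    \sum_k Cint (m k) (Ico x y) (fun t => G' k t * (F t - F x)).
  rewrite (FE _ _ Dx Dy xy) (GE _ _ Dx Dy xy) ![_ x + _]addrC !addrK mulr_suml.
  under eq_bigr do rewrite mulr_sumr.
  under eq_bigr => k _ do under eq_bigr => l _ do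
    rewrite (Cint_by_parts' aD Dx Dy (na k l) (Fi k _ _ Dx Dy xy) (Gi l _ _ Dx Dy xy)).
  under eq_bigr do rewrite big_split/=.
  rewrite big_split/=; congr (_ + _); last rewrite exchange_big/=.
    apply: eq_bigr => k _; rewrite -Cint_sum//; last first.
      move=> l; apply: (@int_mul_lbm (Icc x y)); rewrite /Icc/= ?xy ?lexx//; last exact: Fi.
      move=> c d /andP[xc cy] /andP[xd dy].
      have sI : Icc c d `<=` Icc x y.
        by move=> t /andP[ct td]; rewrite /Icc/= (le_trans xc) ?(le_trans td).
      split.
        apply: cmeasS (measurable_Cint_Ico (Gi l _ _ Dx Dy xy)) => //.
        exact: measurable_Icc.
      exists (Rintegral (m l) (Ico x y) (fun x => n1 (G' l x))) => t /sI /andP[xt ty].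
      by apply: Cint_Ico_bound ty; exact: Gi.
    apply: eq_Cint => t /[dup] /sub Dt /andP[xt ty]; rewrite -mulr_sumr; congr (_ * _).
    by rewrite (GE x t)// [G x + _]addrC addrK.
  apply: eq_bigr => k _; rewrite -Cint_sum//; last first.
    move=> l; apply: (@int_mul_lbm (Icc x y)); rewrite /Icc/= ?xy ?lexx//; last exact: Gi.
    move=> c d /andP[xc cy] /andP[xd dy].
    have sI : Icc c d `<=` Icc x y.
      by move=> t /andP[ct td]; rewrite /Icc/= (le_trans xc) ?(le_trans td).
    split.
      apply: cmeasS (measurable_Cint_Ico (Fi l _ _ Dx Dy xy)) => //.
      exact: measurable_Icc.
    exists (Rintegral (m l) (Ico x y) (fun x => n1 (F' l x))) => t /sI /andP[xt ty].
    by apply: Cint_Ico_bound ty; exact: Fi.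
  apply: eq_Cint => t /[dup] /sub Dt /andP[xt ty]; rewrite -mulr_sumr; congr (_ * _).
  by rewrite (FE x t)// [F x + _]addrC addrK.
have e1 k : Cint (m k) (Ico x y) (fun t => F' k t * (G t - G x)) =
    Cint (m k) (Ico x y) (fun t => F' k t * G t) - Cint (m k) (Ico x y) (F' k) * G x.
  rewrite -CintZr//; last exact: Fi.
  rewrite -CintB//; [|exact: F'Gi|].
    by apply: eq_Cint => t _; rewrite mulrBr.
  by apply: Cintegrable_ext (CintegrableZl (G x) (mI _ _) (Fi k _ _ Dx Dy xy)) => // t _; rewrite mulrC.
have e2 k : Cint (m k) (Ico x y) (fun t => G' k t * (F t - F x)) =
    Cint (m k) (Ico x y) (fun t => G' k t * F t) - Cint (m k) (Ico x y) (G' k) * F x.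
  rewrite -CintZr//; last exact: Gi.
  rewrite -CintB//; [|exact: G'Fi|].
    by apply: eq_Cint => t _; rewrite mulrBr.
  by apply: Cintegrable_ext (CintegrableZl (F x) (mI _ _) (Gi k _ _ Dx Dy xy)) => // t _; rewrite mulrC.
move: key; rewrite (eq_bigr _ (fun k _ => e1 k)) (eq_bigr _ (fun k _ => e2 k)).
rewrite !sumrB -!mulr_suml.
have -> : \sum_k Cint (m k) (Ico x y) (F' k) = F y - F x.
  by rewrite (FE _ _ Dx Dy xy) [F x + _]addrC addrK.
have -> : \sum_k Cint (m k) (Ico x y) (G' k) = G y - G x.
  by rewrite (GE _ _ Dx Dy xy) [G x + _]addrC addrK.
set A := \sum_k _; set B := \sum_k _.
move: A B (F x) (F y) (G x) (G y) => A B Fx Fy Gx Gy key.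
have -> : A + B = (A - (Fy - Fx) * Gx + (B - (Gy - Gx) * Fx)) + (Fy - Fx) * Gx + (Gy - Gx) * Fx.
  by ring.
by rewrite -key; ring.
Qed.

End AbsolutelyContinuous.

(** * Volterra systems *)

Section Volterra.
Variable R : realType.
Local Notation Msr := {measure set R -> \bar R}.
Variables (K : finType) (m : K -> Msr) (D : set R) (c : R).
Hypotheses (aD : admissible m D) (Dc : D c).
Implicit Types (f g h : R -> R).

Definition rlb f := forall d, D d -> c <= d ->
  measurable_fun (Icc c d) f /\ exists M, forall x, Icc c d x -> `|f x| <= M.

(** Integration against the sum of all the measures, the scalar operator that majorises the
    system. *)
Definition vint h x := \sum_k Rintegral (m k) (Ico c x) h.

Lemma rlb_cst r : rlb (fun => r).
Proof. by move=> d Dd cd; split; [exact: measurable_cst|exists `|r|]. Qed.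

Lemma rlbD f g : rlb f -> rlb g -> rlb (fun x => f x + g x).
Proof.
move=> lf lg d Dd cd; have [mf [M fM]] := lf _ Dd cd; have [mg [N gN]] := lg _ Dd cd.
split; first exact: measurable_funD.
exists (M + N) => x xcd; rewrite (le_trans (ler_normD _ _))// lerD//; [exact: fM|exact: gN].
Qed.

Lemma rlbM f g : rlb f -> rlb g -> rlb (fun x => f x * g x).
Proof.
move=> lf lg d Dd cd; have [mf [M fM]] := lf _ Dd cd; have [mg [N gN]] := lg _ Dd cd.
split; first exact: measurable_funM.
exists (M * N) => x xcd; rewrite normrM ler_pM//; [exact: fM|exact: gN].
Qed.

Lemma rlb_norm f : rlb f -> rlb (fun x => `|f x|).
Proof.
move=> lf d Dd cd; have [mf [M fM]] := lf _ Dd cd; split; first exact: measurableT_comp.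
by exists M => x xcd; rewrite normr_id; exact: fM.
Qed.

Lemma rlb_sum (J : Type) (r : seq J) (F : J -> R -> R) : (forall j, rlb (F j)) ->
  rlb (fun x => \sum_(j <- r) F j x).
Proof.
move=> lF; elim: r => [|j r IH].
  by under eq_fun do rewrite big_nil; exact: rlb_cst.
by under eq_fun do rewrite big_cons; exact: rlbD.
Qed.

Lemma rlb_int f k x : rlb f -> D x -> c <= x -> (m k).-integrable (Ico c x) (EFin \o f).
Proof.
move=> lf Dx cx; have [mf [M fM]] := lf _ Dx cx.
apply: (integrable_bounded (M := M)).
- exact: measurable_Ico.
- exact: (admissible_Ico k aD).
- apply: measurable_funS mf; [exact: measurable_Icc|exact: Ico_sub_Icc].
- by move=> t /Ico_sub_Icc; exact: fM.
Qed.

Lemma Ico_dom x t : D x -> Ico c x t -> D t /\ c <= t.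
Proof. by move=> Dx /andP[ct /ltW tx]; split => //; exact: (aD.1 c x). Qed.

Lemma Rint_Ico_bound f k d x : rlb f -> D d -> c <= x -> x <= d ->
  `|Rintegral (m k) (Ico c x) f| <= Rintegral (m k) (Ico c d) (fun t => `|f t|).
Proof.
move=> lf Dd cx xd; have cd := le_trans cx xd.
have mI := @measurable_Ico R; have sub := IcoS (lexx c) xd.
have fi := rlb_int k lf Dd cd.
have fix_ := integrableS (mI c d) (mI c x) sub fi.
rewrite (le_trans (le_normr_Rintegral (mI c x) fix_))//.
by apply: le_Rintegral_set => //; exact: integrable_norm.
Qed.

Lemma rlb_Rint f k : rlb f -> rlb (fun x => Rintegral (m k) (Ico c x) f).
Proof.
move=> lf d Dd cd; split.
  by apply: measurable_Rintegral_Ico; exact: rlb_int.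
exists (Rintegral (m k) (Ico c d) (fun x => `|f x|)) => x /andP[cx xd].
exact: Rint_Ico_bound.
Qed.

Lemma rlb_vint f : rlb f -> rlb (vint f).
Proof. by move=> lf; apply: rlb_sum => k; exact: rlb_Rint. Qed.

Lemma le_vint f g x : rlb f -> rlb g -> D x -> c <= x ->
  (forall t, Ico c x t -> f t <= g t) -> vint f x <= vint g x.
Proof.
move=> lf lg Dx cx fg; apply: ler_sum => k _; apply: le_Rintegral => //.
- exact: measurable_Ico.
- exact: rlb_int.
- exact: rlb_int.
Qed.

Lemma vint_ge0 f x : (forall t, Ico c x t -> 0 <= f t) -> 0 <= vint f x.
Proof. by move=> f0; apply: sumr_ge0 => k _; exact: Rintegral_ge0. Qed.

Lemma vint_mono f x y : rlb f -> D y -> c <= x -> x <= y ->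
  (forall t, Ico c y t -> 0 <= f t) -> vint f x <= vint f y.
Proof.
move=> lf Dy cx xy f0; apply: ler_sum => k _; apply: le_Rintegral_set => //.
- exact: measurable_Ico.
- exact: measurable_Ico.
- exact: IcoS.
- by apply: rlb_int => //; exact: le_trans xy.
Qed.

Lemma vintZ r f x : rlb f -> D x -> c <= x -> vint (fun t => r * f t) x = r * vint f x.
Proof.
move=> lf Dx cx; rewrite /vint mulr_sumr; apply: eq_bigr => k _.
by rewrite RintegralZl//; [exact: measurable_Ico|exact: rlb_int].
Qed.

Lemma Rint_sum (J : Type) (r : seq J) (F : J -> R -> R) k x : (forall j, rlb (F j)) ->
  D x -> c <= x ->
  Rintegral (m k) (Ico c x) (fun t => \sum_(j <- r) F j t) =
  \sum_(j <- r) Rintegral (m k) (Ico c x) (F j).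
Proof.
move=> lF Dx cx; elim: r => [|j r IH].
  rewrite big_nil /Rintegral; under eq_integral do rewrite big_nil.
  by rewrite integral0.
rewrite big_cons -IH -RintegralD//; last first.
- by apply: rlb_int => //; exact: rlb_sum.
- exact: rlb_int.
- exact: measurable_Ico.
by apply: eq_Rintegral => t _; rewrite big_cons.
Qed.

(** Without atoms this is the product rule, with equality. Atoms only enlarge the right side: there
    the diagonal is counted through [Icc c t], which contains [Ico c t], and the functions are
    nonnegative. *)
Lemma vint_mul_ge f g x : rlb f -> rlb g -> D x -> c <= x ->
  (forall t, Ico c x t -> 0 <= f t) -> (forall t, Ico c x t -> 0 <= g t) ->
  vint (fun t => f t * vint g t) x + vint (fun t => g t * vint f t) x
  <= vint f x * vint g x.
Proof.
move=> lf lg Dx cx f0 g0; rewrite (_ : vint f x * vint g x = \sum_k \sum_l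
    Rintegral (m k) (Ico c x) f * Rintegral (m l) (Ico c x) g); last first.
  by rewrite /vint mulr_suml; apply: eq_bigr => k _; rewrite mulr_sumr.
have fin k : (m k (Ico c x) < +oo)%E by exact: (admissible_Ico k aD).
have fi k : (m k).-integrable (Ico c x) (EFin \o f) by exact: rlb_int.
have gi k : (m k).-integrable (Ico c x) (EFin \o g) by exact: rlb_int.
under [leRHS]eq_bigr => k _ do under eq_bigr => l _ do
  rewrite (Rintegral_product_Icc (fin k) (fin l) (fi k) (gi l)).
under [leRHS]eq_bigr do rewrite big_split/=.
rewrite big_split/= lerD//.
  apply: ler_sum => k _.
  rewrite (_ : Rintegral _ _ _ = \sum_l Rintegral (m k) (Ico c x)
     (fun t => f t * Rintegral (m l) (Ico c t) g)); last first.
    rewrite -Rint_sum//; last by move=> l; apply: rlbM => //; exact: rlb_Rint.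
    by apply: eq_Rintegral => t _; rewrite /vint mulr_sumr.
  apply: ler_sum => l _; apply: le_Rintegral.
  - exact: measurable_Ico.
  - by apply: rlb_int => //; apply: rlbM => //; exact: rlb_Rint.
  - apply: (integrable_mul_bounded (M := Rintegral (m l) (Ico c x) g)) => //.
    + exact: measurable_Ico.
    + exact: measurable_Rintegral_Icc.
    + move=> t /andP[ct tx]; have sub : Icc c t `<=` Ico c x.
        by move=> s /andP[cs st]; rewrite /Ico/= cs (le_lt_trans st).
      rewrite ger0_norm; last by apply: Rintegral_ge0 => s /sub; exact: g0.
      apply: le_Rintegral_set => //; [exact: measurable_Icc|exact: measurable_Ico].
  move=> t tx; apply: ler_wpM2l; first exact: f0.
  have sub : Icc c t `<=` Ico c x.
    move: tx => /andP[ct tx].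
    by move=> s /andP[cs st]; rewrite /Ico/= cs (le_lt_trans st).
  apply: le_Rintegral_set => //.
  - exact: measurable_Ico.
  - exact: measurable_Icc.
  - exact: Ico_sub_Icc.
  - apply: integrableS (gi l) => //; [exact: measurable_Ico|exact: measurable_Icc].
  - by move=> s /sub; exact: g0.
rewrite exchange_big/=; apply: ler_sum => l _.
rewrite -Rint_sum//; last by move=> k; apply: rlbM => //; exact: rlb_Rint.
rewrite le_eqVlt; apply/orP; left; apply/eqP.
by apply: eq_Rintegral => t _; rewrite /vint mulr_sumr.
Qed.

Definition vpow n := iter n vint (fun => 1).

Lemma rlb_vpow n : rlb (vpow n).
Proof. by elim: n => [|n IH]; [exact: rlb_cst|exact: rlb_vint]. Qed.

Lemma vpow_ge0 n x : 0 <= vpow n x.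
Proof. by elim: n x => [|n IH] x; [exact: ler01|exact: vint_ge0]. Qed.

(** Source of the factorial bound on iterated integrals. Taking [1] and [vpow n] in [vint_mul_ge],
    one term is [vpow n.+2] and the other dominates [n.+1] copies of it by the induction
    hypothesis. *)
Lemma vpow_step n x : D x -> c <= x -> n.+1%:R * vpow n.+1 x <= vpow 1 x * vpow n x.
Proof.
elim: n x => [|n IH] x Dx cx; first by rewrite mul1r /vpow /= mulr1.
apply: le_trans (vint_mul_ge (rlb_cst 1) (rlb_vpow n) Dx cx _ _); last first.
- by move=> t _; exact: vpow_ge0.
- by move=> t _; exact: ler01.
rewrite (_ : n.+2%:R = 1 + n.+1%:R); last by rewrite -natr1 addrC.
rewrite mulrDl mul1r lerD//.
  apply: (@le_vint (vpow n.+1)) => //; first exact: rlb_vpow.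
    by apply: rlbM; [exact: rlb_cst|exact: (rlb_vpow n.+1)].
  by move=> t _; rewrite mul1r.
rewrite -[vpow n.+2]/(vint (vpow n.+1)) -vintZ//; last exact: rlb_vpow.
apply: le_vint => //.
- by apply: rlbM; [exact: rlb_cst|exact: rlb_vpow].
- by apply: rlbM; [exact: rlb_vpow|exact: (rlb_vpow 1)].
- move=> t /(Ico_dom Dx)[Dt ct]; rewrite mulrC [leRHS]mulrC mulrC.
  exact: IH.
Qed.

(** The bound V^n / n!, with V the total mass of [[c, d)], holds in the presence of atoms too. It
    makes the iteration converge on the whole interval without any smallness assumption. *)
Lemma vpow_le n x d : D d -> c <= x -> x <= d -> vpow n x <= exp_coeff (vpow 1 d) n.
Proof.
move=> Dd cx xd; have Dx : D x by exact: (aD.1 c d).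
elim: n => [|n IH]; first by rewrite /exp_coeff/= expr0 fact0 invr1 mulr1.
have := vpow_step n Dx cx; rewrite -ler_pdivlMl// => /le_trans; apply.
rewrite (_ : exp_coeff _ _ = n.+1%:R^-1 * (vpow 1 d * exp_coeff (vpow 1 d) n)); last first.
  rewrite /exp_coeff/= exprS factS natrM invfM.
  move: (vint _ _) => v; move: (n.+1%:R^-1) => r; move: (n`!%:R^-1) (v ^+ n) => s u; ring.
rewrite ler_pM2l ?invr_gt0// ler_pM//; [exact: vpow_ge0|exact: vpow_ge0|].
by apply: vint_mono => //; exact: rlb_cst.
Qed.

End Volterra.

Lemma series_tail (R : realType) (u e : R^nat) N : (forall n, `|u n| <= e n) ->
  cvgn (series e) ->
  cvgn (series u) /\ `|limn (series u) - series u N| <= limn (series e) - series e N.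
Proof.
move=> ue ce.
have cu : cvgn (series u).
  apply: normed_cvg; apply: series_le_cvg ce => //= n.
  exact: le_trans (normr_ge0 _) (ue n).
split => //.
have c1 : `|series u n - series u N| @[n --> \oo] --> `|limn (series u) - series u N|.
  by apply: cvg_norm; apply: cvgB => //; exact: cvg_cst.
have c2 : series e n - series e N @[n --> \oo] --> limn (series e) - series e N.
  by apply: cvgB => //; exact: cvg_cst.
apply: ler_cvg_to c1 c2 _; near=> n.
have Nn : (N <= n)%N by near: n; exact: nbhs_infty_ge.
rewrite !sub_series_geq// (le_trans (ler_norm_sum _ _ _))//; apply: ler_sum => i _; exact: ue.
Unshelve. all: by end_near. Qed.

(** * Uniqueness and existence for linear Volterra systems *)

Section VolterraSystem.
Variable R : realType.
Local Notation Msr := {measure set R -> \bar R}.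
Variables (K : finType) (m : K -> Msr) (D : set R) (c : R).
Hypotheses (aD : admissible m D) (Dc : D c).
Variables (I : finType) (A : K -> I -> I -> R).
Implicit Types (y z : I -> R -> R).
Local Notation rlb := (rlb D c).
Local Notation vint := (vint m c).
Local Notation vpow := (vpow m c).

Definition vsys y i x :=
  \sum_k Rintegral (m k) (Ico c x) (fun t => \sum_j A k i j * y j t).
Definition vnrm y t := \sum_i `|y i t|.
(** [a] bounds every entry of every coefficient matrix, and [L] is the resulting Lipschitz constant
    of the system in the l1 norm [vnrm]. *)
Let a : R := \sum_(p : K * I * I) `|A p.1.1 p.1.2 p.2|.
Let L : R := #|I|%:R * a.

Let a_ge k i j : `|A k i j| <= a.
Proof. by rewrite /a (bigD1 (k, i, j))//= lerDl sumr_ge0. Qed.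

Let a_ge0 : 0 <= a. Proof. exact: sumr_ge0. Qed.
Let L_ge0 : 0 <= L. Proof. by rewrite mulr_ge0. Qed.

Lemma rlb_row y k i : (forall i, rlb (y i)) -> rlb (fun t => \sum_j A k i j * y j t).
Proof.
by move=> ly; apply: rlb_sum => j; apply: rlbM; [exact: rlb_cst|exact: ly].
Qed.

Lemma rlb_vsys y i : (forall i, rlb (y i)) -> rlb (vsys y i).
Proof.
by move=> ly; apply: rlb_sum => k; apply: (rlb_Rint aD) => //; exact: rlb_row.
Qed.

Lemma rlb_vnrm y : (forall i, rlb (y i)) -> rlb (vnrm y).
Proof. by move=> ly; apply: rlb_sum => i; exact: rlb_norm. Qed.

Lemma le_vnrm y i x : `|y i x| <= vnrm y x.
Proof. by rewrite /vnrm (bigD1 i)//= lerDl sumr_ge0. Qed.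

Lemma vsys_le y i x : (forall i, rlb (y i)) -> D x -> c <= x ->
  `|vsys y i x| <= a * vint (vnrm y) x.
Proof.
move=> ly Dx cx; rewrite /vint mulr_sumr (le_trans (ler_norm_sum _ _ _))// ler_sum// => k _.
have mI := measurable_Ico c x.
have ri := rlb_int aD Dc k (rlb_row k i ly) Dx cx.
rewrite (le_trans (le_normr_Rintegral mI ri))//.
have ni := rlb_int aD Dc k (rlb_vnrm ly) Dx cx.
rewrite -RintegralZl//; apply: le_Rintegral => //.
- exact: integrable_norm.
- exact: integrableZr'.
move=> t _; rewrite (le_trans (ler_norm_sum _ _ _))// /vnrm mulr_sumr ler_sum// => j _.
by rewrite normrM ler_wpM2r.
Qed.

Lemma vnrm_vsys y x : (forall i, rlb (y i)) -> D x -> c <= x ->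
  vnrm (vsys y) x <= L * vint (vnrm y) x.
Proof.
move=> ly Dx cx; apply: (@le_trans _ _ (\sum_(i : I) a * vint (vnrm y) x)).
  by apply: ler_sum => i _; exact: vsys_le.
by rewrite sumr_const -mulr_natl mulrA.
Qed.

Lemma vsysD y z i x : (forall i, rlb (y i)) -> (forall i, rlb (z i)) -> D x -> c <= x ->
  vsys (fun i t => y i t + z i t) i x = vsys y i x + vsys z i x.
Proof.
move=> ly lz Dx cx; rewrite /vsys -big_split/=; apply: eq_bigr => k _.
rewrite -RintegralD//; [|exact: measurable_Ico| |].
- by apply: eq_Rintegral => t _; rewrite -big_split/=; apply: eq_bigr => j _; rewrite mulrDr.
- by apply: (rlb_int aD) => //; exact: rlb_row.
- by apply: (rlb_int aD) => //; exact: rlb_row.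
Qed.

Lemma vsysN y i x : (forall i, rlb (y i)) -> D x -> c <= x ->
  vsys (fun i t => - y i t) i x = - vsys y i x.
Proof.
move=> ly Dx cx; rewrite /vsys -sumrN; apply: eq_bigr => k _.
rewrite -mulN1r -RintegralZl//; [|exact: measurable_Ico|].
- by apply: eq_Rintegral => t _; rewrite mulN1r -sumrN; apply: eq_bigr => j _; rewrite mulrN.
- by apply: (rlb_int aD) => //; exact: rlb_row.
Qed.

Lemma rlbN f : rlb f -> rlb (fun t => - f t).
Proof.
move=> lf; under eq_fun do rewrite -mulN1r; apply: rlbM => //; exact: rlb_cst.
Qed.

Lemma exp_coeffZ (M r : R) n : r ^+ n * exp_coeff M n = exp_coeff (r * M) n.
Proof. by rewrite /exp_coeff/= exprMn mulrA. Qed.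

Lemma exp_coeff_cvg0 (r : R) : exp_coeff r n @[n --> \oo] --> 0.
Proof. exact/cvg_series_cvg_0/is_cvg_series_exp_coeff. Qed.

(** A Gronwall argument: inserting the equation into itself n times bounds [y] by M times the n-th
    coefficient of an exponential series, which tends to 0. *)
Lemma vsys_unique y : (forall i, rlb (y i)) ->
  (forall i x, D x -> c <= x -> y i x = vsys y i x) ->
  forall i x, D x -> c <= x -> y i x = 0.
Proof.
move=> ly ye i x Dx cx.
have [_ [M nM]] := rlb_vnrm ly Dx cx.
have M0 : 0 <= M by rewrite (le_trans _ (nM x _))// /Icc/= ?cx ?lexx.
have bnd n t : c <= t -> t <= x -> vnrm y t <= M * (L ^+ n * vpow n t).
  elim: n t => [|n IH] t ct tx.
    rewrite expr0 mul1r mulr1 (le_trans _ (nM t _))//; first exact: ler_norm.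
    by rewrite /Icc/= ct.
  have Dt : D t by exact: (aD.1 c x).
  have -> : vnrm y t = vnrm (vsys y) t by apply: eq_bigr => j _; rewrite -ye.
  rewrite (le_trans (vnrm_vsys ly Dt ct))// exprS -mulrA mulrCA ler_wpM2l//.
  rewrite mulrA -[vpow n.+1]/(vint (vpow n)) -(vintZ aD Dc)//; last exact: rlb_vpow.
  apply: (le_vint aD Dc) => //; first exact: rlb_vnrm.
    by apply: rlbM; [exact: rlb_cst|exact: rlb_vpow].
  by move=> s /andP[cs st]; rewrite -mulrA IH// (le_trans (ltW st)).
apply/eqP; rewrite -normr_le0.
have lim0 : M * exp_coeff (L * vpow 1 x) n @[n --> \oo] --> M * 0.
  by apply: cvgM; [exact: cvg_cst|exact: exp_coeff_cvg0].
rewrite mulr0 in lim0.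
apply: ler_cvg_to (cvg_cst _) lim0 _; near=> n.
rewrite (le_trans (le_vnrm y i x))// (le_trans (bnd n x cx (lexx _)))//.
rewrite -exp_coeffZ ler_wpM2l// ler_wpM2l ?exprn_ge0//.
exact: (vpow_le aD Dc).
Unshelve. all: by end_near. Qed.

(** The solution is the Neumann series of the iterates of [vsys] on [y0]. On each [[c, x]] it is
    dominated by an exponential series, and the uniform bound on its tails carries the limit through
    the integrals. *)
Lemma vsys_exists (y0 : I -> R -> R) : (forall i, rlb (y0 i)) ->
  exists y, (forall i, rlb (y i)) /\
    forall i x, D x -> c <= x -> y i x = y0 i x + vsys y i x.
Proof.
move=> ly0.
pose v n := iter n vsys y0.
have lv n i : rlb (v n i) by elim: n i => [|n IH] i //=; exact: rlb_vsys.
pose P N := fun i x => series (fun n => v n i x) N.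
have lP N i : rlb (P N i) by apply: rlb_sum => n; exact: lv.
pose Y := fun i x => limn (series (fun n => v n i x)).
pose e M W := fun n => M * exp_coeff W n : R.
have bnd x : D x -> c <= x -> exists M W, forall i t n, c <= t -> t <= x ->
    `|v n i t| <= e M W n.
  move=> Dx cx; have [_ [M nM]] := rlb_vnrm ly0 Dx cx.
  have M0 : 0 <= M by rewrite (le_trans _ (nM x _))// /Icc/= ?cx ?lexx.
  exists M, (L * vpow 1 x).
  have bn n t : c <= t -> t <= x -> vnrm (v n) t <= M * (L ^+ n * vpow n t).
    elim: n t => [|n IH] t ct tx.
      rewrite expr0 mul1r mulr1 (le_trans _ (nM t _))//; first exact: ler_norm.
      by rewrite /Icc/= ct.
    have Dt : D t by exact: (aD.1 c x).
    rewrite (le_trans (vnrm_vsys (lv n) Dt ct))// exprS -mulrA mulrCA ler_wpM2l//.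
    rewrite mulrA -[vpow n.+1]/(vint (vpow n)) -(vintZ aD Dc)//; last exact: rlb_vpow.
    apply: (le_vint aD Dc) => //; first exact: rlb_vnrm.
      by apply: rlbM; [exact: rlb_cst|exact: rlb_vpow].
    by move=> s /andP[cs st]; rewrite -mulrA IH// (le_trans (ltW st)).
  move=> i t n ct tx; rewrite (le_trans (le_vnrm _ i t))// (le_trans (bn n t ct tx))//.
  rewrite /e -exp_coeffZ ler_wpM2l// ler_wpM2l ?exprn_ge0//.
  exact: (vpow_le aD Dc).
have ce M W : cvgn (series (e M W)).
  have -> : series (e M W) = (fun n => M * series (exp_coeff W) n).
    by apply/funext => n; rewrite /series/= mulr_sumr.
  by apply: is_cvgM; [exact: is_cvg_cst|exact: is_cvg_series_exp_coeff].
have tail0 M W : limn (series (e M W)) - series (e M W) N @[N --> \oo] --> 0.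
  rewrite -[X in _ --> X](subrr (limn (series (e M W)))).
  by apply: cvgB; [exact: cvg_cst|exact: ce].
have lY i : rlb (Y i).
  move=> d Dd cd; have [M [W Mv]] := bnd d Dd cd; split.
    apply: (@measurable_fun_cvg _ _ _ _ (fun n => P n i)).
      by move=> n; have [] := lP n i d Dd cd.
    by move=> t /andP[ct td]; have [] := series_tail 0 (fun n => Mv i t n ct td) (ce M W).
  exists (limn (series (e M W)) - series (e M W) 0) => t /andP[ct td].
  have [_] := series_tail 0 (fun n => Mv i t n ct td) (ce M W).
  by rewrite {2}/series/= big_geq// subr0.
have step N i x : D x -> c <= x -> P N.+1 i x = y0 i x + vsys (P N) i x.
  move=> Dx cx; elim: N => [|N IH].
    rewrite /P /series/= big_nat1 (_ : vsys _ _ _ = 0) ?addr0//.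
    rewrite /vsys big1// => k _; rewrite /Rintegral (eq_integral (fun=> 0%E)) ?integral0//.
    by move=> t _; rewrite big1// => j _; rewrite big_geq// mulr0.
  have PS n j t : P n.+1 j t = P n j t + v n j t by rewrite /P /series/= big_nat_recr.
  rewrite PS IH -addrA; congr (_ + _).
  have -> : P N.+1 = fun j t => P N j t + v N j t by apply/funext => j; apply/funext => t.
  by rewrite -[v N.+1 i x]/(vsys (v N) i x) -vsysD.
exists Y; split => // i x Dx cx.
have [M [W Mv]] := bnd x Dx cx.
have tl N j t : c <= t -> t <= x -> `|Y j t - P N j t| <= limn (series (e M W)) - series (e M W) N.
  by move=> ct tx; have [] := series_tail N (fun n => Mv j t n ct tx) (ce M W).
have cP : P N.+1 i x @[N --> \oo] --> Y i x.
  rewrite (cvg_shiftS (fun N => P N i x)).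
  by have [] := series_tail 0 (fun n => Mv i x n cx (lexx x)) (ce M W).
have cV : y0 i x + vsys (P N) i x @[N --> \oo] --> y0 i x + vsys Y i x.
  apply: cvgD; first exact: cvg_cst.
  apply/cvgrPdist_le => eps eps0.
  have C0 : 0 <= a * (vint (fun => #|I|%:R) x) by rewrite mulr_ge0// vint_ge0.
  (* The added 1 keeps the divisor positive even when the measures have no mass on [[c, x)]. *)
  pose C := a * (vint (fun => #|I|%:R) x) + 1.
  have Cp : 0 < C by rewrite ltr_wpDl.
  have eC : 0 < eps / C by rewrite divr_gt0.
  move/cvgrPdist_le : (tail0 M W) => /(_ _ eC) tail.
  near=> N.
  have hN : `|0 - (limn (series (e M W)) - series (e M W) N)| <= eps / C by near: N; exact: tail.
  rewrite sub0r normrN in hN.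
  have := vsysD (z := fun j t => - P N j t) i lY (fun j => rlbN (lP N j)) Dx cx.
  rewrite vsysN// => <-.
  rewrite (le_trans (vsys_le _ _ Dx cx))//.
    by move=> j; apply: rlbD => //; exact: rlbN.
  set r := _ - _ in hN.
  have le1 : vint (vnrm (fun j t => Y j t + - P N j t)) x <= r * vint (fun => #|I|%:R) x.
    rewrite -(vintZ aD Dc)//; last exact: rlb_cst.
    apply: (le_vint aD Dc) => //.
    - by apply: rlb_vnrm => j; apply: rlbD => //; exact: rlbN.
    - by apply: rlbM; exact: rlb_cst.
    move=> t /andP[ct tx]; rewrite mulr_natr -sumr_const; apply: ler_sum => j _.
    by apply: tl => //; exact: ltW.
  rewrite (le_trans (ler_wpM2l _ le1))// mulrCA.
  rewrite (@le_trans _ _ (eps / C * (C - 1)))//.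
    rewrite [in C - 1]/C addrK ler_wpM2r//; exact: le_trans (ler_norm _) hN.
  by rewrite mulrBr mulr1 divfK ?gt_eqF// lerBlDr lerDl ltW.
apply: (cvg_unique _ cP); first exact: Rhausdorff.
rewrite (_ : (fun N => P N.+1 i x) = (fun N => y0 i x + vsys (P N) i x))//=.
by apply/funext => N; exact: step.
Unshelve. all: by end_near. Qed.

End VolterraSystem.

Lemma integrable_disjointU (R : realType) (mu : {measure set R -> \bar R}) (A B : set R)
    (f : R -> \bar R) : measurable A -> measurable B -> [disjoint A & B] ->
  mu.-integrable A f -> mu.-integrable B f -> mu.-integrable (A `|` B) f.
Proof.
move=> mA mB AB /integrableP[mfA fA] /integrableP[mfB fB].
have mf : measurable_fun (A `|` B) f by apply/measurable_funU.
apply/integrableP; split => //.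
rewrite ge0_integral_setU//; first exact: lte_add_pinfty.
exact: measurableT_comp.
Qed.

(** * The first order system *)

Section SturmLiouville.
Variable R : realType.
Local Notation C := (R[i]).
Local Notation Msr := {measure set R -> \bar R}.
Variables (K : finType) (m : K -> Msr) (k0 : K) (s q : K -> R).
Implicit Types (D : set R) (f p g : R -> C) (z w : C).

Definition dlt (k : K) : R := (k == k0)%:R.

(* df = p (sum_k s_k dm_k) and dp = f (sum_k q_k dm_k) - g dm_k0; in the notation of [tau_rel],
   p is df/dsigma corrected on a null set, that is p = int f dchi - F. *)
Definition qd D f p g :=
  abscont m D f (fun k x => (s k)%:C%C * p x) /\
  abscont m D p (fun k x => (q k)%:C%C * f x - (dlt k)%:C%C * g x).

(** The pair [(k, l)] matters only if [m k] drives [f] ([s k] nonzero) and [m l] drives [p] ([q l]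
    nonzero or [l = k0]). Only then are common atoms forbidden. *)
Definition noatoms D := forall k l, s k = 0 \/ (q l = 0 /\ l != k0) \/
  forall t, D t -> m k [set t] = 0%E \/ m l [set t] = 0%E.

Definition wr f p f2 p2 (x : R) : C := f x * p2 x - p x * f2 x.

Lemma noatomsS D E : E `<=` D -> noatoms D -> noatoms E.
Proof.
by move=> ED na k l; have [?|[?|h]] := na k l; [left|right; left|right; right => t /ED /h].
Qed.

Lemma sum_dlt E (h : R -> C) :
  \sum_k Cint (m k) E (fun x => (dlt k)%:C%C * h x) = Cint (m k0) E h.
Proof.
rewrite (bigD1 k0)//= big1 ?addr0 => [|k kk0].
  by apply: eq_Cint => x _; rewrite /dlt eqxx mul1r.
rewrite -(Cint0 (m k) E); apply: eq_Cint => x _.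
by rewrite /dlt (negbTE kk0) mul0r.
Qed.

Lemma dlt_int D E (h : R -> C) k : measurable E ->
  Cintegrable (m k0) E h -> Cintegrable (m k) E (fun x => (dlt k)%:C%C * h x).
Proof.
move=> mE hi; rewrite /dlt; have [->|_] := eqVneq k k0.
  exact: CintegrableZl.
by under eq_fun do rewrite mul0r; exact: Cintegrable0.
Qed.

(** In the derivatives of [f * p2] and [f2 * p] the terms [p * p2] and [f * f2] carry the same
    coefficients and cancel in the difference; only the terms with [g] and [g2] remain. The absence
    of interacting atoms allows the product rule. *)
Lemma lagrange D f p g f2 p2 g2 : admissible m D -> noatoms D ->
  qd D f p g -> qd D f2 p2 g2 ->
  abscont m D (wr f p f2 p2) (fun k x => (dlt k)%:C%C * (g x * f2 x - f x * g2 x)).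
Proof.
move=> aD na [af ap] [af2 ap2].
have P1 : abscont m D _ _ := AC_mul aD af ap2 _.
have P2 : abscont m D _ _ := AC_mul aD af2 ap _.
have nz (u v w : R -> C) k l : (forall t, D t -> (s k)%:C%C * u t = 0) \/
    (forall t, D t -> (q l)%:C%C * v t - (dlt l)%:C%C * w t = 0) \/
    (forall t, D t -> m k [set t] = 0%E \/ m l [set t] = 0%E).
  have [s0|[[q0 lk0]|h]] := na k l.
  - by left => t _; rewrite s0 mul0r.
  - by right; left => t _; rewrite q0 /dlt (negbTE lk0) !mul0r subr0.
  - by right; right.
have Q := ACD (P1 (nz _ _ _)) (ACZ (-1) (P2 (nz _ _ _))).
apply: (AC_ext aD Q) => [x _|k x _]; rewrite /wr; ring.
Qed.

Lemma lagrange_int D f p g f2 p2 g2 x y : admissible m D -> noatoms D ->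
  qd D f p g -> qd D f2 p2 g2 -> D x -> D y -> x <= y ->
  wr f p f2 p2 y = wr f p f2 p2 x +
    Cint (m k0) (Ico x y) (fun t => g t * f2 t - f t * g2 t).
Proof.
move=> aD na qf qf2 Dx Dy xy; have [_ E] := lagrange aD na qf qf2.
by rewrite (E _ _ Dx Dy xy) sum_dlt.
Qed.

Lemma qd_lin D f p g f2 p2 g2 z w : admissible m D -> qd D f p g -> qd D f2 p2 g2 ->
  qd D (fun x => z * f x + w * f2 x) (fun x => z * p x + w * p2 x)
    (fun x => z * g x + w * g2 x).
Proof.
move=> aD [af ap] [af2 ap2]; split.
  by apply: (AC_ext aD (ACD (ACZ z af) (ACZ w af2))) => // k x _; ring.
by apply: (AC_ext aD (ACD (ACZ z ap) (ACZ w ap2))) => // k x _; ring.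
Qed.

Lemma qd_conj D f p g : admissible m D -> qd D f p g ->
  qd D (fun x => (f x)^*%C) (fun x => (p x)^*%C) (fun x => (g x)^*%C).
Proof.
move=> aD [af ap]; split.
  by apply: (AC_ext aD (ACJ af)) => // k x _; rewrite rmorphM; congr (_ * _); exact: conjc_real.
apply: (AC_ext aD (ACJ ap)) => // k x _.
by rewrite rmorphB !rmorphM; congr (_ * _ - _ * _); exact: conjc_real.
Qed.

Lemma qd_ext D f p g f2 p2 g2 : admissible m D -> qd D f p g ->
  (forall x, D x -> f x = f2 x) -> (forall x, D x -> p x = p2 x) ->
  (forall x, D x -> g x = g2 x) -> qd D f2 p2 g2.
Proof.
move=> aD [af ap] ef ep eg; split.
  by apply: (AC_ext aD af) => // k x Dx; rewrite ep.
by apply: (AC_ext aD ap) => // k x Dx; rewrite ef ?eg.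
Qed.

Lemma qdS D E f p g : E `<=` D -> qd D f p g -> qd E f p g.
Proof. by move=> ED [af ap]; split; exact: ACS ED _. Qed.

Lemma qd_lbm D f p g : admissible m D -> qd D f p g -> lbm D f /\ lbm D p.
Proof. by move=> aD [af ap]; split; [exact: AC_lbm af|exact: AC_lbm ap]. Qed.

Definition from D c := [set x | D x /\ c <= x].

Lemma fromS D c : from D c `<=` D. Proof. by move=> x []. Qed.

Lemma admissibleS D c : admissible m D -> admissible m (from D c).
Proof.
move=> [cv fin]; split => [x y t [Dx cx] [Dy _] xt ty|k x y [Dx _] [Dy _]].
  by split; [exact: (cv x y)|exact: le_trans xt].
exact: fin.
Qed.

Lemma AC_base D c (F : R -> C) (F' : K -> R -> C) : D c ->
  (forall k x, D x -> c <= x -> Cintegrable (m k) (Ico c x) (F' k)) ->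
  (forall x, D x -> c <= x -> F x = F c + \sum_k Cint (m k) (Ico c x) (F' k)) ->
  abscont m (from D c) F F'.
Proof.
move=> Dc Fi FE; have mI := @measurable_Ico R.
split => [k x y [Dx cx] [Dy cy] xy|x y [Dx cx] [Dy cy] xy].
  by apply: CintegrableS (Fi k _ Dy cy); [exact: mI|exact: mI|exact: IcoS].
rewrite (FE _ Dx cx) (FE _ Dy cy) -addrA -big_split/=; congr (_ + _).
by apply: eq_bigr => k _; rewrite -Cint_Ico_split//; exact: Fi.
Qed.

(** The density may be nonzero at [c] itself: an atom there moves [F] only strictly to the right of
    [c], which is compatible with [F c = 0]. *)
Lemma AC_extend0 D c (F : R -> C) (F' : K -> R -> C) : admissible m D -> D c ->
  abscont m (from D c) F F' -> (forall x, x <= c -> F x = 0) ->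
  (forall k x, x < c -> F' k x = 0) -> abscont m D F F'.
Proof.
move=> [cv _] Dc [Fi FE] F0 F'0; have mI := @measurable_Ico R.
have i0 k x y : y <= c -> Cintegrable (m k) (Ico x y) (F' k).
  move=> yc; apply: Cintegrable_ext (Cintegrable0 (m k) (mI x y)) => //.
  by move=> t /andP[_ ty]; rewrite F'0// (lt_le_trans ty).
have c0 k x y : y <= c -> Cint (m k) (Ico x y) (F' k) = 0.
  move=> yc; rewrite -(Cint0 (m k) (Ico x y)); apply: eq_Cint.
  by move=> t /andP[_ ty]; rewrite F'0// (lt_le_trans ty).
have ii k x y : D x -> D y -> x <= y -> Cintegrable (m k) (Ico x y) (F' k).
  move=> Dx Dy xy; have [yc|/ltW cy] := leP y c; first exact: i0.
  have [cx|/ltW xc] := leP c x; first by apply: Fi.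
  rewrite (Ico_setU xc cy).
  have [a1 b1] := i0 k x c (lexx _).
  have [a2 b2] : Cintegrable (m k) (Ico c y) (F' k) := Fi k c y (conj Dc (lexx c)) (conj Dy cy) cy.
  by split; apply: integrable_disjointU => //; exact: Ico_disj.
split=> // x y Dx Dy xy; have [yc|/ltW cy] := leP y c.
  rewrite !F0 ?(le_trans xy)// big1 ?addr0// => k _; exact: c0.
have [cx|/ltW xc] := leP c x; first by apply: FE.
rewrite (F0 x)// add0r (FE c y (conj Dc (lexx c)) (conj Dy cy) cy).
rewrite F0// add0r; apply: eq_bigr => k _.
by rewrite (Cint_Ico_split xc cy (ii k x y Dx Dy xy)) (c0 k x c (lexx c)) add0r.
Qed.

Lemma sum_bool2 (V : nmodType) (F : bool * bool -> V) :
  \sum_j F j = F (true, true) + F (true, false) + (F (false, true) + F (false, false)).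
Proof.
rewrite (eq_bigr (fun j => F (j.1, j.2))); last by case.
by rewrite -(pair_bigA _ (fun i j => F (i, j)))/= big_bool /= !big_bool.
Qed.

(* The system in real form: the index (i, j) stands for f or p (i = false, true) and for the real or
   imaginary part (j = false, true). *)
Definition slmat z (k : K) (i j : bool * bool) : R :=
  match i, j with
  | (false, false), (true, false) => s k
  | (false, true), (true, true) => s k
  | (true, false), (false, false) => q k - dlt k * complex.Re z
  | (true, false), (false, true) => dlt k * complex.Im z
  | (true, true), (false, true) => q k - dlt k * complex.Re z
  | (true, true), (false, false) => - (dlt k * complex.Im z)
  | _, _ => 0
  end.

Definition slvec f p (i : bool * bool) (x : R) : R :=
  match i with
  | (false, false) => complex.Re (f x)
  | (false, true) => complex.Im (f x)
  | (true, false) => complex.Re (p x)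
  | (true, true) => complex.Im (p x)
  end.

Lemma slmat_f z k f p b t :
  \sum_j slmat z k (false, b) j * slvec f p j t =
  if b then complex.Im ((s k)%:C%C * p t) else complex.Re ((s k)%:C%C * p t).
Proof. by rewrite sum_bool2; case: b => /=; rewrite !cE /=; ring. Qed.

Lemma slmat_p z k f p b t :
  \sum_j slmat z k (true, b) j * slvec f p j t =
  if b then complex.Im ((q k)%:C%C * f t - (dlt k)%:C%C * (z * f t))
  else complex.Re ((q k)%:C%C * f t - (dlt k)%:C%C * (z * f t)).
Proof. by rewrite sum_bool2; case: b => /=; rewrite !cE /=; ring. Qed.

Lemma lbm_rlb D c f : D c -> lbm (from D c) f ->
  rlb D c (fun x => complex.Re (f x)) /\ rlb D c (fun x => complex.Im (f x)).
Proof.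
move=> Dc lf; have fc : from D c c by [].
split=> d Dd cd; have [[mr mi] [M fM]] := lf c d fc (conj Dd cd); split => //;
  exists M => x xcd.
- by rewrite (le_trans (Re_le_n1 _))// fM.
- by rewrite (le_trans (Im_le_n1 _))// fM.
Qed.

Lemma rlb_lbm D c f : admissible m D -> rlb D c (fun x => complex.Re (f x)) ->
  rlb D c (fun x => complex.Im (f x)) -> lbm (from D c) f.
Proof.
move=> aD rf imf x y [Dx cx] [Dy cy].
have [mr [M rM]] := rf y Dy cy; have [mi [N iN]] := imf y Dy cy.
have sub : Icc x y `<=` Icc c y by move=> t /andP[xt ty]; rewrite /Icc/= (le_trans cx).
split.
  by split; [apply: measurable_funS mr|apply: measurable_funS mi] => //; exact: measurable_Icc.
by exists (M + N) => t /sub tcy; rewrite /n1 lerD//; [exact: rM|exact: iN].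
Qed.

Lemma Re_sumCint E (F : K -> R -> C) :
  complex.Re (\sum_k Cint (m k) E (F k)) =
  \sum_k Rintegral (m k) E (fun t => complex.Re (F k t)).
Proof. by rewrite cRe_sum. Qed.

Lemma Im_sumCint E (F : K -> R -> C) :
  complex.Im (\sum_k Cint (m k) E (F k)) =
  \sum_k Rintegral (m k) E (fun t => complex.Im (F k t)).
Proof. by rewrite cIm_sum. Qed.

Lemma vsys_slmat_f c z f p b x :
  vsys m c (slmat z) (slvec f p) (false, b) x =
  let S := \sum_k Cint (m k) (Ico c x) (fun t => (s k)%:C%C * p t) in
  if b then complex.Im S else complex.Re S.
Proof.
rewrite /vsys; cbv zeta; rewrite Re_sumCint Im_sumCint.
by case: b; apply: eq_bigr => k _; apply: eq_Rintegral => t _; rewrite slmat_f.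
Qed.

Lemma vsys_slmat_p c z f p b x :
  vsys m c (slmat z) (slvec f p) (true, b) x =
  let S := \sum_k Cint (m k) (Ico c x)
    (fun t => (q k)%:C%C * f t - (dlt k)%:C%C * (z * f t)) in
  if b then complex.Im S else complex.Re S.
Proof.
rewrite /vsys; cbv zeta; rewrite Re_sumCint Im_sumCint.
by case: b; apply: eq_bigr => k _; apply: eq_Rintegral => t _; rewrite slmat_p.
Qed.

Lemma fwd_unique D c f p z : admissible m D -> D c ->
  qd (from D c) f p (fun x => z * f x) -> f c = 0 -> p c = 0 ->
  forall x, D x -> c <= x -> f x = 0 /\ p x = 0.
Proof.
move=> aD Dc qf f0 p0; have aDc := admissibleS c aD.
have [lf lp] := qd_lbm aDc qf.
have [rf imf] := lbm_rlb Dc lf; have [rp ip] := lbm_rlb Dc lp.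
have fc : from D c c by [].
have [[_ fE] [_ pE]] := qf.
have := @vsys_unique _ _ _ _ _ aD Dc _ (slmat z) (slvec f p).
have ly i : rlb D c (slvec f p i) by case: i => [[] []].
move=> /(_ ly) H x Dx cx.
have fx : from D c x by [].
have key : forall i t, D t -> c <= t -> slvec f p i t = vsys m c (slmat z) (slvec f p) i t.
  move=> i t Dt ct; have ft : from D c t by [].
  have := fE _ _ fc ft ct; have := pE _ _ fc ft ct; rewrite f0 p0 !add0r => pt ft'.
  case: i => [[] b]; first by rewrite vsys_slmat_p -pt; case: b.
  by rewrite vsys_slmat_f -ft'; case: b.
have e i := H key i x Dx cx.
by split; apply: Cext; [exact: (e (false, false))|exact: (e (false, true))|
  exact: (e (true, false))|exact: (e (true, true))].
Qed.

Lemma rlb_int_fun D c k (h : R -> R) : D c ->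
  (forall x, D x -> c <= x -> (m k).-integrable (Ico c x) (EFin \o h)) ->
  rlb D c (fun x => Rintegral (m k) (Ico c x) h).
Proof.
move=> Dc hi d Dd cd; split; first exact: measurable_Rintegral_Ico (hi _ Dd cd).
exists (Rintegral (m k) (Ico c d) (fun t => `|h t|)) => x /andP[cx xd].
have mI := @measurable_Ico R; have sub := IcoS (lexx c) xd.
have fix_ := integrableS (mI c d) (mI c x) sub (hi _ Dd cd).
rewrite (le_trans (le_normr_Rintegral (mI c x) fix_))//.
by apply: le_Rintegral_set => //; apply: integrable_norm; exact: hi.
Qed.

Lemma fwd_exists D c z (g : R -> C) (f0 p0 : C) : admissible m D -> D c ->
  (forall x, D x -> c <= x -> Cintegrable (m k0) (Ico c x) g) ->
  exists f p, [/\ f c = f0, p c = p0 & qd (from D c) f p (fun x => z * f x + g x)].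
Proof.
move=> aD Dc gi.
(* The inhomogeneity [g] enters only through the forcing term of [p], so the Volterra operator stays
   the homogeneous one. *)
pose y0 (i : bool * bool) (x : R) := match i with
  | (false, false) => complex.Re f0
  | (false, true) => complex.Im f0
  | (true, false) => complex.Re p0 - Rintegral (m k0) (Ico c x) (fun t => complex.Re (g t))
  | (true, true) => complex.Im p0 - Rintegral (m k0) (Ico c x) (fun t => complex.Im (g t))
  end.
have ly0 i : rlb D c (y0 i).
  case: i => [[] []]; rewrite /y0; try exact: rlb_cst.
    apply: rlbD; first exact: rlb_cst.
    apply: rlbN; apply: rlb_int_fun => // x Dx cx; by have [] := gi x Dx cx.
  apply: rlbD; first exact: rlb_cst.
  apply: rlbN; apply: rlb_int_fun => // x Dx cx; by have [] := gi x Dx cx.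
have [y [ly ye]] := vsys_exists aD Dc (slmat z) ly0.
pose f x : C := (y (false, false) x +i* y (false, true) x)%C.
pose p x : C := (y (true, false) x +i* y (true, true) x)%C.
have ysl : y = slvec f p by apply/funext => -[[] []].
have lf : lbm (from D c) f by apply: rlb_lbm => //; exact: ly.
have lp : lbm (from D c) p by apply: rlb_lbm => //; exact: ly.
have aDc := admissibleS c aD; have fc : from D c c by [].
have mI := @measurable_Ico R.
have i1 k x : D x -> c <= x -> Cintegrable (m k) (Ico c x) (fun t => (s k)%:C%C * p t).
  move=> Dx cx; apply: CintegrableZl => //.
  by apply: (lbm_int _ aDc).
have i2 k x : D x -> c <= x -> Cintegrable (m k) (Ico c x)
    (fun t => (q k)%:C%C * f t - (dlt k)%:C%C * (z * f t)).
  move=> Dx cx; have fi : Cintegrable (m k) (Ico c x) f by apply: (lbm_int _ aDc).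
  by apply: CintegrableB => //; do ?apply: CintegrableZl.
have i3 k x : D x -> c <= x -> Cintegrable (m k) (Ico c x)
    (fun t => (dlt k)%:C%C * g t).
  by move=> Dx cx; apply: (dlt_int D) => //; exact: gi.
have fE x : D x -> c <= x -> f x = f0 + \sum_k Cint (m k) (Ico c x) (fun t => (s k)%:C%C * p t).
  move=> Dx cx; apply: Cext; rewrite !cE.
    by rewrite -[LHS]/(y (false, false) x) ye// {1}ysl vsys_slmat_f.
  by rewrite -[LHS]/(y (false, true) x) ye// {1}ysl vsys_slmat_f.
have pE x : D x -> c <= x -> p x = p0 + \sum_k Cint (m k) (Ico c x)
    (fun t => (q k)%:C%C * f t - (dlt k)%:C%C * (z * f t + g t)).
  move=> Dx cx.
  have -> : \sum_k Cint (m k) (Ico c x) (fun t => (q k)%:C%C * f t - (dlt k)%:C%C * (z * f t + g t))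
    = \sum_k Cint (m k) (Ico c x) (fun t => (q k)%:C%C * f t - (dlt k)%:C%C * (z * f t))
      - Cint (m k0) (Ico c x) g.
    rewrite -sum_dlt -sumrB; apply: eq_bigr => k _; rewrite -CintB//; last 2 first.
    - exact: i2.
    - exact: i3.
    by apply: eq_Cint => t _; rewrite mulrDr opprD addrA.
  apply: Cext; rewrite !cE addrA addrAC.
    by rewrite -[LHS]/(y (true, false) x) ye// {1}ysl vsys_slmat_p.
  by rewrite -[LHS]/(y (true, true) x) ye// {1}ysl vsys_slmat_p.
have z0 (h : K -> R -> C) : \sum_k Cint (m k) (Ico c c) (h k) = 0.
  by rewrite Ico_empty// big1// => k _; exact: Cint_set0.
have fc0 : f c = f0 by rewrite fE// z0 addr0.
have pc0 : p c = p0 by rewrite pE// z0 addr0.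
exists f, p; split => //; split; apply: AC_base => //.
- by move=> x Dx cx; rewrite fc0 fE.
- move=> k x Dx cx; apply: Cintegrable_ext (CintegrableB _ (i2 k x Dx cx) (i3 k x Dx cx)) => //.
  by move=> t _; rewrite mulrDr opprD addrA.
- by move=> x Dx cx; rewrite pc0 pE.
Qed.

Lemma fwd_exists0 D c z (f0 p0 : C) : admissible m D -> D c ->
  exists f p, [/\ f c = f0, p c = p0 & qd (from D c) f p (fun x => z * f x)].
Proof.
move=> aD Dc; have [|f [p [e1 e2 qf]]] := @fwd_exists D c z (fun => 0) f0 p0 aD Dc.
  by move=> x _ _; apply: Cintegrable0; exact: measurable_Ico.
exists f, p; split => //; apply: (qd_ext (admissibleS c aD) qf) => // x _.
by rewrite addr0.
Qed.

Lemma wr_const D f p f2 p2 z x y : admissible m D -> noatoms D ->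
  qd D f p (fun x => z * f x) -> qd D f2 p2 (fun x => z * f2 x) ->
  D x -> D y -> wr f p f2 p2 x = wr f p f2 p2 y.
Proof.
move=> aD na qf qf2; wlog xy : x y / x <= y.
  by move=> W Dx Dy; have [xy|/ltW yx] := leP x y; [exact: W|apply/esym/W].
move=> Dx Dy; rewrite (lagrange_int aD na qf qf2 Dx Dy xy) (_ : Cint _ _ _ = 0) ?addr0//.
rewrite -(Cint0 (m k0) (Ico x y)); apply: eq_Cint => t _; ring.
Qed.

(** To the left of [c] the Wronskian replaces iteration. Against the two basic solutions started at
    [x], the Wronskians of the given solution are [- p x] and [f x] at [x], and both vanish at
    [c]. *)
Lemma sol_unique D c f p z : admissible m D -> noatoms D -> D c ->
  qd D f p (fun x => z * f x) -> f c = 0 -> p c = 0 ->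
  forall x, D x -> f x = 0 /\ p x = 0.
Proof.
move=> aD na Dc qf f0 p0 x Dx.
have [cx|/ltW xc] := leP c x.
  by apply: (fwd_unique aD Dc) => //; apply: qdS qf; exact: fromS.
have aDx := admissibleS x aD.
have nax : noatoms (from D x) by apply: noatomsS na; exact: fromS.
have qfx : qd (from D x) f p (fun x => z * f x) by apply: qdS qf; exact: fromS.
have [u1 [v1 [u1x v1x q1]]] := fwd_exists0 z 1 0 aD Dx.
have [u2 [v2 [u2x v2x q2]]] := fwd_exists0 z 0 1 aD Dx.
have fx : from D x x by []. have fc : from D x c by [].
have := wr_const aDx nax qfx q1 fx fc; rewrite /wr u1x v1x f0 p0 => e1.
have := wr_const aDx nax qfx q2 fx fc; rewrite /wr u2x v2x f0 p0 => e2.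
move: e1 e2; rewrite !mul0r !mulr0 !mulr1 !subr0 sub0r => /eqP.
by rewrite oppr_eq0 => /eqP.
Qed.

(* Data prescribed at c are attained by a solution started at x <= c: the Wronskian of the two basic
   solutions at x is still 1 at c. *)
Lemma sol_from D c x z (f0 p0 : C) : admissible m D -> noatoms D -> D c -> D x -> x <= c ->
  exists f p, [/\ f c = f0, p c = p0 & qd (from D x) f p (fun x => z * f x)].
Proof.
move=> aD na Dc Dx xc.
have aDx := admissibleS x aD.
have nax : noatoms (from D x) by apply: noatomsS na; exact: fromS.
have [u1 [v1 [u1x v1x q1]]] := fwd_exists0 z 1 0 aD Dx.
have [u2 [v2 [u2x v2x q2]]] := fwd_exists0 z 0 1 aD Dx.
have fx : from D x x by []. have fc : from D x c by [].
have := wr_const aDx nax q1 q2 fx fc; rewrite /wr u1x v1x u2x v2x => det.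
have {}det : u1 c * v2 c - v1 c * u2 c = 1 by rewrite -det; ring.
(* Cramer's rule, with determinant 1 by [det]. *)
pose al := f0 * v2 c - p0 * u2 c; pose be := p0 * u1 c - f0 * v1 c.
exists (fun x => al * u1 x + be * u2 x), (fun x => al * v1 x + be * v2 x).
split.
- rewrite -[RHS]mulr1 -det /al /be; ring.
- rewrite -[RHS]mulr1 -det /al /be; ring.
- by apply: (qd_ext aDx (qd_lin al be aDx q1 q2)) => // t _; ring.
Qed.

Lemma qd_unique_eq D c f p f2 p2 z : admissible m D -> noatoms D -> D c ->
  qd D f p (fun x => z * f x) -> qd D f2 p2 (fun x => z * f2 x) ->
  f c = f2 c -> p c = p2 c -> forall x, D x -> f x = f2 x /\ p x = p2 x.
Proof.
move=> aD na Dc q1 q2 ef ep x Dx.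
have ql := qd_lin 1 (-1) aD q1 q2.
have ql' : qd D (fun x => 1 * f x + -1 * f2 x) (fun x => 1 * p x + -1 * p2 x)
    (fun x => z * (1 * f x + -1 * f2 x)).
  by apply: (qd_ext aD ql) => // t _; ring.
have [|| e1 e2] := sol_unique aD na Dc ql' _ _ Dx.
- by rewrite ef; ring.
- by rewrite ep; ring.
split; apply/eqP; rewrite -subr_eq0; apply/eqP.
  by rewrite -e1; ring.
by rewrite -e2; ring.
Qed.

(** By uniqueness the solutions started at points to the left of [c] agree on common domains. They
    are glued by reading the value at [x] from the one started at [Num.min x c]. *)
Lemma sol_exists D c z (f0 p0 : C) : admissible m D -> noatoms D -> D c ->
  exists f p, [/\ f c = f0, p c = p0 & qd D f p (fun x => z * f x)].
Proof.
move=> aD na Dc.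
have H x : exists fp : (R -> C) * (R -> C), D x -> x <= c ->
   [/\ fp.1 c = f0, fp.2 c = p0 & qd (from D x) fp.1 fp.2 (fun x => z * fp.1 x)].
  have [Dx|nDx] := pselect (D x); last by exists (fun => 0, fun => 0).
  have [xc|cx] := leP x c; last by exists (fun => 0, fun => 0).
  by have [f [p fp]] := sol_from z f0 p0 aD na Dc Dx xc; exists (f, p).
have [S HS] := choice H.
have Dm x : D x -> D (Num.min x c) by move=> Dx; rewrite minEle; case: ifP.
have mc x : Num.min x c <= c by rewrite ge_min lexx orbT.
pose f x := (S (Num.min x c)).1 x; pose p x := (S (Num.min x c)).2 x.
have agree x y : D x -> x <= c -> D y -> x <= y -> f y = (S x).1 y /\ p y = (S x).2 y.
  move=> Dx xc Dy xy.
  have [a1 a2 a3] := HS x Dx xc.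
  have [b1 b2 b3] := HS _ (Dm _ Dy) (mc y).
  have my : from D (Num.min y c) y by split => //; rewrite ge_min lexx.
  have mcc : from D (Num.min y c) c by split.
  apply: (qd_unique_eq (admissibleS _ aD) _ mcc b3 _ _ _ my).
  - by apply: noatomsS na; exact: fromS.
  - apply: qdS a3 => t [Dt mt]; split => //; apply: le_trans mt.
    by rewrite le_min xy.
  - by rewrite b1 a1.
  - by rewrite b2 a2.
exists f, p; split.
- by rewrite /f minxx; have [] := HS c Dc (lexx _).
- by rewrite /p minxx; have [] := HS c Dc (lexx _).
have loc x : D x -> x <= c -> qd (from D x) f p (fun x => z * f x).
  move=> Dx xc; have [_ _ h] := HS x Dx xc.
  apply: (qd_ext (admissibleS _ aD) h) => t [Dt xt];
    by have [e1 e2] := agree x t Dx xc Dt xt; rewrite ?e1 ?e2.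
split; split=> [k x y Dx Dy xy|x y Dx Dy xy].
- have [[+ _] _] := loc _ (Dm _ Dx) (mc x); apply => //; split => //; rewrite ?(le_trans _ xy)// ge_min lexx//.
- have [[_ +] _] := loc _ (Dm _ Dx) (mc x); apply => //; split => //; rewrite ?(le_trans _ xy)// ge_min lexx//.
- have [_ [+ _]] := loc _ (Dm _ Dx) (mc x); apply => //; split => //; rewrite ?(le_trans _ xy)// ge_min lexx//.
- have [_ [_ +]] := loc _ (Dm _ Dx) (mc x); apply => //; split => //; rewrite ?(le_trans _ xy)// ge_min lexx//.
Qed.

(** Because the data at [c] are zero and [g] vanishes to its left, the forward solution continues by
    0 without a jump at [c]. *)
Lemma inh_exists D c z (g : R -> C) : admissible m D -> D c ->
  (forall x, D x -> c <= x -> Cintegrable (m k0) (Ico c x) g) ->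
  (forall x, x < c -> g x = 0) ->
  exists f p, [/\ forall x, x <= c -> f x = 0, forall x, x <= c -> p x = 0
    & qd D f p (fun x => z * f x + g x)].
Proof.
move=> aD Dc gi g0; have [f [p [fc pc qf]]] := fwd_exists z 0 0 aD Dc gi.
pose cut (h : R -> C) x := if x <= c then 0 else h x.
have cE (h : R -> C) x : h c = 0 -> c <= x -> h x = cut h x.
  move=> hc cx; rewrite /cut; case: leP => // xc.
  by have -> : x = c by apply/eqP; rewrite eq_le xc.
have qf' : qd (from D c) (cut f) (cut p) (fun x => z * cut f x + g x).
  by apply: (qd_ext (admissibleS c aD) qf) => x [Dx cx]; rewrite -?cE.
exists (cut f), (cut p); split; [by move=> x xc; rewrite /cut xc..|].
case: qf' => af ap; split; apply: (AC_extend0 aD Dc) => //.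
- by move=> x xc; rewrite /cut xc.
- by move=> k x xc; rewrite /cut ltW// mulr0.
- by move=> x xc; rewrite /cut xc.
- by move=> k x xc; rewrite /cut (ltW xc) g0// !mulr0 addr0 mulr0 subr0.
Qed.

End SturmLiouville.

Lemma Iab_conv (R : realType) (a b : \bar R) (x y t : R) :
  Iab a b x -> Iab a b y -> x <= t -> t <= y -> Iab a b t.
Proof.
move=> [ax xb] [ay yb] xt ty; split.
  by apply: (lt_le_trans ax); rewrite lee_fin.
by apply: le_lt_trans yb; rewrite lee_fin.
Qed.

Lemma Iab_nonempty (R : realType) (a b : \bar R) : (a < b)%E -> exists c : R, Iab a b c.
Proof.
case: a => [a| |]; case: b => [b| |] //; rewrite /Iab/=.
- rewrite lte_fin => ab; exists ((a + b) / 2); rewrite !lte_fin.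
  by rewrite midf_lt// midf_lt.
- by move=> _; exists (a + 1); rewrite lte_fin ltrDl ltr01 ltry.
- by move=> _; exists (b - 1); rewrite lte_fin ltrBlDr ltrDl ltr01 ltNyr.
- by move=> _; exists 0; rewrite ltNyr ltry.
Qed.

Lemma oint_add (R : realType) (a b : \bar R) (mu : {measure set R -> \bar R})
    (h : R -> R[i]) (c x y : R) :
  (forall x y, Iab a b x -> Iab a b y -> x <= y -> Cintegrable mu (Ico x y) h) ->
  Iab a b c -> Iab a b x -> Iab a b y -> x <= y ->
  oint mu c y h = oint mu c x h + Cint mu (Ico x y) h.
Proof.
move=> hi Ic Ix Iy xy; rewrite /oint.
have [cx|xc] := leP c x.
  by rewrite (le_trans cx xy) (Cint_Ico_split cx xy)//; apply: hi => //; exact: le_trans xy.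
have [cy|yc] := leP c y.
  by rewrite (Cint_Ico_split (ltW xc) cy) ?addrA ?addNr ?add0r//; exact: hi.
by rewrite (Cint_Ico_split xy (ltW yc) (hi _ _ Ix Ic (ltW xc))) opprD addrAC addNr add0r.
Qed.

Lemma ointcc (R : realType) (mu : {measure set R -> \bar R}) (c : R) (h : R -> R[i]) :
  oint mu c c h = 0.
Proof. by rewrite /oint lexx Ico_empty// Cint_set0. Qed.

Lemma Cint_ae (R : realType) (mu : {measure set R -> \bar R}) (D : set R) (f g : R -> R[i]) :
  measurable D -> Cintegrable mu D f -> Cintegrable mu D g ->
  {ae mu, forall x, D x -> f x = g x} -> Cint mu D f = Cint mu D g.
Proof.
move=> mD [f1 f2] [g1 g2] fg; apply: Cext => /=.
  rewrite /Rintegral; congr fine; apply: ae_eq_integral => //.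
  - exact: measurable_int f1.
  - exact: measurable_int g1.
  - by apply: filterS fg => x e Dx; rewrite e.
rewrite /Rintegral; congr fine; apply: ae_eq_integral => //.
- exact: measurable_int f2.
- exact: measurable_int g2.
- by apply: filterS fg => x e Dx; rewrite e.
Qed.

(** * The relation tau f = g as a first order system *)

Section Bridge.
Variable R : realType.
Local Notation C := (R[i]).
Local Notation Msr := {measure set R -> \bar R}.
Variables (a b : \bar R) (rho sp sm cp cm : Msr).
Hypotheses (hab : (a < b)%E)
  (Hrho : loc_finite_on a b rho)
  (Hsp : loc_finite_on a b sp) (Hsm : loc_finite_on a b sm)
  (Hs : jordan_pair sp sm)
  (Hcp : loc_finite_on a b cp) (Hcm : loc_finite_on a b cm)
  (Hc : jordan_pair cp cm)
  (H4chi : forall x : R,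
     ((sp [set x] - sm [set x]) * (cp [set x] - cm [set x]) = 0)%E)
  (H4rho : forall x : R, ((sp [set x] - sm [set x]) * rho [set x] = 0)%E).

(* sigma and chi enter through their Jordan parts, with signs [scoef] and [qcoef]. *)
Definition mfam (k : 'I_5) : Msr :=
  match val k with 0 => sp | 1 => sm | 2 => cp | 3 => cm | _ => rho end.
Definition scoef (k : 'I_5) : R :=
  match val k with 0 => 1 | 1 => -1 | _ => 0 end.
Definition qcoef (k : 'I_5) : R :=
  match val k with 2 => 1 | 3 => -1 | _ => 0 end.

Local Notation I := (Iab a b).
Local Notation Qd := (qd mfam ord_max scoef qcoef I).

Lemma mfam_fin k x y : I x -> I y -> (mfam k (Icc x y) < +oo)%E.
Proof.
rewrite /mfam; case: k => [[|[|[|[|k]]]] i] /= Ix Iy;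
  [exact: Hsp.1|exact: Hsm.1|exact: Hcp.1|exact: Hcm.1|exact: Hrho.1].
Qed.

Lemma admissible_mfam : admissible mfam I.
Proof. by split=> [x y t|k x y]; [exact: Iab_conv|exact: mfam_fin]. Qed.

Lemma jordan_atom (mup mum : Msr) x : jordan_pair mup mum ->
  mup [set x] = 0%E \/ mum [set x] = 0%E.
Proof.
move=> [P [mP [p0 m0]]]; have [Px|nPx] := pselect (P x).
  right; apply: subset_measure0 m0 => //; by move=> t ->.
left; apply: subset_measure0 p0 => //; first exact: measurableC.
by move=> t ->.
Qed.

Lemma sube_jordan_eq0 (u v : \bar R) : (u = 0 \/ v = 0)%E -> (u - v = 0)%E ->
  (u = 0 /\ v = 0)%E.
Proof.
move=> [->|->]; first by rewrite sub0e => /eqP; rewrite oppe_eq0 => /eqP.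
by rewrite sube0.
Qed.

(** Mutually singular Jordan parts never both charge a point, so if their difference has no mass at
    a point, neither part has any. Thus (H4), stated for sigma and chi, passes to the separate
    parts. *)
Lemma noatoms_mfam : noatoms mfam ord_max scoef qcoef I.
Proof.
have key t : (sp [set t] = 0 /\ sm [set t] = 0)%E \/
    (cp [set t] = 0 /\ cm [set t] = 0 /\ rho [set t] = 0)%E.
  have [e|ne] := eqVneq (sp [set t] - sm [set t])%E 0%E.
    by left; apply: sube_jordan_eq0 => //; exact: jordan_atom.
  right; have /eqP := H4chi t; rewrite mule_eq0 (negbTE ne)/= => /eqP e1.
  have /eqP := H4rho t; rewrite mule_eq0 (negbTE ne)/= => /eqP e2.
  have [] := sube_jordan_eq0 _ e1; first exact: jordan_atom.
  by split.
move=> k l; rewrite /scoef /qcoef /mfam.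
case: k => [[|[|[|[|[|k]]]]] i] /=; try by left.
  case: l => [[|[|[|[|[|l]]]]] j] //=; try by right; left; split.
  all: try by right; right => t _; have [[]|[? []]] := key t; auto.
case: l => [[|[|[|[|[|l]]]]] j] //=; try by right; left; split.
all: by right; right => t _; have [[]|[? []]] := key t; auto.
Qed.

Lemma sum_mfam (F : 'I_5 -> C) : \sum_k F k =
  F (@Ordinal 5 0 isT) + F (@Ordinal 5 1 isT) + F (@Ordinal 5 2 isT)
  + F (@Ordinal 5 3 isT) + F ord_max.
Proof.
rewrite !big_ord_recl big_ord0 addr0 !addrA.
by do ![congr (_ + _)]; congr F; exact: val_inj.
Qed.

Lemma loc_int_Ico (mu : Msr) (h : R -> C) x y : loc_int a b mu h -> I x -> I y -> x <= y ->
  Cintegrable mu (Ico x y) h.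
Proof.
move=> hi Ix Iy xy; apply: CintegrableS (hi x y Ix Iy xy).
- exact: measurable_Ico.
- exact: measurable_Icc.
- exact: Ico_sub_Icc.
Qed.

Lemma lbm_loc_int k (f : R -> C) : lbm I f -> loc_int a b (mfam k) f.
Proof.
move=> lf x y Ix Iy xy; have [mf [M fM]] := lf x y Ix Iy.
apply: (Cintegrable_bounded (M := M)) => //; first exact: measurable_Icc.
exact: mfam_fin.
Qed.

Lemma sum_s (E : set R) (h : R -> C) : measurable E ->
  Cintegrable sp E h -> Cintegrable sm E h ->
  \sum_k Cint (mfam k) E (fun t => (scoef k)%:C%C * h t) = Cint sp E h - Cint sm E h.
Proof.
move=> mE hp hm; rewrite sum_mfam /mfam /scoef /=.
have z (mu : Msr) : Cint mu E (fun t => 0%:C%C * h t) = 0.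
  by rewrite -[RHS](Cint0 mu E); apply: eq_Cint => t _; rewrite mul0r.
rewrite !z !addr0; congr (_ + _); first by apply: eq_Cint => t _; rewrite mul1r.
rewrite -CintN//; apply: eq_Cint => t _; by rewrite rmorphN mulN1r.
Qed.

Lemma sum_q (E : set R) (f g : R -> C) : measurable E ->
  Cintegrable cp E f -> Cintegrable cm E f -> Cintegrable rho E g ->
  \sum_k Cint (mfam k) E (fun t => (qcoef k)%:C%C * f t - (dlt R ord_max k)%:C%C * g t) =
  Cint cp E f - Cint cm E f - Cint rho E g.
Proof.
move=> mE fp fm gi; rewrite sum_mfam /mfam /qcoef /dlt /=.
have z (mu : Msr) : Cint mu E (fun t => 0%:C%C * f t - 0%:C%C * g t) = 0.
  by rewrite -[RHS](Cint0 mu E); apply: eq_Cint => t _; rewrite !mul0r subr0.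
rewrite !z !add0r; congr (_ + _ + _).
- by apply: eq_Cint => t _; rewrite mul0r subr0 mul1r.
- rewrite -CintN//; apply: eq_Cint => t _; by rewrite mul0r subr0 rmorphN mulN1r.
- rewrite -CintN//; apply: eq_Cint => t _; by rewrite mul0r sub0r mul1r.
Qed.

(** The density [h] serves twice. It first shows that [f] is locally bounded, so that the integral
    of [f] against chi and hence [p] make sense. Then it is exchanged for [p], which equals it
    almost everywhere for both parts of sigma and, unlike [h], is itself absolutely continuous. *)
Lemma tau_rel_qd f g : tau_rel a b rho sp sm cp cm f g ->
  loc_int a b rho g /\ exists p, Qd f p g.
Proof.
move=> [c [Ic [h [F [hp [hm [fE [gi [FE FH]]]]]]]]]; split => //.
have mI := @measurable_Ico R.
have af : abscont mfam I f (fun k x => (scoef k)%:C%C * h x).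
  split=> [k x y Ix Iy xy|x y Ix Iy xy].
    have hpi := loc_int_Ico hp Ix Iy xy; have hmi := loc_int_Ico hm Ix Iy xy.
    rewrite /mfam /scoef.
    case: k => [[|[|k]] i] /=; [exact: CintegrableZl|exact: CintegrableZl|].
    by under eq_fun do rewrite mul0r; exact: Cintegrable0.
  rewrite sum_s//; [|exact: loc_int_Ico|exact: loc_int_Ico].
  rewrite fE// (fE x Ix) -addrA /soint; congr (_ + _).
  rewrite (oint_add (fun x y => @loc_int_Ico sp h x y hp) Ic Ix Iy xy).
  rewrite (oint_add (fun x y => @loc_int_Ico sm h x y hm) Ic Ix Iy xy).
  by rewrite opprD addrACA.
have lf := AC_lbm admissible_mfam af.
have fcp : loc_int a b cp f by exact: (@lbm_loc_int (@Ordinal 5 2 isT)).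
have fcm : loc_int a b cm f by exact: (@lbm_loc_int (@Ordinal 5 3 isT)).
pose p x := soint cp cm c x f - F x.
have ap : abscont mfam I p
    (fun k x => (qcoef k)%:C%C * f x - (dlt R ord_max k)%:C%C * g x).
  split=> [k x y Ix Iy xy|x y Ix Iy xy].
    apply: CintegrableB => //.
      by apply: CintegrableZl => //; exact: lbm_int admissible_mfam lf Ix Iy.
    exact: (@dlt_int _ _ mfam ord_max I _ _ k (mI x y) (loc_int_Ico gi Ix Iy xy)).
  rewrite sum_q//; [|exact: loc_int_Ico..].
  rewrite /p FE// (FE x Ix) /soint.
  rewrite (oint_add (fun x y => @loc_int_Ico cp f x y fcp) Ic Ix Iy xy).
  rewrite (oint_add (fun x y => @loc_int_Ico cm f x y fcm) Ic Ix Iy xy).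
  rewrite (oint_add (fun x y => @loc_int_Ico rho g x y gi) Ic Ix Iy xy).
  by ring.
have lp := AC_lbm admissible_mfam ap.
exists p; split => //; split=> [k x y Ix Iy xy|x y Ix Iy xy].
  by apply: CintegrableZl => //; exact: lbm_int admissible_mfam lp Ix Iy.
have pp : Cintegrable sp (Ico x y) p by exact: (@lbm_int _ _ mfam _ _ (@Ordinal 5 0 isT) _ _ admissible_mfam lp Ix Iy).
have pm : Cintegrable sm (Ico x y) p by exact: (@lbm_int _ _ mfam _ _ (@Ordinal 5 1 isT) _ _ admissible_mfam lp Ix Iy).
rewrite sum_s// (af.2 _ _ Ix Iy xy) sum_s//; [|exact: loc_int_Ico..].
have [N [mN N0 sub]] := FH.
have aes (mu : Msr) : mu N = 0%E -> {ae mu, forall t, Ico x y t -> h t = p t}.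
  move=> muN; exists N; split => // t /= /not_implyP[/andP[xt ty] ht]; apply: sub => /= H.
  apply: ht; have It : I t by apply: Iab_conv Ix Iy xt (ltW ty).
  by rewrite /p (H It); ring.
have [N1 N2] : sp N = 0%E /\ sm N = 0%E.
  move/eqP: N0; rewrite measure_addE padde_eq0 ?measure_ge0//.
  by move=> /andP[/eqP -> /eqP ->].
congr (_ + (_ - _)); apply: Cint_ae => //; try exact: aes; exact: loc_int_Ico.
Qed.

Lemma abscont_oint (F : R -> C) (F' : 'I_5 -> R -> C) c x : abscont mfam I F F' ->
  I c -> I x -> F x = F c + \sum_k oint (mfam k) c x (F' k).
Proof.
move=> [Fi FE] Ic Ix; rewrite /oint; case: leP => [cx|xc]; first exact: FE.
by rewrite (FE _ _ Ix Ic (ltW xc)) sumrN addrK.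
Qed.

(** With [p] itself as the density of [f], the defining equation holds at every point and not only
    almost everywhere. *)
Lemma qd_tau_rel f p g : Qd f p g -> loc_int a b rho g ->
  tau_rel a b rho sp sm cp cm f g.
Proof.
move=> qf gi; have [lf lp] := qd_lbm admissible_mfam qf; have [af ap] := qf.
have [c Ic] := Iab_nonempty hab.
have mI := @measurable_Ico R.
have lfk k : loc_int a b (mfam k) f by exact: lbm_loc_int.
have lpk k : loc_int a b (mfam k) p by exact: lbm_loc_int.
exists c; split => //; exists p, (fun x => soint cp cm c x f - p x).
split; first exact: (lpk (@Ordinal 5 0 isT)).
split; first exact: (lpk (@Ordinal 5 1 isT)).
split.
  move=> x Ix; rewrite (abscont_oint af Ic Ix) /soint /oint; congr (_ + _).
  case: leP => [cx|/ltW xc].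
    rewrite sum_s//; [exact: loc_int_Ico (lpk (@Ordinal 5 0 isT)) _ _ _|].
    exact: loc_int_Ico (lpk (@Ordinal 5 1 isT)) _ _ _.
  rewrite sumrN sum_s//; [by rewrite opprD|exact: loc_int_Ico (lpk (@Ordinal 5 0 isT)) _ _ _|].
  exact: loc_int_Ico (lpk (@Ordinal 5 1 isT)) _ _ _.
split => //; split.
  move=> x Ix; rewrite (abscont_oint ap Ic Ix) /soint !ointcc /oint.
  case: leP => [cx|/ltW xc].
    rewrite sum_q//; [ring|exact: loc_int_Ico (lfk (@Ordinal 5 2 isT)) _ _ _|
      exact: loc_int_Ico (lfk (@Ordinal 5 3 isT)) _ _ _|exact: loc_int_Ico].
  rewrite sumrN sum_q//; [ring|exact: loc_int_Ico (lfk (@Ordinal 5 2 isT)) _ _ _|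
      exact: loc_int_Ico (lfk (@Ordinal 5 3 isT)) _ _ _|exact: loc_int_Ico].
by apply: aeW => x Ix; rewrite addrC.
Qed.

End Bridge.

(** * Exhaustion, one-sided smallness and separation of measures *)

Section MeasureTools.
Variable R : realType.
Local Notation C := (R[i]).
Local Notation Msr := {measure set R -> \bar R}.
Implicit Types (mu nu : Msr) (a b : \bar R).

Lemma exists_inv_small (e : R) : 0 < e -> exists n : nat, n.+1%:R^-1 < e.
Proof. by move=> /ltr_add_invr[n]; rewrite add0r; exists n. Qed.

Lemma Iab_up a b c : Iab a b c -> exists ys : nat -> R,
  [/\ forall n, Iab a b (ys n), forall n, c <= ys n,
      {homo ys : n k / (n <= k)%N >-> n <= k} & forall t, Iab a b t -> exists n, t < ys n].
Proof.
case: b => [b| |] [ac cb]; last by [].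
- rewrite lte_fin in cb; have bc : 0 < b - c by rewrite subr_gt0.
  pose ys (n : nat) := b - (b - c) * n.+1%:R^-1.
  have cy n : c <= ys n.
    rewrite /ys lerBrDr addrC -lerBrDr; apply: ler_piMr; first exact: ltW.
    by rewrite invf_le1 ?ltr0n// ler1n.
  exists ys; split => //.
  - move=> n; split; first by rewrite (lt_le_trans ac)// lee_fin.
    by rewrite lte_fin /ys ltrBlDr ltrDl mulr_gt0// invr_gt0.
  - move=> n k nk; rewrite /ys lerB// ler_pM2l// lef_pV2 ?posrE ?ltr0n// ler_nat ltnS//.
  - move=> t [_]; rewrite lte_fin => tb.
    have bt : 0 < b - t by rewrite subr_gt0.
    have [n nt] := @exists_inv_small ((b - t) / (b - c)) (divr_gt0 bt bc).
    rewrite ltr_pdivlMr// in nt.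
    by exists n; rewrite /ys ltrBrDr addrC -ltrBrDr mulrC.
- pose ys (n : nat) := c + n%:R; exists ys; split => //.
  - move=> n; split; last exact: ltry.
    by rewrite (lt_le_trans ac)// lee_fin lerDl.
  - by move=> n; rewrite lerDl.
  - by move=> n k nk; rewrite lerD2l ler_nat.
  - move=> t _; exists (Num.truncn `|t - c|).+1.
    rewrite /ys -ltrBlDl; apply: le_lt_trans (ler_norm _) _; exact: truncnS_gt.
Qed.

Lemma IabN a b x : Iab (- b)%E (- a)%E (- x) <-> Iab a b x.
Proof.
rewrite /Iab/= !EFinN; split=> -[h1 h2].
  by rewrite lteN2 in h1; rewrite lteN2 in h2; split.
by rewrite !lteN2; split.
Qed.

Lemma Iab_down a b c : Iab a b c -> exists xs : nat -> R,
  [/\ forall n, Iab a b (xs n), forall n, xs n <= c,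
      {homo xs : n k / (n <= k)%N >-> k <= n} & forall t, Iab a b t -> exists n, xs n < t].
Proof.
move=> /IabN /Iab_up[ys [Iy cy ny yt]]; exists (fun n => - ys n); split.
- by move=> n; apply/IabN; rewrite opprK.
- by move=> n; rewrite lerNl.
- by move=> n k nk; rewrite lerN2 ny.
- by move=> t /IabN /yt[n ty]; exists n; rewrite ltrNl.
Qed.

Lemma Iab_gt a b c : Iab a b c -> exists2 d, Iab a b d & c < d.
Proof. by move=> Ic; have [ys [Iy _ _ H]] := Iab_up Ic; have [n] := H c Ic; exists (ys n). Qed.

Lemma Iab_lt a b c : Iab a b c -> exists2 d, Iab a b d & d < c.
Proof. by move=> Ic; have [xs [Ix _ _ H]] := Iab_down Ic; have [n] := H c Ic; exists (xs n). Qed.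

(** Monotone convergence, applied to the two nonnegative functions in [f = (|f| + f) - |f|]. *)
Lemma exhaust_cvg mu (E : (set R)^nat) (f : R -> R) :
  (forall n, measurable (E n)) -> (forall n k, (n <= k)%N -> E n `<=` E k) ->
  mu.-integrable (\bigcup_n E n) (EFin \o f) ->
  Rintegral mu (E n) f @[n --> \oo] --> Rintegral mu (\bigcup_n E n) f.
Proof.
move=> mE nE fi; have mU : measurable (\bigcup_n E n) by exact: bigcup_measurable.
have sub n : E n `<=` \bigcup_n E n by move=> t Et; exists n.
have pos (g : R -> R) : (forall t, 0 <= g t) -> mu.-integrable (\bigcup_n E n) (EFin \o g) ->
    Rintegral mu (E n) g @[n --> \oo] --> Rintegral mu (\bigcup_n E n) g.
  move=> g0 gi; apply: (@fine_cvg _ _ _ _ (fun n => \int[mu]_(x in E n) (g x)%:E)%E).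
  rewrite -Rint_EFin//; apply: ge0_nondecreasing_set_cvg_integral => //.
  - by move=> n k nk; apply/subsetPset; exact: nE.
  - move=> n; apply: measurable_funS (measurable_int _ gi) => //.
  - by move=> n t _; rewrite lee_fin.
have ni := integrable_norm fi.
have pi : mu.-integrable (\bigcup_n E n) (EFin \o (fun x => `|f x| + f x)).
  exact: integrableDr.
have eq (A : set R) : measurable A -> A `<=` \bigcup_n E n -> Rintegral mu A f =
    Rintegral mu A (fun x => `|f x| + f x) - Rintegral mu A (fun x => `|f x|).
  move=> mA sA; rewrite RintegralD//; first by rewrite addrAC subrr add0r.
  - exact: (integrableS mU mA sA).
  - exact: (integrableS mU mA sA).
rewrite (eq _ mU)//.
rewrite (_ : (fun n => Rintegral mu (E n) f) = (fun n =>
  Rintegral mu (E n) (fun x => `|f x| + f x) - Rintegral mu (E n) (fun x => `|f x|))); last first.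
  by apply/funext => n; rewrite eq.
apply: cvgB; apply: pos => // t.
by rewrite -lerBlDr sub0r -normrN ler_norm.
Qed.

Lemma exhaust_le mu (E : (set R)^nat) (f : R -> R) (M : R) :
  (forall n, measurable (E n)) -> (forall n k, (n <= k)%N -> E n `<=` E k) ->
  (forall n, measurable_fun (E n) f) -> (forall t, 0 <= f t) ->
  (forall n, (\int[mu]_(t in E n) (f t)%:E <= M%:E)%E) ->
  (\int[mu]_(t in \bigcup_n E n) (f t)%:E <= M%:E)%E.
Proof.
move=> mE nE mf f0 fM.
have c : (\int[mu]_(x in E n) (f x)%:E)%E @[n --> \oo] -->
    (\int[mu]_(x in \bigcup_n E n) (f x)%:E)%E.
  apply: ge0_nondecreasing_set_cvg_integral => //.
  - by move=> n k nk; apply/subsetPset; exact: nE.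
  - by move=> n; exact/measurable_EFinP.
  - by move=> n t _; rewrite lee_fin.
rewrite -(cvg_lim (@ereal_hausdorff R) c); apply: lime_le.
  by apply/cvg_ex; eexists; exact: c.
exact: nearW.
Qed.

Lemma Ico_exhaust (x0 t : R) : x0 < t -> exists ts : nat -> R,
  [/\ forall n, x0 <= ts n, forall n, ts n < t, forall n k, (n <= k)%N -> ts n <= ts k
    & \bigcup_n Ico x0 (ts n) = Ico x0 t].
Proof.
move=> xt.
have It : Iab -oo%E t%:E x0 by split; rewrite ?ltNyr ?lte_fin.
have [ts [Its xts nts Hts]] := Iab_up It.
have tt n : ts n < t by have [_] := Its n; rewrite lte_fin.
exists ts; split => //.
apply/seteqP; split => [s [n _] /andP[xs st]|s /andP[xs st]].
  by rewrite /Ico/= xs (lt_trans st).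
have [|n sn] := Hts s; first by split; rewrite ?ltNyr ?lte_fin.
by exists n => //; rewrite /Ico/= xs.
Qed.

(** The intervals [[x, t)] shrink to the empty set as [x] increases to [t], so an atom at [t] is not
    seen. This is the source of left continuity. *)
Lemma left_small (K : finType) (m : K -> Msr) (h : K -> R -> R) (x0 t e : R) : x0 < t ->
  (forall k, (m k).-integrable (Ico x0 t) (EFin \o h k)) -> (forall k s, 0 <= h k s) ->
  0 < e -> exists x1, [/\ x0 <= x1, x1 < t & forall x, x1 <= x -> x <= t ->
    \sum_k Rintegral (m k) (Ico x t) (h k) <= e].
Proof.
move=> xt hi h0 e0; have [ts [xts tst nts U]] := Ico_exhaust xt.
have mI := @measurable_Ico R.
have c : \sum_k Rintegral (m k) (Ico x0 (ts n)) (h k) @[n --> \oo] -->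
    \sum_k Rintegral (m k) (Ico x0 t) (h k).
  elim: (index_enum K) => [|k r IH].
    by rewrite big_nil; under eq_fun do rewrite big_nil; exact: cvg_cst.
  rewrite big_cons; under eq_fun do rewrite big_cons.
  apply: cvgD => //.
  have := @exhaust_cvg (m k) (fun n => Ico x0 (ts n)) (h k).
  rewrite U; apply => //.
  by move=> n j nj; apply: IcoS => //; exact: nts.
move/cvgrPdist_le : c => /(_ _ e0)[N _ HN].
have := HN N (leqnn N); rewrite -sumrB => le1.
exists (ts N); split => // x tx xt'; apply: le_trans le1.
rewrite (le_trans _ (ler_norm _))//; apply: ler_sum => k _.
have sub : Ico (ts N) t `<=` Ico x0 t by exact: IcoS.
rewrite (Ico_setU (xts N) (ltW (tst N))) Rintegral_setU//.
- rewrite addrAC subrr add0r; apply: le_Rintegral_set => //; first exact: IcoS.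
  exact: integrableS (hi k).
- by rewrite -(Ico_setU (xts N) (ltW (tst N))).
- exact: Ico_disj.
Qed.

(** On this side the intervals must be open at [t]: an atom there stays in every [[t, x)] and its
    mass does not become small. *)
Lemma right_small mu (t d e : R) : t < d -> (mu (Ioo t d) < +oo)%E -> 0 < e ->
  exists x1, [/\ t < x1, x1 <= d & forall x, x <= x1 -> (mu (Ioo t x) <= e%:E)%E].
Proof.
move=> td fin e0.
have It : Iab t%:E +oo%E d by split; rewrite ?ltry ?lte_fin.
have [ts [Its tsd nts Hts]] := Iab_down It.
have tts n : t < ts n by have [+ _] := Its n; rewrite lte_fin.
have mI := @measurable_Ico R; have mO := @measurable_Ioo R.
have U : \bigcup_n Ico (ts n) d = Ioo t d.
  apply/seteqP; split => [s [n _] /andP[ns sd]|s /andP[ts_ sd]].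
    by rewrite /Ioo/= sd (lt_le_trans (tts n)).
  have [|n sn] := Hts s; first by split; rewrite ?ltry ?lte_fin.
  by exists n => //; rewrite /Ico/= sd ltW.
have one : mu.-integrable (\bigcup_n Ico (ts n) d) (EFin \o (fun=> 1)).
  by rewrite U; apply: (integrable_bounded (M := 1)) => // x _; rewrite normr1.
have c := @exhaust_cvg mu (fun n => Ico (ts n) d) (fun=> 1) (fun n => mI _ _) _ one.
rewrite U in c; have {}c := c (fun n k nk => IcoS (nts n k nk) (lexx d)).
move/cvgrPdist_le : c => /(_ _ e0)[N _ HN].
have := HN N (leqnn N); rewrite !Rintegral_cst// !mul1r => le1.
exists (ts N); split => // x xt.
have finI : (mu (Ico (ts N) d) < +oo)%E.
  apply: le_lt_trans fin; apply: le_measure; rewrite ?inE// -U.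
  by move=> s sN; exists N.
have e1 : mu (Ioo t d) = (mu (Ioo t (ts N)) + mu (Ico (ts N) d))%E.
  rewrite -measureU//.
    congr (mu _); apply/seteqP; split => s; rewrite /Ioo/Ico/=.
      move=> /andP[ts_ sd]; have [sN|Ns] := ltP s (ts N); last by right.
      by left; rewrite ts_.
    move=> [/andP[-> sN]|/andP[Ns ->]]; first by rewrite (lt_le_trans sN).
    by rewrite (lt_le_trans (tts N)).
  apply/seteqP; split => // s [/andP[_ sN] /andP[Ns _]].
  by have := lt_le_trans sN Ns; rewrite ltxx.
have fin2 : (mu (Ioo t (ts N)) < +oo)%E.
  apply: le_lt_trans fin; apply: le_measure; rewrite ?inE//.
  by move=> s /andP[ts_ sN]; rewrite /Ioo/= ts_ (lt_le_trans sN).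
apply: (@le_trans _ _ (mu (Ioo t (ts N)))).
  apply: le_measure; rewrite ?inE//.
  by move=> s /andP[ts_ sN]; rewrite /Ioo/= ts_ (lt_le_trans sN).
have f1 : mu (Ioo t (ts N)) \is a fin_num by rewrite ge0_fin_numE.
have f2 : mu (Ico (ts N) d) \is a fin_num by rewrite ge0_fin_numE.
rewrite -(fineK f1) lee_fin; apply: le_trans le1.
by rewrite e1 fineD// addrK ler_norm.
Qed.

(** Dynkin's theorem for the two set functions with density [h]. A closed right half-line meets
    [[x0, y0)] in an interval ending at [y0], where the hypothesis applies, and these half-lines
    generate the Borel sets. *)
Lemma Rintegral_pi_lambda mu nu (x0 y0 : R) (h : R -> R) : x0 <= y0 ->
  mu.-integrable (Ico x0 y0) (EFin \o h) -> nu.-integrable (Ico x0 y0) (EFin \o h) ->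
  (forall x, x0 <= x -> x <= y0 -> Rintegral mu (Ico x y0) h = Rintegral nu (Ico x y0) h) ->
  forall A, measurable A ->
    Rintegral mu (Ico x0 y0 `&` A) h = Rintegral nu (Ico x0 y0 `&` A) h.
Proof.
move=> xy mi ni H; have mI := @measurable_Ico R.
pose P (A : set R) := Rintegral mu (Ico x0 y0 `&` A) h = Rintegral nu (Ico x0 y0 `&` A) h.
have mIA (A : set R) : measurable A -> measurable (Ico x0 y0 `&` A) by move=> mA; exact: measurableI.
have subI (A : set R) : Ico x0 y0 `&` A `<=` Ico x0 y0 by move=> t [].
have miA (A : set R) : measurable A -> mu.-integrable (Ico x0 y0 `&` A) (EFin \o h).
  by move=> mA; exact: (integrableS (mI x0 y0) (mIA A mA) (subI A)).
have niA (A : set R) : measurable A -> nu.-integrable (Ico x0 y0 `&` A) (EFin \o h).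
  by move=> mA; exact: (integrableS (mI x0 y0) (mIA A mA) (subI A)).
have PT : P setT by rewrite /P setIT; exact: H.
suff W : forall A, <<s @RGenCInfty.G R >> A -> P A.
  move=> A mA; apply: W.
  have := RGenCInfty.measurableE R => e.
  by have : ((ocitv (R:=R)).-sigma.-measurable) A by []; rewrite e.
apply: (@dynkin_induction _ _ (@RGenCInfty.G R) P).
- exact: RGenCInfty.measurableE.
- move=> _ _ [x ->] [y ->]; exists (Num.max x y); apply/seteqP; split => t /=.
    by rewrite !in_itv/= !andbT ge_max => -[-> ->].
  by rewrite !in_itv/= !andbT ge_max => /andP[-> ->].
- exact: PT.
- move=> _ [x ->]; rewrite /P.
  have -> : Ico x0 y0 `&` [set` `[x, +oo[] = Ico (Num.max x0 x) y0.
    apply/seteqP; split => t; rewrite /Ico/= in_itv/= andbT ge_max.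
      by move=> [/andP[-> ->] ->].
    by move=> /andP[/andP[-> ->] ->].
  have [yx|/ltW xy'] := leP y0 (Num.max x0 x).
    by rewrite Ico_empty// !Rintegral_set0.
  by apply: H => //; rewrite le_max lexx.
- move=> S mS PS; rewrite /P.
  have dec : Ico x0 y0 = (Ico x0 y0 `&` S) `|` (Ico x0 y0 `&` ~` S).
    by rewrite -setIUr setUv setIT.
  have dj : [disjoint Ico x0 y0 `&` S & Ico x0 y0 `&` ~` S].
    by apply/disj_setPS => t [[_ St] [_ nSt]].
  have mSC := measurableC mS.
  have := PT; rewrite /P setIT {1 2}dec.
  rewrite !Rintegral_setU//; try exact: mIA.
  - by rewrite PS => /addrI.
  - by rewrite -dec.
  - by rewrite -dec.
- move=> F mF tF PF; rewrite /P setI_bigcupr.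
  have tF' : trivIset [set: nat] (fun k => Ico x0 y0 `&` F k).
    by apply: trivIset_setIl.
  have mU : measurable (\bigcup_k (Ico x0 y0 `&` F k)).
    by apply: bigcup_measurable => k _; exact: mIA.
  have sU : \bigcup_k (Ico x0 y0 `&` F k) `<=` Ico x0 y0 by move=> t [k _ []].
  rewrite /Rintegral; congr fine.
  rewrite !integral_bigcup//.
  + apply: eq_eseriesr => k _.
    by rewrite (Rint_EFin (mIA _ (mF k)) (miA _ (mF k))) (Rint_EFin (mIA _ (mF k)) (niA _ (mF k))) PF.
  + by move=> k; exact: mIA.
  + exact: (integrableS (mI x0 y0) mU sU).
  + by move=> k; exact: mIA.
  + exact: (integrableS (mI x0 y0) mU sU).
Qed.

Lemma Rintegral_eq0_ae mu (D : set R) (f : R -> R) : measurable D ->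
  mu.-integrable D (EFin \o f) -> (forall t, D t -> 0 < f t) -> Rintegral mu D f = 0 ->
  mu D = 0%E.
Proof.
move=> mD fi f0 e.
have /(ae_eq_integral_abs mu mD (measurable_int _ fi))[N [mN N0 sub]] :
    (\int[mu]_(x in D) `|(EFin \o f) x| = 0)%E.
  have -> : (\int[mu]_(x in D) `|(EFin \o f) x| = \int[mu]_(x in D) (f x)%:E)%E.
    by apply: eq_integral => t; rewrite inE => Dt /=; rewrite gtr0_norm// f0.
  by rewrite Rint_EFin// e.
apply: subset_measure0 N0 => // t Dt; apply: sub => /= H.
by have := H Dt => -[] /eqP; rewrite gt_eqF// f0.
Qed.

(** Equality of the integrals is tested on the set that separates the two measures: there one side
    integrates over a null set, so the other side is 0 and, [h] being positive, its measure is null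
    as well. *)
Lemma jordan_zero_null mu nu (x0 y0 : R) (h : R -> R) : x0 <= y0 ->
  jordan_pair mu nu ->
  mu.-integrable (Ico x0 y0) (EFin \o h) -> nu.-integrable (Ico x0 y0) (EFin \o h) ->
  (forall x, x0 <= x -> x <= y0 -> Rintegral mu (Ico x y0) h = Rintegral nu (Ico x y0) h) ->
  (forall t, Ico x0 y0 t -> 0 < h t) ->
  mu (Ico x0 y0) = 0%E /\ nu (Ico x0 y0) = 0%E.
Proof.
move=> xy [P [mP [muP nuP]]] mi ni H h0; have mI := measurable_Ico x0 y0.
have mPC := measurableC mP.
have key := Rintegral_pi_lambda xy mi ni H.
have z (rho : Msr) (A : set R) : measurable A -> rho A = 0%E -> rho.-integrable (Ico x0 y0) (EFin \o h) ->
    Rintegral rho (Ico x0 y0 `&` A) h = 0.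
  move=> mA A0 hi; rewrite /Rintegral null_set_integral//.
  - exact: measurableI.
  - by apply: measurable_funS (measurable_int _ hi) => // t [].
  - by apply: subset_measure0 A0; [exact: measurableI|by []|move=> t []].
have e1 : mu (Ico x0 y0 `&` P) = 0%E.
  apply: (@Rintegral_eq0_ae mu _ h); first exact: measurableI.
  - by apply: integrableS mi; [exact: mI|exact: measurableI|move=> t []].
  - by move=> t [/h0].
  - by rewrite key// z.
have e2 : nu (Ico x0 y0 `&` ~` P) = 0%E.
  apply: (@Rintegral_eq0_ae nu _ h); first exact: measurableI.
  - by apply: integrableS ni; [exact: mI|exact: measurableI|move=> t []].
  - by move=> t [/h0].
  - by rewrite -key// z.
have dec : Ico x0 y0 = (Ico x0 y0 `&` P) `|` (Ico x0 y0 `&` ~` P).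
  by rewrite -setIUr setUv setIT.
have U (rho : Msr) : rho (Ico x0 y0 `&` P) = 0%E -> rho (Ico x0 y0 `&` ~` P) = 0%E ->
    rho (Ico x0 y0) = 0%E.
  move=> r1 r2; apply/eqP; rewrite -measure_le0 dec.
  apply: le_trans (measureU2 _ _ _) _; try exact: measurableI.
  by rewrite [X in (X + _)%E]r1 [X in (_ + X)%E]r2 adde0.
split; apply: U => //.
  by apply: subset_measure0 muP; [exact: measurableI|by []|move=> t []].
by apply: subset_measure0 nuP; [exact: measurableI|by []|move=> t []].
Qed.

Lemma Rintegral_cauchy_schwarz mu (D : set R) (u v : R -> R) : measurable D ->
  mu.-integrable D (EFin \o (fun t => u t ^+ 2)) ->
  mu.-integrable D (EFin \o (fun t => v t ^+ 2)) ->
  mu.-integrable D (EFin \o (fun t => u t * v t)) ->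
  (Rintegral mu D (fun t => u t * v t)) ^+ 2 <=
  Rintegral mu D (fun t => u t ^+ 2) * Rintegral mu D (fun t => v t ^+ 2).
Proof.
move=> mD ui vi uvi.
set A := Rintegral mu D (fun t => u t ^+ 2).
set B := Rintegral mu D (fun t => u t * v t).
set E := Rintegral mu D (fun t => v t ^+ 2).
have A0 : 0 <= A by apply: Rintegral_ge0 => t _; exact: sqr_ge0.
have key (l : R) : 0 <= l ^+ 2 * A - 2 * l * B + E.
  have -> : l ^+ 2 * A - 2 * l * B + E =
      Rintegral mu D (fun t => (l * u t - v t) ^+ 2).
    rewrite /A /B /E -!RintegralZl//.
    rewrite -RintegralB//; [|exact: integrableZr'..].
    rewrite -RintegralD//; last first.
      by apply: integrableBr => //; exact: integrableZr'.
    by apply: eq_Rintegral => t _; ring.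
  by apply: Rintegral_ge0 => t _; exact: sqr_ge0.
have [A00|An0] := eqVneq A 0.
  (* For [A = 0] the quadratic is affine in [l], and this choice makes it equal to -1 unless
     [B = 0]. *)
  have := key ((E + 1) / (2 * B)); rewrite A00.
  have [->|Bn0] := eqVneq B 0; first by rewrite expr0n mul0r.
  rewrite mulr0 add0r mul0r.
  have -> : 2 * ((E + 1) / (2 * B)) * B = E + 1 by field.
  by rewrite opprD addrAC addNr add0r lerNr oppr0 ler10.
have Ap : 0 < A by rewrite lt_def An0.
(* The minimiser of the quadratic. *)
have := key (B / A).
have -> : (B / A) ^+ 2 * A - 2 * (B / A) * B + E = E - B ^+ 2 / A by field.
by rewrite subr_ge0 ler_pdivrMr// mulrC.
Qed.

End MeasureTools.

Lemma abscont_var (R : realType) (K : finType) (m : K -> {measure set R -> \bar R})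
    (D : set R) (F : R -> R[i]) (F' : K -> R -> R[i]) x y :
  abscont m D F F' -> D x -> D y -> x <= y ->
  n1 (F y - F x) <= \sum_k Rintegral (m k) (Ico x y) (fun t => n1 (F' k t)).
Proof.
move=> [Fi FE] Dx Dy xy; rewrite (FE _ _ Dx Dy xy) addrAC subrr add0r.
rewrite (le_trans (n1_sum _ _ _))// ler_sum// => k _.
by apply: n1_Cint; [exact: measurable_Ico|exact: Fi].
Qed.

Lemma abscont_left_cont (R : realType) (K : finType) (m : K -> {measure set R -> \bar R})
    (D : set R) (F : R -> R[i]) (F' : K -> R -> R[i]) x0 t e :
  admissible m D -> abscont m D F F' -> D x0 -> D t -> x0 < t -> 0 < e ->
  exists x1, [/\ x0 <= x1, x1 < t & forall x, x1 <= x -> x <= t ->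
    \sum_k Rintegral (m k) (Ico x t) (fun s => n1 (F' k s)) <= e /\ n1 (F t - F x) <= e].
Proof.
move=> aD aF Dx0 Dt xt e0; have [Fi _] := aF.
have [|k s|x1 [xx1 x1t H]] := @left_small R K m (fun k s => n1 (F' k s)) x0 t e xt _ _ e0.
- move=> k; apply: Cintegrable_n1; first exact: measurable_Ico.
  by apply: Fi => //; exact: ltW.
- exact: n1_ge0.
exists x1; split => // x x1x xt'; have le1 := H _ x1x xt'.
have Dx := aD.1 x0 t x Dx0 Dt (le_trans xx1 x1x) xt'.
by split => //; apply: le_trans le1; exact: abscont_var aF Dx Dt xt'.
Qed.

(** A Lindelöf argument: the null intervals with rational ends are countably many and cover [U]. *)
Lemma open_null (R : realType) (rho : {measure set R -> \bar R}) (U : set R) :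
  measurable U -> (forall x, U x -> exists2 e : R, 0 < e & rho (Ioo (x - e) (x + e)) = 0%E) ->
  rho U = 0%E.
Proof.
move=> mU H; apply/negligibleP => //.
(* Codes that decode to no pair of rationals, or to an interval that is not null, contribute the
   empty set. *)
pose F (n : nat) : set R := if (unpickle n : option (rat * rat)) is Some r then
   (if rho (Ioo (ratr r.1) (ratr r.2)) == 0%E then Ioo (ratr r.1) (ratr r.2) else set0)
  else set0.
apply: (@negligibleS _ _ _ rho (\bigcup_n F n)); last first.
  apply: negligible_bigcup => n; rewrite /F.
  case: unpickle => [r|]; last exact: negligible_set0.
  case: eqP => [e|_]; last exact: negligible_set0.
  by apply/negligibleP => //; exact: measurable_Ioo.
move=> x /H[e e0 re].
have [r1 ] := @rat_in_itvoo R (x - e) x ltac:(by rewrite ltrBlDr ltrDl).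
rewrite in_itv/= => /andP[h1 h2].
have [r2 ] := @rat_in_itvoo R x (x + e) ltac:(by rewrite ltrDl).
rewrite in_itv/= => /andP[h3 h4].
have [n nE] : exists n, unpickle n = Some (r1, r2).
  by exists (pickle (r1, r2)); exact: pickleK.
exists n; first exact: Logic.I.
rewrite /F nE /=.
have -> : rho (Ioo (ratr r1) (ratr r2)) = 0%E.
  apply: subset_measure0 re; [exact: measurable_Ioo|exact: measurable_Ioo|].
  by move=> t /andP[a1 a2]; rewrite /Ioo/= (lt_trans h1)// (lt_trans a2).
by rewrite eqxx /Ioo/= h2 h3.
Qed.

(** * Solutions vanishing almost everywhere *)

Section Injectivity.
Variable R : realType.
Local Notation C := (R[i]).
Local Notation Msr := {measure set R -> \bar R}.
Variables (a b : \bar R) (rho sp sm cp cm : Msr).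
Hypotheses (hab : (a < b)%E)
  (Hrho : loc_finite_on a b rho)
  (Hsp : loc_finite_on a b sp) (Hsm : loc_finite_on a b sm)
  (Hs : jordan_pair sp sm)
  (Hsupp : forall x, Iab a b x -> forall e : R, 0 < e ->
     (0 < measure_add sp sm (Ioo (x - e) (x + e)))%E)
  (Hcp : loc_finite_on a b cp) (Hcm : loc_finite_on a b cm)
  (Hc : jordan_pair cp cm)
  (H4chi : forall x : R,
     ((sp [set x] - sm [set x]) * (cp [set x] - cm [set x]) = 0)%E)
  (H4rho : forall x : R, ((sp [set x] - sm [set x]) * rho [set x] = 0)%E)
  (H5 : gap_hyp a b rho sp sm cp cm).

Local Notation I := (Iab a b).
Local Notation M5 := (mfam rho sp sm cp cm).
Local Notation Qd := (qd M5 ord_max (scoef R) (qcoef R) I).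
Let aI : admissible M5 I := admissible_mfam Hrho Hsp Hsm Hcp Hcm.
Let nI : noatoms M5 ord_max (scoef R) (qcoef R) I := noatoms_mfam a b Hs Hc H4chi H4rho.

Lemma supp_pos_false (h : R -> R) x0 t : I x0 -> I t -> x0 < t ->
  sp.-integrable (Ico x0 t) (EFin \o h) -> sm.-integrable (Ico x0 t) (EFin \o h) ->
  (forall x, x0 <= x -> x <= t -> Rintegral sp (Ico x t) h = Rintegral sm (Ico x t) h) ->
  ~ exists x1, [/\ x0 <= x1, x1 < t & forall x, x1 <= x -> x < t -> 0 < h x].
Proof.
move=> Ix0 It xt pi mi H [x1 [x01 x1t hp]].
have mI := @measurable_Ico R; have sub := IcoS x01 (lexx t).
have [||x x1x xt'|s /andP[s1 s2]|e1 e2] := @jordan_zero_null R sp sm x1 t h (ltW x1t) Hs.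
- exact: (integrableS (mI x0 t) (mI x1 t) sub pi).
- exact: (integrableS (mI x0 t) (mI x1 t) sub mi).
- by apply: H => //; exact: le_trans x1x.
- exact: hp.
(* Half the length, so that the neighbourhood of the midpoint is exactly [(x1, t)]. *)
have e0 : 0 < (t - x1) / 2 by rewrite divr_gt0// subr_gt0.
have Imid : I ((x1 + t) / 2).
  by apply: (Iab_conv Ix0 It); [rewrite (le_trans x01)// midf_le// ltW|rewrite midf_le// ltW].
have := Hsupp Imid e0.
rewrite (_ : (x1 + t) / 2 - (t - x1) / 2 = x1); last by field.
rewrite (_ : (x1 + t) / 2 + (t - x1) / 2 = t); last by field.
have sO : Ioo x1 t `<=` Ico x1 t by move=> s /andP[s1 s2]; rewrite /Ico/= s2 ltW.
rewrite measure_addE (subset_measure0 _ _ sO e1) ?(subset_measure0 _ _ sO e2) ?adde0 ?ltxx//.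
all: try exact: measurable_Ioo.
Qed.

(* On the interval p is the density of the zero measure with respect to sigma; were p nonzero at t,
   left continuity would give a Re or Im part of constant sign before t, so |sigma| would vanish
   there, against supp sigma = (a, b). *)
Lemma qd_zero_quasi f p g x0 y0 : Qd f p g -> I x0 -> I y0 ->
  (forall x, x0 < x -> x < y0 -> f x = 0) -> forall t, x0 < t -> t < y0 -> p t = 0.
Proof.
move=> qf Ix0 Iy0 f0 t xt ty; have [lf lp] := qd_lbm aI qf; have [af ap] := qf.
have It : I t by apply: (Iab_conv Ix0 Iy0); exact: ltW.
(* [f] is known to vanish only strictly to the right of [x0], so the argument starts from an
   interior point. *)
pose x1 := (x0 + t) / 2.
have x01 : x0 < x1 by rewrite midf_lt.
have x1t : x1 < t by rewrite midf_lt.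
have Ix1 : I x1 by apply: (Iab_conv Ix0 It); exact: ltW.
have mI := @measurable_Ico R.
have pp : Cintegrable sp (Ico x1 t) p := @lbm_int _ _ M5 _ _ (@Ordinal 5 0 isT) _ _ aI lp Ix1 It.
have pm : Cintegrable sm (Ico x1 t) p := @lbm_int _ _ M5 _ _ (@Ordinal 5 1 isT) _ _ aI lp Ix1 It.
have eqC x : x1 <= x -> x <= t -> Cint sp (Ico x t) p = Cint sm (Ico x t) p.
  move=> x1x xt'; have Ix : I x by apply: (Iab_conv Ix1 It).
  have := af.2 _ _ Ix It xt'.
  have ft : f t = 0 by exact: f0.
  have fx : f x = 0 by apply: f0; [exact: lt_le_trans x1x|exact: le_lt_trans ty].
  rewrite ft fx.
  have sub := IcoS x1x (lexx t).
  rewrite add0r sum_s//.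
  - by move=> /esym/eqP; rewrite subr_eq0 => /eqP.
  - exact: (CintegrableS (mI x t) (mI x1 t) sub pp).
  - exact: (CintegrableS (mI x t) (mI x1 t) sub pm).
have pos (h : R -> R) : sp.-integrable (Ico x1 t) (EFin \o h) ->
    sm.-integrable (Ico x1 t) (EFin \o h) ->
    (forall x, x1 <= x -> x <= t -> Rintegral sp (Ico x t) h = Rintegral sm (Ico x t) h) ->
    (forall x, `|h t - h x| <= n1 (p t - p x)) -> ~ 0 < h t.
  move=> hp hm H hl ht.
  have e0 : 0 < h t / 2 by rewrite divr_gt0.
  have [x2 [x12 x2t lc]] := abscont_left_cont aI ap Ix1 It x1t e0.
  apply: (supp_pos_false Ix1 It x1t hp hm H); exists x2; split => // x x2x xt'.
  have [_ le1] := lc x x2x (ltW xt').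
  have := le_trans (hl x) le1; rewrite ler_distlC => /andP[+ _].
  by move=> hx; apply: lt_le_trans hx; lra.
have neg (mu : Msr) (h : R -> R) x : x1 <= x -> mu.-integrable (Ico x1 t) (EFin \o h) ->
    Rintegral mu (Ico x t) (fun s => - h s) = - Rintegral mu (Ico x t) h.
  move=> x1x hi; have sub := IcoS x1x (lexx t).
  have := integrableS (mI x1 t) (mI x t) sub hi => hi'.
  rewrite -mulN1r -RintegralZl//; apply: eq_Rintegral => s _; by rewrite mulN1r.
have zero (h : R -> R) : sp.-integrable (Ico x1 t) (EFin \o h) ->
    sm.-integrable (Ico x1 t) (EFin \o h) ->
    (forall x, x1 <= x -> x <= t -> Rintegral sp (Ico x t) h = Rintegral sm (Ico x t) h) ->
    (forall x, `|h t - h x| <= n1 (p t - p x)) -> h t = 0.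
  move=> hp hm H hl.
  have n1' := pos h hp hm H hl.
  have n2' := pos (fun x => - h x) (integrableNr (mI _ _) hp) (integrableNr (mI _ _) hm).
  apply/eqP; rewrite eq_le !leNgt; apply/andP; split; apply/negP; first exact: n1'.
  rewrite -oppr_gt0; apply: n2' => x.
    by move=> x1x xt'; rewrite !neg// H.
  by rewrite -opprD normrN.
apply: Cext.
  apply: (zero (fun x => complex.Re (p x)) pp.1 pm.1) => x.
    by move=> x1x xt'; have := eqC x x1x xt' => -[].
  by rewrite -cReN -cReD Re_le_n1.
apply: (zero (fun x => complex.Im (p x)) pp.2 pm.2) => x.
  by move=> x1x xt'; have := eqC x x1x xt' => -[].
by rewrite -cImN -cImD Im_le_n1.
Qed.

(** Only sigma moves [f]. Over an interval that avoids the atom at its limit point, the masses of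
    sigma, and with them the change of [f], become small from the right. *)
Lemma f_var f p g y x (M : R) : Qd f p g -> I y -> I x -> y <= x ->
  (forall t, Ico y x t -> n1 (p t) <= M) ->
  n1 (f x - f y) <= M * fine (sp (Ico y x)) + M * fine (sm (Ico y x)).
Proof.
move=> qf Iy Ix yx pM; have [lf lp] := qd_lbm aI qf; have [af _] := qf.
have mI := @measurable_Ico R.
have pp : Cintegrable sp (Ico y x) p := @lbm_int _ _ M5 _ _ (@Ordinal 5 0 isT) _ _ aI lp Iy Ix.
have pm : Cintegrable sm (Ico y x) p := @lbm_int _ _ M5 _ _ (@Ordinal 5 1 isT) _ _ aI lp Iy Ix.
rewrite (af.2 _ _ Iy Ix yx) sum_s// addrAC subrr add0r (le_trans (n1B _ _))//.
apply: lerD; apply: n1_Cint_bounded => //.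
  exact: (@admissible_Ico _ _ M5 I (@Ordinal 5 0 isT)).
exact: (@admissible_Ico _ _ M5 I (@Ordinal 5 1 isT)).
Qed.

Lemma left_limit (f : R -> C) (t : R) :
  (forall e : R, 0 < e -> exists2 x1, x1 < t & forall x, x1 <= x -> x < t -> n1 (f x) <= e) ->
  (fun x => complex.Re (f x)) @ t^'- --> (0 : R) /\ (fun x => complex.Im (f x)) @ t^'- --> (0 : R).
Proof.
move=> H; split; apply/cvgrPdist_le => e e0; have [x1 x1t Hx] := H e e0; near=> x;
  rewrite sub0r normrN.
- apply: le_trans (Re_le_n1 _) _; apply: Hx.
  + by near: x; exact: nbhs_left_ge.
  + by near: x; exact: nbhs_left_lt.
- apply: le_trans (Im_le_n1 _) _; apply: Hx.
  + by near: x; exact: nbhs_left_ge.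
  + by near: x; exact: nbhs_left_lt.
Unshelve. all: by end_near. Qed.

Lemma right_limit (f : R -> C) (t : R) :
  (forall e : R, 0 < e -> exists2 x1, t < x1 & forall x, t < x -> x <= x1 -> n1 (f x) <= e) ->
  (fun x => complex.Re (f x)) @ t^'+ --> (0 : R) /\ (fun x => complex.Im (f x)) @ t^'+ --> (0 : R).
Proof.
move=> H; split; apply/cvgrPdist_le => e e0; have [x1 x1t Hx] := H e e0; near=> x;
  rewrite sub0r normrN.
- apply: le_trans (Re_le_n1 _) _; apply: Hx.
  + by near: x; exact: nbhs_right_gt.
  + by near: x; exact: nbhs_right_le.
- apply: le_trans (Im_le_n1 _) _; apply: Hx.
  + by near: x; exact: nbhs_right_gt.
  + by near: x; exact: nbhs_right_le.
Unshelve. all: by end_near. Qed.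

Lemma supp_closed_left t : I t -> (forall e : R, 0 < e -> exists s, [/\ supp a b rho s, t - e < s & s < t + e]) ->
  supp a b rho t.
Proof.
move=> It H; split => // e e0.
have e20 : 0 < e / 2 by rewrite divr_gt0.
have [s [[Is ps] s1 s2]] := H _ e20.
apply: lt_le_trans (ps _ e20) _; apply: le_measure; rewrite ?inE; try exact: measurable_Ioo.
by move=> x /andP[x1 x2]; rewrite /Ioo/=; apply/andP; split; lra.
Qed.

Section Gap.
Variables (u p : R -> C) (z : C) (al be : R).
Hypotheses (qu : Qd u p (fun x => z * u x)) (Ial : I al) (Ibe : I be)
  (u0 : {ae rho, forall x, Ico al be x -> u x = 0}).

Lemma pos_zero (A : set R) : measurable A -> A `<=` Ico al be -> rho A <> 0%E ->
  exists2 x, A x & u x = 0.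
Proof.
move=> mA sA rA; apply: contrapT => nx; apply: rA.
have [N [mN N0 sub]] := u0; apply: subset_measure0 N0 => // x Ax.
by apply: sub => /= H; apply: nx; exists x => //; apply: H; exact: sA.
Qed.

(** If rho has mass at [c], then [u c = 0] and left continuity suffices. Otherwise, rho being null
    just right of [c], the support condition puts mass in every [(x, c)]; this yields a zero of [u]
    there, and the variation of [u] over [[x, c)] is small. *)
Lemma gap_left_limit c : al < c -> c < be -> supp a b rho c ->
  (exists2 d, c < d & rho (Ioo c d) = 0%E) ->
  forall e : R, 0 < e -> exists2 x1, x1 < c & forall x, x1 <= x -> x < c -> n1 (u x) <= e.
Proof.
move=> alc cbe [Ic sc] [d cd nul] e e0; have [au _] := qu.
have [x1 [x01 x1c H]] := abscont_left_cont aI au Ial Ic alc e0.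
exists x1 => // x x1x xc.
have Ix : I x by apply: (Iab_conv Ial Ic); [exact: le_trans x1x|exact: ltW].
have [le1 le2] := H x x1x (ltW xc).
have [r0|rn0] := eqVneq (rho [set c]) 0%E; last first.
  have sc1 : [set c] `<=` Ico al be by move=> y ->; rewrite /Ico/= cbe ltW.
  have [y -> uc] := pos_zero (measurable_set1 c) sc1 (elimN eqP rn0).
  by move: le2; rewrite uc sub0r n1N.
have [y /andP[xy yc] uy] : exists2 y, Ioo x c y & u y = 0.
  apply: pos_zero; first exact: measurable_Ioo.
    move=> y /andP[xy yc]; rewrite /Ico/= (lt_trans yc)// andbT.
    by rewrite (le_trans x01)// (le_trans x1x)// ltW.
  move=> rx; pose d' := Num.min (c - x) (d - c).
  have d'0 : 0 < d' by rewrite lt_min !subr_gt0 xc.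
  have := sc _ d'0; rewrite lt_neqAle measure_ge0 andbT eq_sym => /eqP; apply.
  have mO := @measurable_Ioo R; have m1 := measurable_set1 c.
  apply: (@subset_measure0 _ _ _ rho _ (Ioo x c `|` ([set c] `|` Ioo c d))).
  - exact: mO.
  - by apply: measurableU => //; exact: measurableU.
  - move=> y /andP[y1 y2]; have : d' <= c - x by rewrite ge_min lexx.
    have : d' <= d - c by rewrite ge_min lexx orbT.
    move=> h1 h2; have [yc|cy|->] := ltgtP y c.
    + by left; rewrite /Ioo/= yc andbT; lra.
    + by right; right; rewrite /Ioo/= cy; lra.
    + by right; left.
  - apply: null_set_setU => //; first exact: measurableU.
    exact: null_set_setU.
have Iy : I y by apply: (Iab_conv Ix Ic); exact: ltW.
rewrite -n1N -sub0r -uy; apply: le_trans (abscont_var au Ix Iy (ltW xy)) _.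
apply: le_trans le1; apply: ler_sum => k _.
apply: le_Rintegral_set; try exact: measurable_Ico.
- by apply: IcoS => //; exact: ltW.
- by apply: Cintegrable_n1; [exact: measurable_Ico|exact: au.1 k _ _ Ix Ic (ltW xc)].
- by move=> s _; exact: n1_ge0.
Qed.

(** Here [u] might jump at [c]. If rho has mass at [c], then [u c = 0], and (H4) rules out a mass of
    sigma there, hence a jump. Otherwise every [(c, x)] contains a zero [y] of [u], and [[y, x)]
    avoids the atom. *)
Lemma gap_right_limit c : al < c -> c < be -> supp a b rho c ->
  (exists2 d, d < c & rho (Ioo d c) = 0%E) ->
  forall e : R, 0 < e -> exists2 x1, c < x1 & forall x, c < x -> x <= x1 -> n1 (u x) <= e.
Proof.
move=> alc cbe [Ic sc] [d dc nul] e e0; have [au _] := qu.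
have [lu lp] := qd_lbm aI qu.
have [_ [M pM]] := lp c be Ic Ibe.
have M0 : 0 <= M by apply: le_trans (n1_ge0 (p c)) (pM c _); rewrite /Icc/= lexx ltW.
(* [M] bounds the quasi-derivative on [[c, be]]; the factor 2 accounts for the two Jordan parts of
   sigma, and the added 1 keeps the divisor positive. *)
pose e' := e / (2 * (M + 1)).
have e'0 : 0 < e' by rewrite divr_gt0// mulr_gt0// ltr_wpDl.
have mO := @measurable_Ioo R.
have fin k : (M5 k (Ioo c be) < +oo)%E.
  apply: le_lt_trans (mfam_fin Hrho Hsp Hsm Hcp Hcm k Ic Ibe).
  apply: le_measure; rewrite ?inE//; first exact: measurable_Icc.
  by move=> s /andP[s1 s2]; rewrite /Icc/= !ltW.
have [x1 [cx1 x1be H1]] := right_small cbe (fin (@Ordinal 5 0 isT)) e'0.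
have [x2 [cx2 x2be H2]] := right_small cbe (fin (@Ordinal 5 1 isT)) e'0.
have bnd (mu : Msr) x A : (mu (Ioo c x) <= e'%:E)%E -> measurable A -> (mu A <= mu (Ioo c x))%E ->
    fine (mu A) <= e'.
  move=> h mA sA; have h' := le_trans sA h.
  have fA : mu A \is a fin_num by rewrite ge0_fin_numE// (le_lt_trans h')// ltry.
  by rewrite -lee_fin fineK.
exists (Num.min (Num.min x1 x2) ((c + be) / 2)).
  by rewrite !lt_min cx1 cx2 midf_lt.
move=> x cx; rewrite !le_min => /andP[/andP[xx1 xx2] xm].
have xbe : x < be by apply: le_lt_trans xm _; rewrite midf_lt.
have Ix : I x by apply: (Iab_conv Ic Ibe); exact: ltW.
have main y : c <= y -> y <= x -> u y = 0 ->
    (sp (Ico y x) <= sp (Ioo c x))%E -> (sm (Ico y x) <= sm (Ioo c x))%E -> n1 (u x) <= e.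
  move=> cy yx uy h1 h2; have Iy : I y by apply: (Iab_conv Ic Ix).
  have := @f_var _ _ _ y x M qu Iy Ix yx; rewrite uy subr0 => fv.
  apply: le_trans (fv _) _.
    by move=> t /andP[yt tx]; apply: pM; rewrite /Icc/= (le_trans cy)// ltW// (lt_trans tx).
  have b1 := bnd sp x (Ico y x) (H1 x xx1) (measurable_Ico _ _) h1.
  have b2 := bnd sm x (Ico y x) (H2 x xx2) (measurable_Ico _ _) h2.
  apply: (@le_trans _ _ (M * e' + M * e')); first by rewrite lerD// ler_wpM2l.
  have -> : M * e' + M * e' = e * (M / (M + 1)) by rewrite /e'; field; rewrite gt_eqF// ltr_wpDl.
  apply: ler_piMr; first exact: ltW.
  by rewrite ler_pdivrMr ?mul1r ?lerDl// ltr_wpDl.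
have mI := @measurable_Ico R.
have [r0|rn0] := eqVneq (rho [set c]) 0%E; last first.
  have sc1 : [set c] `<=` Ico al be by move=> y ->; rewrite /Ico/= cbe ltW.
  have [y -> uc] := pos_zero (measurable_set1 c) sc1 (elimN eqP rn0).
  have at0 k : scoef R k != 0 -> M5 k [set c] = 0%E.
    move=> sk; have [s0|[[_ /eqP//]|h]] := nI k ord_max; first by rewrite s0 eqxx in sk.
    by have [//|r0] := h c Ic; move: rn0; rewrite -[rho]/(M5 ord_max) r0 eqxx.
  have key (mu : Msr) : mu [set c] = 0%E -> (mu (Ico c x) <= mu (Ioo c x))%E.
    move=> m0; apply: (@le_trans _ _ (mu ([set c] `|` Ioo c x))).
      apply: le_measure; rewrite ?inE//; first exact: measurableU.
      move=> s /andP[]; rewrite le_eqVlt => /orP[/eqP <-|cs] sx; [by left|right].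
      by rewrite /Ioo/= cs.
    apply: le_trans (measureU2 _ _ _) _ => //.
    by rewrite [X in (X + _)%E]m0 add0e.
  apply: (main c) => //; first exact: ltW.
    by apply: key; apply: (at0 (@Ordinal 5 0 isT)); rewrite /scoef/= oner_eq0.
  by apply: key; apply: (at0 (@Ordinal 5 1 isT)); rewrite /scoef/= oppr_eq0 oner_eq0.
have [y /andP[cy yx] uy] : exists2 y, Ioo c x y & u y = 0.
  apply: pos_zero; first exact: measurable_Ioo.
    by move=> y /andP[cy yx]; rewrite /Ico/= (lt_trans yx)// andbT ltW// (lt_trans alc).
  move=> rx; pose d' := Num.min (x - c) (c - d).
  have d'0 : 0 < d' by rewrite lt_min !subr_gt0 cx.
  have := sc _ d'0; rewrite lt_neqAle measure_ge0 andbT eq_sym => /eqP; apply.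
  have m1 := measurable_set1 c.
  apply: (@subset_measure0 _ _ _ rho _ (Ioo d c `|` ([set c] `|` Ioo c x))).
  - exact: mO.
  - by apply: measurableU => //; exact: measurableU.
  - move=> y /andP[y1 y2]; have : d' <= x - c by rewrite ge_min lexx.
    have : d' <= c - d by rewrite ge_min lexx orbT.
    move=> h1 h2; have [yc|cy|->] := ltgtP y c.
    + by left; rewrite /Ioo/= yc andbT; lra.
    + by right; right; rewrite /Ioo/= cy; lra.
    + by right; left.
  - apply: null_set_setU => //; first exact: measurableU.
    exact: null_set_setU.
apply: (main y) => //; first exact: ltW.
- exact: ltW.
- apply: le_measure; rewrite ?inE//.
  by move=> s /andP[ys sx]; rewrite /Ioo/= sx (lt_le_trans cy).
- apply: le_measure; rewrite ?inE//.
  by move=> s /andP[ys sx]; rewrite /Ioo/= sx (lt_le_trans cy).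
Qed.

Lemma gap_zero c d : al < c -> c < d -> d < be -> supp a b rho c -> supp a b rho d ->
  (forall x, c < x < d -> ~ supp a b rho x) -> forall x, c < x < d -> u x = 0.
Proof.
move=> alc cd dbe sc sd ns.
have Ic := sc.1; have Id := sd.1.
have nul : rho (Ioo c d) = 0%E.
  apply: open_null; first exact: measurable_Ioo.
  move=> x xcd; have Ix : I x by move: xcd => /andP[/ltW cx /ltW xd]; exact: (Iab_conv Ic Id).
  apply: contrapT => nex; apply: (ns x xcd); split => // e e0.
  rewrite lt_neqAle measure_ge0 andbT eq_sym; apply/eqP => r0; apply: nex; by exists e.
have Du : D_tau a b rho sp sm cp cm u.
  exists (fun x => z * u x); apply: (qd_tau_rel hab Hrho Hsp Hsm Hcp Hcm qu).
  exact: (@lbm_loc_int _ _ _ _ _ _ _ _ Hrho Hsp Hsm Hcp Hcm ord_max _ (lbmZ z (qd_lbm aI qu).1)).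
have cbe : c < be by exact: lt_trans dbe.
have ald : al < d by exact: lt_trans cd.
have [l1 l2] := left_limit (gap_left_limit alc cbe sc (ex_intro2 _ _ d cd nul)).
have [r1 r2] := right_limit (gap_right_limit ald dbe sd (ex_intro2 _ _ c cd nul)).
exact: (H5 cd sc sd ns Du l1 l2 r1 r2).
Qed.

(** A point [t0] off the support between [x1] and [x2] lies in a gap whose ends are a supremum and
    an infimum over the closed support, and [gap_zero] applies. If there is no such point, every
    interval ending at [t] has positive rho mass near [t] and so contains a zero of [u]; left
    continuity then gives [u t = 0]. *)
Lemma vanish_interval x1 x2 : al < x1 -> x1 < x2 -> x2 < be ->
  supp a b rho x1 -> supp a b rho x2 ->
  exists c d, [/\ al <= c, c < d, d <= be & forall x, c < x -> x < d -> u x = 0].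
Proof.
move=> al1 x12 x2be s1 s2.
have [[t0 [t1 t2 nt0]]|all] := pselect (exists t, [/\ x1 < t, t < x2 & ~ supp a b rho t]).
  have It0 : I t0 by apply: (Iab_conv s1.1 s2.1); exact: ltW.
  pose S := [set s | supp a b rho s /\ s <= t0].
  pose S' := [set s | supp a b rho s /\ t0 <= s].
  have S1 : S x1 by split => //; exact: ltW.
  have S2 : S' x2 by split => //; exact: ltW.
  have hS : has_sup S by split; [exists x1|exists t0 => s []].
  have hS' : has_inf S' by split; [exists x2|exists t0 => s []].
  pose c := sup S; pose d := inf S'.
  have x1c : x1 <= c by apply: ub_le_sup => //; exact: hS.2.
  have ct0 : c <= t0 by apply: ge_sup; [exists x1|move=> s []].
  have dx2 : d <= x2 by apply: ge_inf => //; exact: hS'.2.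
  have t0d : t0 <= d by apply: lb_le_inf; [exists x2|move=> s []].
  have Ic : I c by apply: (Iab_conv s1.1 It0).
  have Id : I d by apply: (Iab_conv It0 s2.1).
  have sc : supp a b rho c.
    apply: supp_closed_left => // e e0.
    have [s Ss es] := sup_adherent e0 hS; exists s; split => //; first exact: Ss.1.
    by apply: le_lt_trans (ub_le_sup hS.2 Ss) _; rewrite ltrDl.
  have sd : supp a b rho d.
    apply: supp_closed_left => // e e0.
    have [s Ss es] := inf_adherent e0 hS'; exists s; split => //; first exact: Ss.1.
    by apply: lt_le_trans (ge_inf hS'.2 Ss); rewrite ltrBlDr ltrDl.
  have ct : c < t0 by rewrite lt_neqAle ct0 andbT; apply/eqP => e; apply: nt0; rewrite -e.
  have td : t0 < d by rewrite lt_neqAle t0d andbT; apply/eqP => e; apply: nt0; rewrite e.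
  exists c, d; split.
  - by apply: ltW; exact: lt_le_trans x1c.
  - exact: lt_trans td.
  - by apply: ltW; exact: le_lt_trans x2be.
  - move=> x cx xd; apply: (@gap_zero c d) => //.
    + exact: lt_le_trans x1c.
    + exact: lt_trans td.
    + exact: le_lt_trans x2be.
    + move=> y /andP[cy yd] sy; have [yt|ty] := leP y t0.
        by have := ub_le_sup hS.2 (conj sy yt : S y); rewrite leNgt cy.
      by have := ge_inf hS'.2 (conj sy (ltW ty) : S' y); rewrite leNgt yd.
    + by rewrite cx.
exists x1, x2; split; [exact: ltW|by []|exact: ltW|].
have dense t : x1 < t -> t < x2 -> supp a b rho t.
  by move=> t1 t2; apply: contrapT => nt; apply: all; exists t.
move=> t t1 t2; have It := (dense t t1 t2).1.
have [au _] := qu; apply: n1_eq0; apply/eqP; rewrite eq_le n1_ge0 andbT.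
apply/ler_addgt0Pl => e e0; rewrite addr0.
have [y0 [y01 y0t H]] := abscont_left_cont aI au s1.1 It t1 e0.
pose y := (y0 + t) / 2.
have y0y : y0 < y by rewrite midf_lt.
have yt : y < t by rewrite midf_lt.
have sy : supp a b rho y by apply: dense; [exact: le_lt_trans y0y|exact: lt_trans t2].
have d0 : 0 < (t - y0) / 2 by rewrite divr_gt0// subr_gt0.
have := sy.2 _ d0.
rewrite (_ : y - (t - y0) / 2 = y0); last by rewrite /y; field.
rewrite (_ : y + (t - y0) / 2 = t); last by rewrite /y; field.
rewrite lt_neqAle measure_ge0 andbT eq_sym => /eqP rn0.
have sO : Ioo y0 t `<=` Ico al be.
  move=> s /andP[h1 h2]; rewrite /Ico/=; apply/andP; split.
    by apply: ltW; apply: (lt_trans al1); exact: le_lt_trans h1.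
  by apply: (lt_trans h2); exact: lt_trans x2be.
have [s /andP[h1 h2] us] := pos_zero (measurable_Ioo _ _) sO rn0.
by have [_] := H s (ltW h1) (ltW h2); rewrite us subr0.
Qed.

(** Once [u] vanishes on an interval so does its quasi-derivative, and the data at the midpoint are
    zero. The strict inequalities leave room on the far side of a gap ending at [x1] or [x2], where
    the outer limits needed for (H5) are computed. *)
Lemma sol_inj x1 x2 : al < x1 -> x1 < x2 -> x2 < be ->
  supp a b rho x1 -> supp a b rho x2 -> forall x, I x -> u x = 0 /\ p x = 0.
Proof.
move=> al1 x12 x2be s1 s2.
have [c [d [alc cd dbe u0']]] := vanish_interval al1 x12 x2be s1 s2.
have albe : al <= be by apply: ltW; exact: (lt_trans al1 (lt_trans x12 x2be)).
have Ic : I c by apply: (Iab_conv Ial Ibe alc); exact: ltW (lt_le_trans cd dbe).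
have Id : I d by apply: (Iab_conv Ial Ibe) dbe; exact: le_trans (ltW cd).
have p0' := qd_zero_quasi qu Ic Id u0'.
have m1 : c < (c + d) / 2 by rewrite midf_lt.
have m2 : (c + d) / 2 < d by rewrite midf_lt.
have Im : I ((c + d) / 2) by apply: (Iab_conv Ic Id); exact: ltW.
exact: (sol_unique aI nI Im qu (u0' _ m1 m2) (p0' _ m1 m2)).
Qed.

End Gap.
End Injectivity.

(* v is a priori square integrable only on each compact piece E; the bound does not depend on it, so
   it survives exhausting a half-neighbourhood of an endpoint. *)
Lemma l2_bootstrap (R : realType) (mu : {measure set R -> \bar R}) (E : set R)
    (v U : R -> R) (C1 C eta : R) : measurable E ->
  mu.-integrable E (EFin \o (fun t => v t ^+ 2)) ->
  mu.-integrable E (EFin \o (fun t => U t ^+ 2)) ->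
  mu.-integrable E (EFin \o (fun t => v t * U t)) ->
  (forall t, E t -> 0 <= v t) -> (forall t, E t -> 0 <= U t) ->
  0 <= C1 -> 0 <= C -> 0 <= eta -> 4 * C ^+ 2 * eta ^+ 2 <= 1 ->
  Rintegral mu E (fun t => U t ^+ 2) <= eta ->
  (forall t, E t -> v t <= U t * (C1 + C * Rintegral mu E (fun t => v t * U t))) ->
  Rintegral mu E (fun t => v t ^+ 2) <= 4 * eta * C1 ^+ 2.
Proof.
move=> mE vi Ui vUi v0 U0 C10 C0 eta0 small Ueta vle.
set B := Rintegral mu E (fun t => v t * U t) in vle.
set V := Rintegral mu E (fun t => v t ^+ 2).
have B0 : 0 <= B by apply: Rintegral_ge0 => t Et; rewrite mulr_ge0 ?v0 ?U0.
have V0 : 0 <= V by apply: Rintegral_ge0 => t _; exact: sqr_ge0.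
have CS : B ^+ 2 <= V * eta.
  apply: le_trans (Rintegral_cauchy_schwarz mE vi Ui vUi) _.
  by rewrite ler_wpM2l.
have le1 : V <= eta * (2 * C1 ^+ 2 + 2 * C ^+ 2 * B ^+ 2).
  apply: (@le_trans _ _ (Rintegral mu E (fun t => (2 * C1 ^+ 2 + 2 * C ^+ 2 * B ^+ 2) * U t ^+ 2))).
    apply: le_Rintegral => //; first exact: integrableZr'.
    move=> t Et; apply: (@le_trans _ _ ((U t * (C1 + C * B)) ^+ 2)).
      by rewrite ler_sqr ?nnegrE ?v0// ?mulr_ge0 ?U0// ?addr_ge0// ?mulr_ge0//; exact: vle.
    rewrite exprMn mulrC ler_wpM2r ?sqr_ge0// -subr_ge0.
    rewrite (_ : _ - _ = (C1 - C * B) ^+ 2) ?sqr_ge0//; ring.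
  rewrite RintegralZl// mulrC ler_wpM2r//.
  by rewrite addr_ge0// !mulr_ge0// ?sqr_ge0.
(* By Cauchy-Schwarz and the smallness of [eta], the term in [B] is absorbed into half of [V]. *)
have le2 : eta * (2 * C ^+ 2 * B ^+ 2) <= V / 2.
  apply: (@le_trans _ _ (eta * (2 * C ^+ 2 * (V * eta)))).
    by rewrite ler_wpM2l// ler_wpM2l// mulr_ge0// sqr_ge0.
  rewrite (_ : eta * _ = (4 * C ^+ 2 * eta ^+ 2) * (V / 2)); last by field.
  by apply: ler_piMl => //; rewrite divr_ge0.
by rewrite mulrDr in le1; lra.
Qed.

Lemma Csqn (R : realType) (z : R[i]) : complex.Re z ^+ 2 + complex.Im z ^+ 2 <= n1 z ^+ 2.
Proof.
rewrite /n1 sqrrD !real_normK ?num_real// addrAC lerDl.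
by rewrite mulrn_wge0// mulr_ge0.
Qed.

Lemma n1_sq_le (R : realType) (z : R[i]) :
  n1 z ^+ 2 <= 2 * (complex.Re z ^+ 2 + complex.Im z ^+ 2).
Proof.
rewrite /n1 sqrrD !real_normK ?num_real//.
have := sqr_ge0 (`|complex.Re z| - `|complex.Im z|).
by rewrite sqrrB !real_normK ?num_real//; move: (_ * _) => w; lra.
Qed.

Lemma sqn_lin (R : realType) (z w : R[i]) (u v : R -> R[i]) x :
  sqn (fun x => z * u x + w * v x) x <=
  2 * n1 z ^+ 2 * sqn u x + 2 * n1 w ^+ 2 * sqn v x.
Proof.
have M (y y' : R[i]) : complex.Re (y * y') ^+ 2 + complex.Im (y * y') ^+ 2 =
   (complex.Re y ^+ 2 + complex.Im y ^+ 2) * (complex.Re y' ^+ 2 + complex.Im y' ^+ 2).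
  by rewrite !cE; ring.
have A (y y' : R[i]) : complex.Re (y + y') ^+ 2 + complex.Im (y + y') ^+ 2 <=
  2 * (complex.Re y ^+ 2 + complex.Im y ^+ 2) + 2 * (complex.Re y' ^+ 2 + complex.Im y' ^+ 2).
  rewrite !cE -subr_ge0.
  have := addr_ge0 (sqr_ge0 (complex.Re y - complex.Re y')) (sqr_ge0 (complex.Im y - complex.Im y')).
  by congr (_ <= _); ring.
have B (y y' : R[i]) : 2 * (complex.Re (y * y') ^+ 2 + complex.Im (y * y') ^+ 2) <=
    2 * n1 y ^+ 2 * (complex.Re y' ^+ 2 + complex.Im y' ^+ 2).
  rewrite M mulrA; apply: ler_wpM2r; first by rewrite addr_ge0// sqr_ge0.
  by apply: ler_wpM2l => //; exact: Csqn.
exact: le_trans (A _ _) (lerD (B _ _) (B _ _)).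
Qed.

Lemma sqn_ge0 (R : realType) (u : R -> R[i]) x : 0 <= sqn u x.
Proof. by rewrite addr_ge0// sqr_ge0. Qed.

Lemma sqnJ (R : realType) (u : R -> R[i]) : sqn (fun x => (u x)^*%C) = sqn u.
Proof. by apply/funext => x; rewrite /sqn !cE sqrrN. Qed.

(** The finite intersection property for a downward directed family: its members form a filter base,
    and a cluster point lies in each of them because they are closed. *)
Lemma compact_directed (T : topologicalType) (J : Type) (P : set J) (K : J -> set T) (S : set T) :
  compact S -> (exists j, P j) -> (forall j, P j -> K j `<=` S) ->
  (forall j, P j -> closed (K j)) -> (forall j, P j -> K j !=set0) ->
  (forall i j, P i -> P j -> exists2 k, P k & K k `<=` K i `&` K j) ->
  exists x, S x /\ forall j, P j -> K j x.
Proof.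
move=> cS [j0 Pj0] KS cK nK dir.
pose F := filter_from P K.
have FF : ProperFilter F.
  apply: filter_from_proper => //; apply: filter_from_filter; first by exists j0.
  exact: dir.
have FS : F S by exists j0 => //; exact: KS.
have [x [Sx clx]] := cS F FF FS.
exists x; split => // j Pj; apply: cK => // B nB.
by apply: clx => //; exists j.
Qed.

(** * Weyl theory *)

Section Weyl.
Variable R : realType.
Local Notation C := (R[i]).
Local Notation Msr := {measure set R -> \bar R}.
Variables (a b : \bar R) (K : finType) (m : K -> Msr) (k0 : K) (s q : K -> R).
Local Notation I := (Iab a b).
Hypotheses (aI : admissible m I) (nI : noatoms m k0 s q I).
Local Notation rho := (m k0).
Local Notation sol z u p := (qd m k0 s q I u p (fun x => z * u x)).
Implicit Types (u v p : R -> C) (z w : C).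
Let mI := @measurable_Ico R.

Definition Qi u (x y : R) := Rintegral rho (Ico x y) (sqn u).
(** Square integrability near [b], phrased as a bound uniform over compact pieces, on which
    solutions are bounded; [bdda] is the same near [a]. *)
Definition bddb u := forall c, I c -> exists M, forall y, I y -> c <= y -> Qi u c y <= M.
Definition bdda u := forall c, I c -> exists M, forall x, I x -> x <= c -> Qi u x c <= M.

Lemma Qi_ge0 u x y : 0 <= Qi u x y.
Proof. by apply: Rintegral_ge0 => t _; exact: sqn_ge0. Qed.

Lemma lbm_real_int k (h : R -> R) x y : I x -> I y ->
  measurable_fun (Icc x y) h -> (exists M, forall t, Icc x y t -> `|h t| <= M) ->
  (m k).-integrable (Ico x y) (EFin \o h).
Proof.
move=> Ix Iy mh [M hM]; apply: (integrable_bounded (M := M)) => //.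
- exact: (admissible_Ico k aI).
- apply: measurable_funS mh; [exact: measurable_Icc|exact: Ico_sub_Icc].
- by move=> t /Ico_sub_Icc; exact: hM.
Qed.

Lemma lbm_n1 u x y : lbm I u -> I x -> I y ->
  measurable_fun (Icc x y) (fun t => n1 (u t)) /\ exists M, forall t, Icc x y t -> `|n1 (u t)| <= M.
Proof.
move=> lu Ix Iy; have [mu [M uM]] := lu x y Ix Iy; split; first exact: cmeas_n1.
by exists M => t txy; rewrite ger0_norm ?n1_ge0// uM.
Qed.

Lemma sqn_int u x y : lbm I u -> I x -> I y -> rho.-integrable (Ico x y) (EFin \o sqn u).
Proof.
move=> lu Ix Iy; have [[m1 m2] [M uM]] := lu x y Ix Iy.
apply: lbm_real_int => //.
  by apply: measurable_funD; exact: measurable_funX.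
exists (M ^+ 2) => t txy; rewrite ger0_norm ?sqn_ge0// (le_trans (Csqn _))//.
have n0 := n1_ge0 (u t).
by rewrite ler_sqr ?nnegrE// ?uM// (le_trans n0)// uM.
Qed.

Lemma Qi_split u x y t : lbm I u -> I x -> I t -> x <= y -> y <= t ->
  Qi u x t = Qi u x y + Qi u y t.
Proof.
move=> lu Ix It xy yt; rewrite /Qi (Ico_setU xy yt) Rintegral_setU//.
- by rewrite -(Ico_setU xy yt); exact: sqn_int.
- exact: Ico_disj.
Qed.

Lemma bddb1 u c M : lbm I u -> I c -> (forall y, I y -> c <= y -> Qi u c y <= M) -> bddb u.
Proof.
move=> lu Ic H d Id; have M0 : 0 <= M by apply: le_trans (Qi_ge0 u c c) (H c Ic (lexx _)).
exists (Qi u d c + M) => y Iy dy; have [cd|/ltW dc] := leP c d.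
  have := H y Iy (le_trans cd dy); rewrite (Qi_split lu Ic Iy cd dy).
  have := Qi_ge0 u c d; have := Qi_ge0 u d c; lra.
have [cy|/ltW yc] := leP c y.
  by rewrite (Qi_split lu Id Iy dc cy) lerD2l H.
rewrite (Qi_split lu Id Ic dy yc); have := Qi_ge0 u y c; lra.
Qed.

Lemma bdda1 u c M : lbm I u -> I c -> (forall x, I x -> x <= c -> Qi u x c <= M) -> bdda u.
Proof.
move=> lu Ic H d Id; have M0 : 0 <= M by apply: le_trans (Qi_ge0 u c c) (H c Ic (lexx _)).
exists (M + Qi u c d) => x Ix xd; have [cd|/ltW dc] := leP c d; last first.
  have := H x Ix (le_trans xd dc); rewrite (Qi_split lu Ix Ic xd dc).
  have := Qi_ge0 u c d; have := Qi_ge0 u d c; lra.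
have [cx|/ltW xc] := leP c x.
  rewrite (Qi_split lu Ic Id cx xd); have := Qi_ge0 u c x; lra.
by rewrite (Qi_split lu Ix Id xc cd) lerD2r H.
Qed.

Lemma Qi_lin z w u v x y : lbm I u -> lbm I v -> I x -> I y ->
  Qi (fun t => z * u t + w * v t) x y <= 2 * n1 z ^+ 2 * Qi u x y + 2 * n1 w ^+ 2 * Qi v x y.
Proof.
move=> lu lv Ix Iy; have ui := sqn_int lu Ix Iy; have vi := sqn_int lv Ix Iy.
rewrite /Qi -!RintegralZl// -RintegralD//; [|exact: integrableZr'..].
apply: le_Rintegral => //.
- by apply: sqn_int => //; apply: lbmD; exact: lbmZ.
- by apply: integrableDr => //; exact: integrableZr'.
- by move=> t _; exact: sqn_lin.
Qed.

Lemma bddb_lin z w u v : lbm I u -> lbm I v -> bddb u -> bddb v ->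
  bddb (fun t => z * u t + w * v t).
Proof.
move=> lu lv bu bv c Ic; have [M HM] := bu c Ic; have [N HN] := bv c Ic.
exists (2 * n1 z ^+ 2 * M + 2 * n1 w ^+ 2 * N) => y Iy cy.
rewrite (le_trans (Qi_lin z w lu lv Ic Iy))// lerD// ler_wpM2l ?HM ?HN//;
  by rewrite mulr_ge0// sqr_ge0.
Qed.

Lemma bdda_lin z w u v : lbm I u -> lbm I v -> bdda u -> bdda v ->
  bdda (fun t => z * u t + w * v t).
Proof.
move=> lu lv bu bv c Ic; have [M HM] := bu c Ic; have [N HN] := bv c Ic.
exists (2 * n1 z ^+ 2 * M + 2 * n1 w ^+ 2 * N) => y Iy cy.
rewrite (le_trans (Qi_lin z w lu lv Iy Ic))// lerD// ler_wpM2l ?HM ?HN//;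
  by rewrite mulr_ge0// sqr_ge0.
Qed.

Lemma wr_diff z1 u p z v pv x y t t' : sol z1 u p -> sol z v pv -> I x -> I y ->
  Icc x y t -> Icc x y t' ->
  n1 (wr v pv u p t - wr v pv u p t') <=
  n1 (z - z1) * Rintegral rho (Ico x y) (fun r => n1 (v r) * n1 (u r)).
Proof.
move=> su sv Ix Iy; have [lu _] := qd_lbm aI su; have [lv _] := qd_lbm aI sv.
wlog tt' : t t' / t' <= t.
  move=> W tx t'x; have [h|/ltW h] := leP t' t; first exact: W.
  by rewrite -n1N opprB; exact: W.
move=> /andP[xt ty] /andP[xt' t'y].
have It : I t by exact: (Iab_conv Ix Iy).
have It' : I t' by exact: (Iab_conv Ix Iy).
rewrite (lagrange_int aI nI sv su It' It tt') addrAC subrr add0r.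
have vu k : Cintegrable (m k) (Ico t' t) (fun r => v r * u r).
  by apply: (lbm_int _ aI) => //; exact: lbmM.
have -> : Cint rho (Ico t' t) (fun r => z * v r * u r - v r * (z1 * u r)) =
    (z - z1) * Cint rho (Ico t' t) (fun r => v r * u r).
  by rewrite -CintZl//; apply: eq_Cint => r _; ring.
rewrite (le_trans (n1M _ _))// ler_wpM2l ?n1_ge0// (le_trans (n1_Cint _ (vu k0)))//.
have [m1 [M1 b1]] := lbm_n1 lv Ix Iy; have [m2 [M2 b2]] := lbm_n1 lu Ix Iy.
have ni : rho.-integrable (Ico x y) (EFin \o (fun r => n1 (v r) * n1 (u r))).
  apply: lbm_real_int => //; first exact: measurable_funM.
  by exists (M1 * M2) => r rxy; rewrite normrM ler_pM ?b1 ?b2.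
have sub := IcoS xt' ty.
apply: (@le_trans _ _ (Rintegral rho (Ico t' t) (fun r => n1 (v r) * n1 (u r)))).
  apply: le_Rintegral => //; first exact: Cintegrable_n1.
    exact: (integrableS (mI x y) (mI t' t) sub ni).
  by move=> r _; exact: n1M.
by apply: le_Rintegral_set => // r _; rewrite mulr_ge0// n1_ge0.
Qed.

(* Variation of constants with a different spectral parameter in u1, u2: v is expressed by u1, u2 and
   the Wronskians (v, u_i), whose variation is controlled by the integral of |v| |u_i|. *)
Lemma weyl_core z1 u1 p1 z2 u2 p2 z v pv x y d (kap eta : R) :
  sol z1 u1 p1 -> sol z2 u2 p2 -> sol z v pv -> I x -> I y -> Icc x y d ->
  0 <= kap -> 0 <= eta ->
  (forall t, Icc x y t -> wr u1 p1 u2 p2 t != 0 /\ n1 (wr u1 p1 u2 p2 t)^-1 <= kap) ->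
  4 * (kap * (n1 (z - z1) + n1 (z - z2))) ^+ 2 * eta ^+ 2 <= 1 ->
  Rintegral rho (Ico x y) (fun t => (n1 (u1 t) + n1 (u2 t)) ^+ 2) <= eta ->
  Qi v x y <= 4 * eta * (kap * (n1 (wr v pv u1 p1 d) + n1 (wr v pv u2 p2 d))) ^+ 2.
Proof.
move=> s1 s2 sv Ix Iy dxy kap0 eta0 wk small Ueta.
have [l1 _] := qd_lbm aI s1; have [l2 _] := qd_lbm aI s2; have [lv _] := qd_lbm aI sv.
have [mv [Mv bv]] := lbm_n1 lv Ix Iy.
have [m1 [M1 b1]] := lbm_n1 l1 Ix Iy; have [m2 [M2 b2]] := lbm_n1 l2 Ix Iy.
have mU : measurable_fun (Icc x y) (fun t => n1 (u1 t) + n1 (u2 t)) by exact: measurable_funD.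
have bU t : Icc x y t -> `|n1 (u1 t) + n1 (u2 t)| <= M1 + M2.
  by move=> txy; rewrite (le_trans (ler_normD _ _))// lerD ?b1 ?b2.
have vUi : rho.-integrable (Ico x y) (EFin \o (fun t => n1 (v t) * (n1 (u1 t) + n1 (u2 t)))).
  apply: lbm_real_int => //; first exact: measurable_funM.
  by exists (Mv * (M1 + M2)) => t txy; rewrite normrM ler_pM ?bv ?bU.
have v2i : rho.-integrable (Ico x y) (EFin \o (fun t => n1 (v t) ^+ 2)).
  apply: lbm_real_int => //; first exact: measurable_funX.
  exists (Mv * Mv) => t txy; rewrite expr2 normrM ler_pM ?bv//.
have U2i : rho.-integrable (Ico x y) (EFin \o (fun t => (n1 (u1 t) + n1 (u2 t)) ^+ 2)).
  apply: lbm_real_int => //; first exact: measurable_funX.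
  by exists ((M1 + M2) * (M1 + M2)) => t txy; rewrite expr2 normrM ler_pM ?bU.
have C0 : 0 <= kap * (n1 (z - z1) + n1 (z - z2)) by rewrite mulr_ge0// addr_ge0// n1_ge0.
have U0 t : 0 <= n1 (u1 t) + n1 (u2 t) by rewrite addr_ge0// n1_ge0.
apply: (@le_trans _ _ (Rintegral rho (Ico x y) (fun t => n1 (v t) ^+ 2))).
  apply: le_Rintegral => //; first exact: sqn_int.
  by move=> t _; exact: Csqn.
apply: (l2_bootstrap (U := fun t => n1 (u1 t) + n1 (u2 t)) _ _ _ _ _ _ _ C0 eta0 small Ueta) => //.
- by move=> t _; exact: n1_ge0.
- by rewrite mulr_ge0// addr_ge0// n1_ge0.
move=> t /Ico_sub_Icc txy; set B := Rintegral _ _ _.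
have [wn0 wle] := wk t txy.
have Bu u : (forall r, 0 <= n1 (u r) <= n1 (u1 r) + n1 (u2 r)) -> lbm I u ->
    Rintegral rho (Ico x y) (fun r => n1 (v r) * n1 (u r)) <= B.
  move=> h lu; have [mu' [Mu bu]] := lbm_n1 lu Ix Iy.
  apply: le_Rintegral => //.
    apply: lbm_real_int => //; first exact: measurable_funM.
    by exists (Mv * Mu) => r rxy; rewrite normrM ler_pM ?bv ?bu.
  by move=> r _; rewrite ler_wpM2l ?n1_ge0//; have /andP[] := h r.
have B1 : Rintegral rho (Ico x y) (fun r => n1 (v r) * n1 (u1 r)) <= B.
  by apply: Bu => // r; rewrite n1_ge0 lerDl n1_ge0.
have B2 : Rintegral rho (Ico x y) (fun r => n1 (v r) * n1 (u2 r)) <= B.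
  by apply: Bu => // r; rewrite n1_ge0 lerDr n1_ge0.
have w1 : n1 (wr v pv u1 p1 t) <= n1 (wr v pv u1 p1 d) + n1 (z - z1) * B.
  rewrite -[wr v pv u1 p1 t](subrK (wr v pv u1 p1 d)) (le_trans (n1D _ _))// addrC lerD2l.
  by rewrite (le_trans (wr_diff s1 sv Ix Iy txy dxy))// ler_wpM2l ?n1_ge0.
have w2 : n1 (wr v pv u2 p2 t) <= n1 (wr v pv u2 p2 d) + n1 (z - z2) * B.
  rewrite -[wr v pv u2 p2 t](subrK (wr v pv u2 p2 d)) (le_trans (n1D _ _))// addrC lerD2l.
  by rewrite (le_trans (wr_diff s2 sv Ix Iy txy dxy))// ler_wpM2l ?n1_ge0.
(* The Plücker relation: three vectors in the plane are dependent, with their Wronskians as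
   coefficients. *)
have plucker : v t = (wr u1 p1 u2 p2 t)^-1 * (wr v pv u2 p2 t * u1 t - wr v pv u1 p1 t * u2 t).
  apply: (mulfI wn0); rewrite mulrA divff// mul1r /wr; ring.
rewrite {1}plucker (le_trans (n1M _ _))//.
apply: (@le_trans _ _ (kap * ((n1 (wr v pv u2 p2 d) + n1 (z - z2) * B) * n1 (u1 t) +
   (n1 (wr v pv u1 p1 d) + n1 (z - z1) * B) * n1 (u2 t)))).
  apply: ler_pM; rewrite ?n1_ge0//.
  rewrite (le_trans (n1B _ _))// lerD// (le_trans (n1M _ _))// ler_wpM2r ?n1_ge0//.
have B0 : 0 <= B by apply: Rintegral_ge0 => r _; rewrite mulr_ge0 ?n1_ge0.
have := n1_ge0 (wr v pv u1 p1 d); have := n1_ge0 (wr v pv u2 p2 d).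
have := n1_ge0 (z - z1); have := n1_ge0 (z - z2); have := n1_ge0 (u1 t); have := n1_ge0 (u2 t).
move: (n1 (wr v pv u1 p1 d)) (n1 (wr v pv u2 p2 d)) (n1 (z - z1)) (n1 (z - z2)) (n1 (u1 t)) (n1 (u2 t)).
move=> W1 W2 Z1 Z2 N1 N2 h1 h2 h3 h4 h5 h6.
rewrite -subr_ge0.
rewrite (_ : _ - _ = kap * (N1 * W1 + N2 * W2 + N1 * (Z1 * B) + N2 * (Z2 * B))); last by ring.
by rewrite mulr_ge0// !addr_ge0// !mulr_ge0.
Qed.

(** The integrals from [c] increase and are bounded. Beyond a point where they come within [eta] of
    their supremum, at most [eta] is left. *)
Lemma tail_b (h : R -> R) c M eta : I c ->
  (forall x y, I x -> I y -> rho.-integrable (Ico x y) (EFin \o h)) -> (forall t, 0 <= h t) ->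
  (forall y, I y -> c <= y -> Rintegral rho (Ico c y) h <= M) -> 0 < eta ->
  exists d, [/\ I d, c <= d & forall y, I y -> d <= y -> Rintegral rho (Ico d y) h <= eta].
Proof.
move=> Ic hi h0 HM eta0.
pose S := [set r | exists y, [/\ I y, c <= y & r = Rintegral rho (Ico c y) h]].
have hS : has_sup S.
  split; first by exists (Rintegral rho (Ico c c) h), c.
  by exists M => r [y [Iy cy ->]]; exact: HM.
have [r [d [Id cd ->]] lt1] := sup_adherent eta0 hS.
exists d; split => // y Iy dy.
have : Rintegral rho (Ico c y) h <= sup S.
  by apply: (ub_le_sup hS.2); exists y; split => //; exact: le_trans dy.
rewrite (Ico_setU cd dy) Rintegral_setU//.
- by move=> h1; rewrite -(lerD2l (Rintegral rho (Ico c d) h)); apply: le_trans h1 _; lra.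
- by rewrite -(Ico_setU cd dy); exact: hi.
- exact: Ico_disj.
Qed.

Lemma tail_a (h : R -> R) c M eta : I c ->
  (forall x y, I x -> I y -> rho.-integrable (Ico x y) (EFin \o h)) -> (forall t, 0 <= h t) ->
  (forall x, I x -> x <= c -> Rintegral rho (Ico x c) h <= M) -> 0 < eta ->
  exists d, [/\ I d, d <= c & forall x, I x -> x <= d -> Rintegral rho (Ico x d) h <= eta].
Proof.
move=> Ic hi h0 HM eta0.
pose S := [set r | exists x, [/\ I x, x <= c & r = Rintegral rho (Ico x c) h]].
have hS : has_sup S.
  split; first by exists (Rintegral rho (Ico c c) h), c.
  by exists M => r [y [Iy cy ->]]; exact: HM.
have [r [d [Id dc ->]] lt1] := sup_adherent eta0 hS.
exists d; split => // x Ix xd.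
have : Rintegral rho (Ico x c) h <= sup S.
  by apply: (ub_le_sup hS.2); exists x; split => //; exact: le_trans dc.
rewrite (Ico_setU xd dc) Rintegral_setU//.
- by move=> h1; rewrite -(lerD2r (Rintegral rho (Ico d c) h)); apply: le_trans h1 _; lra.
- by rewrite -(Ico_setU xd dc); exact: hi.
- exact: Ico_disj.
Qed.

Lemma sumsq_int u1 u2 x y : lbm I u1 -> lbm I u2 -> I x -> I y ->
  rho.-integrable (Ico x y) (EFin \o (fun t => (n1 (u1 t) + n1 (u2 t)) ^+ 2)) /\
  Rintegral rho (Ico x y) (fun t => (n1 (u1 t) + n1 (u2 t)) ^+ 2) <= 4 * (Qi u1 x y + Qi u2 x y).
Proof.
move=> l1 l2 Ix Iy.
have [m1 [M1 b1]] := lbm_n1 l1 Ix Iy; have [m2 [M2 b2]] := lbm_n1 l2 Ix Iy.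
have i12 : rho.-integrable (Ico x y) (EFin \o (fun t => (n1 (u1 t) + n1 (u2 t)) ^+ 2)).
  apply: lbm_real_int => //; first by apply: measurable_funX; exact: measurable_funD.
  exists ((M1 + M2) * (M1 + M2)) => t txy; rewrite expr2 normrM.
  by apply: ler_pM => //; rewrite (le_trans (ler_normD _ _))// lerD ?b1 ?b2.
split => //; rewrite /Qi -RintegralD//; [|exact: sqn_int..].
rewrite -RintegralZl//; last by apply: integrableDr => //; exact: sqn_int.
apply: le_Rintegral => //.
  by apply: integrableZr' => //; apply: integrableDr => //; exact: sqn_int.
move=> t _; have := n1_sq_le (u1 t); have := n1_sq_le (u2 t).
rewrite -/(sqn u1 t) -/(sqn u2 t).
move: (n1 (u1 t)) (n1 (u2 t)) => A B.
rewrite (_ : (A + B) ^+ 2 = 2 * A ^+ 2 + 2 * B ^+ 2 - (A - B) ^+ 2); last by ring.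
by have := sqr_ge0 (A - B); lra.
Qed.

Let eta_ok (C : R) : 0 <= C -> exists2 eta, 0 < eta & 4 * C ^+ 2 * eta ^+ 2 <= 1.
Proof.
move=> C0; exists (2 * C + 1)^-1; first by rewrite invr_gt0 ltr_wpDl// mulr_ge0.
have p : 0 < 2 * C + 1 by rewrite ltr_wpDl// mulr_ge0.
rewrite (_ : _ * _ = (2 * C / (2 * C + 1)) ^+ 2); last by field; rewrite gt_eqF.
rewrite expr_le1// ?divr_ge0 ?mulr_ge0 ?(ltW p)// ler_pdivrMr// mul1r; lra.
Qed.

(** Two different parameters are allowed so that the pair may be a solution and its conjugate. Their
    Wronskian is then not constant, which is why a bound [kap] on its inverse is assumed. The tail
    size [eta] depends only on [kap] and the parameters, so the point [d] and the final bound do not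
    depend on [y]. *)
Lemma weyl_b z1 u1 p1 z2 u2 p2 z v pv d0 (kap : R) :
  sol z1 u1 p1 -> sol z2 u2 p2 -> sol z v pv -> I d0 -> bddb u1 -> bddb u2 -> 0 <= kap ->
  (forall t, I t -> d0 <= t -> wr u1 p1 u2 p2 t != 0 /\ n1 (wr u1 p1 u2 p2 t)^-1 <= kap) ->
  bddb v.
Proof.
move=> s1 s2 sv Id0 b1 b2 kap0 wk.
have [l1 _] := qd_lbm aI s1; have [l2 _] := qd_lbm aI s2; have [lv _] := qd_lbm aI sv.
have [eta eta0 small] : exists2 eta, 0 < eta &
    4 * (kap * (n1 (z - z1) + n1 (z - z2))) ^+ 2 * eta ^+ 2 <= 1.
  by apply: eta_ok; rewrite mulr_ge0// addr_ge0// n1_ge0.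
have [M1 H1] := b1 d0 Id0; have [M2 H2] := b2 d0 Id0.
have [||y Iy dy|d [Id d0d tl]] := @tail_b (fun t => (n1 (u1 t) + n1 (u2 t)) ^+ 2) d0 (4 * (M1 + M2)) eta Id0 _ _ _ eta0.
- by move=> x y Ix Iy; have [] := sumsq_int l1 l2 Ix Iy.
- by move=> t; exact: sqr_ge0.
- have [_] := sumsq_int l1 l2 Id0 Iy; move/le_trans; apply.
  by rewrite ler_pM2l// lerD ?H1 ?H2.
apply: (bddb1 lv Id (M := 4 * eta * (kap * (n1 (wr v pv u1 p1 d) + n1 (wr v pv u2 p2 d))) ^+ 2)).
move=> y Iy dy; apply: (weyl_core s1 s2 sv Id Iy _ kap0 (ltW eta0) _ small (tl y Iy dy)).
  by rewrite /Icc/= lexx.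
by move=> t /andP[dt ty]; apply: wk; [exact: (Iab_conv Id Iy)|exact: le_trans dt].
Qed.

Lemma weyl_a z1 u1 p1 z2 u2 p2 z v pv d0 (kap : R) :
  sol z1 u1 p1 -> sol z2 u2 p2 -> sol z v pv -> I d0 -> bdda u1 -> bdda u2 -> 0 <= kap ->
  (forall t, I t -> t <= d0 -> wr u1 p1 u2 p2 t != 0 /\ n1 (wr u1 p1 u2 p2 t)^-1 <= kap) ->
  bdda v.
Proof.
move=> s1 s2 sv Id0 b1 b2 kap0 wk.
have [l1 _] := qd_lbm aI s1; have [l2 _] := qd_lbm aI s2; have [lv _] := qd_lbm aI sv.
have [eta eta0 small] : exists2 eta, 0 < eta &
    4 * (kap * (n1 (z - z1) + n1 (z - z2))) ^+ 2 * eta ^+ 2 <= 1.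
  by apply: eta_ok; rewrite mulr_ge0// addr_ge0// n1_ge0.
have [M1 H1] := b1 d0 Id0; have [M2 H2] := b2 d0 Id0.
have [||x Ix xd|d [Id dd0 tl]] := @tail_a (fun t => (n1 (u1 t) + n1 (u2 t)) ^+ 2) d0 (4 * (M1 + M2)) eta Id0 _ _ _ eta0.
- by move=> x y Ix Iy; have [] := sumsq_int l1 l2 Ix Iy.
- by move=> t; exact: sqr_ge0.
- have [_] := sumsq_int l1 l2 Ix Id0; move/le_trans; apply.
  by rewrite ler_pM2l// lerD ?H1 ?H2.
apply: (bdda1 lv Id (M := 4 * eta * (kap * (n1 (wr v pv u1 p1 d) + n1 (wr v pv u2 p2 d))) ^+ 2)).
move=> x Ix xd; apply: (weyl_core s1 s2 sv Ix Id _ kap0 (ltW eta0) _ small (tl x Ix xd)).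
  by rewrite /Icc/= lexx xd.
by move=> t /andP[xt td]; apply: wk; [exact: (Iab_conv Ix Id)|exact: le_trans dd0].
Qed.

End Weyl.

(** * Solutions with J of one sign, and independence of the spectral parameter *)

Section WeylSolutions.
Variable R : realType.
Local Notation C := (R[i]).
Local Notation Msr := {measure set R -> \bar R}.
Variables (a b : \bar R) (K : finType) (m : K -> Msr) (k0 : K) (s q : K -> R).
Local Notation I := (Iab a b).
Hypotheses (aI : admissible m I) (nI : noatoms m k0 s q I).
Local Notation rho := (m k0).
Local Notation sol z u p := (qd m k0 s q I u p (fun x => z * u x)).
Local Notation Qi := (Qi m k0).
Local Notation bddb := (bddb a b m k0).
Local Notation bdda := (bdda a b m k0).
Implicit Types (u p : R -> C) (z w : C).
Let mI := @measurable_Ico R.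

Definition Jf u p (x : R) : R := complex.Im (u x * (p x)^*%C).

(** Identifies [Jf] as a Wronskian. Hence the Lagrange identity governs its change, and a nonzero
    value means that the solution and its conjugate are independent. *)
Lemma wr_conj u p x :
  wr u p (fun x => (u x)^*%C) (fun x => (p x)^*%C) x = (0 +i* (2 * Jf u p x))%C.
Proof. by apply: Cext; rewrite /wr /Jf !cE /=; ring. Qed.

Lemma sol_conj z u p : sol z u p -> sol (z^*%C) (fun x => (u x)^*%C) (fun x => (p x)^*%C).
Proof.
move=> su; apply: (qd_ext aI (qd_conj aI su)) => // x _; exact: rmorphM.
Qed.

Lemma sol_lin z al be u p v pv : sol z u p -> sol z v pv ->
  sol z (fun x => al * u x + be * v x) (fun x => al * p x + be * pv x).
Proof.
by move=> su sv; apply: (qd_ext aI (qd_lin al be aI su sv)) => // x _; ring.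
Qed.

Lemma Jf_eq u p x y : sol (- 'i%C) u p -> I x -> I y -> x <= y ->
  Jf u p y = Jf u p x - Qi u x y.
Proof.
move=> su Ix Iy xy; have := lagrange_int aI nI su (sol_conj su) Ix Iy xy.
rewrite !wr_conj => /(congr1 (@complex.Im R)); rewrite cImD /=.
have -> : Rintegral rho (Ico x y) (fun t => complex.Im
    (- 'i%C * u t * (u t)^*%C - u t * (((- 'i)^*)%C * (u t)^*%C))) = - 2 * Qi u x y.
  rewrite /Qi -RintegralZl//; last exact: (sqn_int k0 aI (qd_lbm aI su).1 Ix Iy).
  by apply: eq_Rintegral => t _; rewrite /sqn !cE /=; ring.
by move=> e; apply: (mulfI (_ : 2 != 0 :> R)) => //; rewrite e; ring.
Qed.

Lemma sol_repr z c u p B1 P1 B2 P2 : I c -> sol z u p -> sol z B1 P1 -> sol z B2 P2 ->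
  B1 c = 1 -> P1 c = 0 -> B2 c = 0 -> P2 c = 1 ->
  forall x, I x -> u x = u c * B1 x + p c * B2 x /\ p x = u c * P1 x + p c * P2 x.
Proof.
move=> Ic su s1 s2 e1 e2 e3 e4.
apply: (qd_unique_eq aI nI Ic su (sol_lin (u c) (p c) s1 s2)).
  by rewrite e1 e3; ring.
by rewrite e2 e4; ring.
Qed.

Let o0 := @Ordinal 4 0 isT.
Let o1 := @Ordinal 4 1 isT.
Let o2 := @Ordinal 4 2 isT.
Let o3 := @Ordinal 4 3 isT.

Lemma real_continuousM (T : topologicalType) (f g : T -> R) :
  continuous f -> continuous g -> continuous (fun v => f v * g v : R).
Proof. by move=> cf cg v; apply: (@continuousM R T f g v); [exact: cf|exact: cg]. Qed.

Lemma real_continuousD (T : topologicalType) (f g : T -> R) :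
  continuous f -> continuous g -> continuous (fun v => f v + g v : R).
Proof. by move=> cf cg v; apply: (@continuousD R R^o T f g v); [exact: cf|exact: cg]. Qed.

Lemma real_continuousB (T : topologicalType) (f g : T -> R) :
  continuous f -> continuous g -> continuous (fun v => f v - g v : R).
Proof. by move=> cf cg v; apply: (@continuousB R R^o T f g v); [exact: cf|exact: cg]. Qed.

Lemma row_coord_continuous i : continuous (fun v : 'rV[R]_4 => v ord0 i : R).
Proof. exact: coord_continuous. Qed.

Lemma row_lin_continuous (r0 r1 r2 r3 : R) :
  continuous (fun v : 'rV[R]_4 => v ord0 o0 * r0 + v ord0 o1 * r1 + v ord0 o2 * r2 + v ord0 o3 * r3 : R).
Proof.
have cM i r : continuous (fun v : 'rV[R]_4 => v ord0 i * r : R).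
  by refine (real_continuousM (@row_coord_continuous i) _) => v; exact: cst_continuous.
by apply: real_continuousD (cM _ _); apply: real_continuousD (cM _ _); apply: real_continuousD (cM _ _).
Qed.

Lemma row_sphere_compact : compact [set v : 'rV[R]_4 |
  v ord0 o0 ^+ 2 + v ord0 o1 ^+ 2 + v ord0 o2 ^+ 2 + v ord0 o3 ^+ 2 = 1].
Proof.
have cB := @rV_compact R 4 (fun=> `[(-1 : R), 1]%classic) (fun=> @segment_compact R (-1) 1).
apply: (subclosed_compact _ cB).
- apply: (@closed_comp _ _ (fun v : 'rV[R]_4 =>
    v ord0 o0 ^+ 2 + v ord0 o1 ^+ 2 + v ord0 o2 ^+ 2 + v ord0 o3 ^+ 2 : R) [set x | x = 1]).
    have cM i : continuous (fun v : 'rV[R]_4 => v ord0 i ^+ 2 : R).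
      by move=> v; apply: (@real_continuousM _ _ _ (@row_coord_continuous i) (@row_coord_continuous i) v).
    move=> v _; move: v.
    by apply: real_continuousD (cM _); apply: real_continuousD (cM _); apply: real_continuousD (cM _).
  exact: closed_eq.
- move=> v /= e i; rewrite in_itv/= -ler_norml -(@ler_pXn2r _ 2)// ?nnegrE// expr1n.
  rewrite real_normK ?num_real// -e.
  have := (sqr_ge0 (v ord0 o0), sqr_ge0 (v ord0 o1), sqr_ge0 (v ord0 o2), sqr_ge0 (v ord0 o3)).
  move=> [[[h0 h1] h2] h3].
  case: i => [[|[|[|[|i]]]] hi] //.
  + by rewrite (_ : Ordinal hi = o0); [lra|exact: val_inj].
  + by rewrite (_ : Ordinal hi = o1); [lra|exact: val_inj].
  + by rewrite (_ : Ordinal hi = o2); [lra|exact: val_inj].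
  + by rewrite (_ : Ordinal hi = o3); [lra|exact: val_inj].
Qed.

(* The unit vectors of initial data with sg * J >= 0 at x form a nested family of nonempty compact
   sets, as J is monotone. *)
Lemma exists_sign c (sg : R) : I c -> sg = 1 \/ sg = -1 ->
  exists u p, [/\ sol (- 'i%C) u p, ~ (u c = 0 /\ p c = 0) &
    forall x, I x -> 0 <= sg * Jf u p x].
Proof.
move=> Ic hsg.
have [B1 [P1 [b1 p1 s1]]] := sol_exists (- 'i%C) 1 0 aI nI Ic.
have [B2 [P2 [b2 p2 s2]]] := sol_exists (- 'i%C) 0 1 aI nI Ic.
pose al (v : 'rV[R]_4) : C := (v ord0 o0 +i* v ord0 o1)%C.
pose be (v : 'rV[R]_4) : C := (v ord0 o2 +i* v ord0 o3)%C.
pose U (v : 'rV[R]_4) x := al v * B1 x + be v * B2 x.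
pose P (v : 'rV[R]_4) x := al v * P1 x + be v * P2 x.
have sUP (v : 'rV[R]_4) : sol (- 'i%C) (U v) (P v) by exact: sol_lin.
have Jc x : continuous (fun v : 'rV[R]_4 => sg * Jf (U v) (P v) x).
  (* [Jf] is a quadratic polynomial in the four real coordinates of the data, a difference of
     products of linear forms. *)
  have -> : (fun v : 'rV[R]_4 => sg * Jf (U v) (P v) x) = (fun v : 'rV[R]_4 => sg * (
      (v ord0 o0 * complex.Im (B1 x) + v ord0 o1 * complex.Re (B1 x)
        + v ord0 o2 * complex.Im (B2 x) + v ord0 o3 * complex.Re (B2 x)) *
      (v ord0 o0 * complex.Re (P1 x) + v ord0 o1 * - complex.Im (P1 x)
        + v ord0 o2 * complex.Re (P2 x) + v ord0 o3 * - complex.Im (P2 x)) -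
      (v ord0 o0 * complex.Re (B1 x) + v ord0 o1 * - complex.Im (B1 x)
        + v ord0 o2 * complex.Re (B2 x) + v ord0 o3 * - complex.Im (B2 x)) *
      (v ord0 o0 * complex.Im (P1 x) + v ord0 o1 * complex.Re (P1 x)
        + v ord0 o2 * complex.Im (P2 x) + v ord0 o3 * complex.Re (P2 x)))).
    by apply/funext => v; congr (_ * _); rewrite /Jf /U /P !cE /=; ring.
  refine (real_continuousM (f := fun=> sg) _ _); first by move=> v; exact: cst_continuous.
  by apply: real_continuousB; apply: real_continuousM; exact: row_lin_continuous.
pose S := [set v : 'rV[R]_4 |
  v ord0 o0 ^+ 2 + v ord0 o1 ^+ 2 + v ord0 o2 ^+ 2 + v ord0 o3 ^+ 2 = 1].
pose Kx (x : R) := S `&` [set v : 'rV[R]_4 | 0 <= sg * Jf (U v) (P v) x].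
have cS := row_sphere_compact.
have closedS : closed S by apply: compact_closed => //; exact: norm_hausdorff.
have mono x y (v : 'rV[R]_4) : I x -> I y -> x <= y -> Jf (U v) (P v) y <= Jf (U v) (P v) x.
  move=> Ix Iy xy; rewrite (Jf_eq (sUP v) Ix Iy xy).
  by have := Qi_ge0 m k0 (U v) x y; lra.
have dir1 x y : I x -> I y -> x <= y -> exists2 k, I k & Kx k `<=` Kx x `&` Kx y.
  (* [Jf] is nonincreasing, so the condition [Jf >= 0] is stronger at the right point and [Jf <= 0]
     at the left one. *)
  move=> Ix Iy xy; case: hsg => e.
    exists y => // v [Sv]; rewrite /= e mul1r => h.
    split; split => //=; rewrite e mul1r// (le_trans h)//; exact: mono.
  exists x => // v [Sv]; rewrite /= e mulN1r => h.
  split; split => //=; rewrite e mulN1r// (le_trans h)// lerN2; exact: mono.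
have [x Ix v []//|x Ix|x Ix|x y Ix Iy|v [Sv Kv]] :=
    @compact_directed _ R I Kx S cS (ex_intro _ c Ic).
- apply: closedI => //.
  apply: (@closed_comp _ _ (fun v : 'rV[R]_4 => sg * Jf (U v) (P v) x) [set y | 0 <= y]).
    by move=> v _; exact: Jc.
  exact: closed_ge.
(* A solution vanishing at [x] has [Jf = 0] there, which satisfies either sign condition. Its data
   at [c] are nonzero by uniqueness and are scaled to the unit sphere. *)
- have [u [p [ux px su]]] := sol_exists (- 'i%C) 0 1 aI nI Ix.
  pose N := complex.Re (u c) ^+ 2 + complex.Im (u c) ^+ 2 + complex.Re (p c) ^+ 2 + complex.Im (p c) ^+ 2.
  have N0 : 0 <= N by rewrite !addr_ge0// sqr_ge0.
  have Nn0 : N != 0.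
    apply/eqP => /eqP; rewrite !paddr_eq0 ?addr_ge0 ?sqr_ge0// !sqrf_eq0.
    move=> /andP[/andP[/andP[/eqP h1 /eqP h2] /eqP h3] /eqP h4].
    have uc : u c = 0 by apply: Cext.
    have pc : p c = 0 by apply: Cext.
    have [_] := sol_unique aI nI Ic su uc pc Ix.
    by rewrite px => /eqP; rewrite oner_eq0.
  pose r := (Num.sqrt N)^-1.
  have rN : r ^+ 2 * N = 1.
    by rewrite /r exprVn sqr_sqrtr// mulVf.
  pose v : 'rV[R]_4 := \row_(i < 4) (r * match val i with
    | 0 => complex.Re (u c) | 1 => complex.Im (u c)
    | 2 => complex.Re (p c) | _ => complex.Im (p c) end).
  have alv : al v = r%:C%C * u c.
    by rewrite /al !mxE /=; apply: Cext; rewrite cE /=; ring.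
  have bev : be v = r%:C%C * p c.
    by rewrite /be !mxE /=; apply: Cext; rewrite cE /=; ring.
  exists v; split.
    by rewrite /S/= !mxE /= -rN /N; ring.
  have [eu _] := sol_repr Ic su s1 s2 b1 p1 b2 p2 Ix.
  have -> : [set v : 'rV[R]_4 | 0 <= sg * Jf (U v) (P v) x] v = (0 <= sg * Jf (U v) (P v) x) by [].
  have U0 : U v x = 0 by rewrite /U alv bev -!mulrA -mulrDr -eu ux mulr0.
  by rewrite /Jf U0 mul0r /= mulr0.
- have [xy|/ltW yx] := leP x y; first exact: dir1.
  by rewrite setIC; exact: dir1.
exists (U v), (P v); split => //; last by move=> x Ix; have [] := Kv x Ix.
rewrite /U /P b1 b2 p1 p2 !mulr1 !mulr0 addr0 add0r => -[[e0 e1] [e2 e3]].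
by move: Sv; rewrite /S/= e0 e1 e2 e3 !expr0n/= !addr0 => /eqP; rewrite eq_sym oner_eq0.
Qed.

Lemma exists_bddb c : I c ->
  exists u p, [/\ sol (- 'i%C) u p, ~ (u c = 0 /\ p c = 0) & bddb u].
Proof.
move=> Ic; have [u [p [su nz J0]]] := exists_sign Ic (or_introl erefl).
exists u, p; split => //; apply: (bddb1 aI (qd_lbm aI su).1 Ic (M := Jf u p c)) => y Iy cy.
by have := Jf_eq su Ic Iy cy; have := J0 y Iy; rewrite mul1r; lra.
Qed.

Lemma exists_bdda c : I c ->
  exists u p, [/\ sol (- 'i%C) u p, ~ (u c = 0 /\ p c = 0) & bdda u].
Proof.
move=> Ic; have [u [p [su nz J0]]] := exists_sign Ic (or_intror erefl).
exists u, p; split => //; apply: (bdda1 aI (qd_lbm aI su).1 Ic (M := - Jf u p c)) => y Iy cy.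
by have := Jf_eq su Iy Ic cy; have := J0 y Iy; rewrite mulN1r; lra.
Qed.

Lemma bddbJ u : bddb u -> bddb (fun x => (u x)^*%C).
Proof.
by move=> bu c Ic; have [M H] := bu c Ic; exists M => y Iy cy; rewrite /Qi sqnJ; exact: H.
Qed.

Lemma bddaJ u : bdda u -> bdda (fun x => (u x)^*%C).
Proof.
by move=> bu c Ic; have [M H] := bu c Ic; exists M => y Iy cy; rewrite /Qi sqnJ; exact: H.
Qed.

Lemma wr_conj_inv u p x (e : R) : 0 < e -> e <= `|Jf u p x| ->
  wr u p (fun x => (u x)^*%C) (fun x => (p x)^*%C) x != 0 /\
  n1 (wr u p (fun x => (u x)^*%C) (fun x => (p x)^*%C) x)^-1 <= (2 * e)^-1.
Proof.
move=> e0 eJ; rewrite wr_conj.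
have Jn0 : Jf u p x != 0 by rewrite -normr_gt0 (lt_le_trans e0).
split; first by rewrite eq_complex /= eqxx/= mulf_eq0 (negbTE Jn0) orbF pnatr_eq0.
have -> : (0 +i* (2 * Jf u p x))%C^-1 = (0 +i* (- (2 * Jf u p x)^-1))%C :> C.
  apply: (mulIf (_ : (0 +i* (2 * Jf u p x))%C != 0 :> C)).
    by rewrite eq_complex /= eqxx/= mulf_eq0 (negbTE Jn0) orbF pnatr_eq0.
  rewrite mulVf; last by rewrite eq_complex /= eqxx/= mulf_eq0 (negbTE Jn0) orbF pnatr_eq0.
  by apply: Cext; rewrite cE /=; [field|ring].
rewrite /n1 /= normr0 add0r normrN normfV normrM (ger0_norm (ler0n _ 2)).
by rewrite lef_pV2 ?posrE ?mulr_gt0// ?normr_gt0// ler_pM2l.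
Qed.

Lemma Jf_neg_bddb u p x0 v pv : sol (- 'i%C) u p -> bddb u -> I x0 -> Jf u p x0 < 0 ->
  sol (- 'i%C) v pv -> bddb v.
Proof.
move=> su bu Ix0 Jn sv.
have e0 : 0 < - Jf u p x0 by rewrite oppr_gt0.
apply: (weyl_b aI nI su (sol_conj su) sv Ix0 bu (bddbJ bu) (kap := (2 * - Jf u p x0)^-1)).
  by rewrite invr_ge0 mulr_ge0// ltW.
move=> t It x0t; apply: wr_conj_inv => //.
have := Jf_eq su Ix0 It x0t; have := Qi_ge0 m k0 u x0 t => h1 h2.
by rewrite ltr0_norm; lra.
Qed.

Lemma Jf_pos_bdda u p x0 v pv : sol (- 'i%C) u p -> bdda u -> I x0 -> 0 < Jf u p x0 ->
  sol (- 'i%C) v pv -> bdda v.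
Proof.
move=> su bu Ix0 Jp sv.
apply: (weyl_a aI nI su (sol_conj su) sv Ix0 bu (bddaJ bu) (kap := (2 * Jf u p x0)^-1)).
  by rewrite invr_ge0 mulr_ge0// ltW.
move=> t It tx0; apply: wr_conj_inv => //.
have := Jf_eq su It Ix0 tx0; have := Qi_ge0 m k0 u t x0 => h1 h2.
by rewrite gtr0_norm; lra.
Qed.

Lemma basis_wr z c : I c -> exists B1 P1 B2 P2, [/\ sol z B1 P1, sol z B2 P2 &
  forall x, I x -> wr B1 P1 B2 P2 x = 1].
Proof.
move=> Ic.
have [B1 [P1 [b1 p1 s1]]] := sol_exists z 1 0 aI nI Ic.
have [B2 [P2 [b2 p2 s2]]] := sol_exists z 0 1 aI nI Ic.
exists B1, P1, B2, P2; split => // x Ix.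
rewrite (wr_const aI nI s1 s2 Ix Ic) /wr b1 p1 b2 p2; ring.
Qed.

Lemma n1_inv1 : n1 (1 : C)^-1 <= 1.
Proof. by rewrite invr1 /n1 /= normr1 normr0 addr0. Qed.

(** A fundamental system for [z0] can be taken with Wronskian 1, so [weyl_b] applies with [kap = 1]:
    one spectral parameter decides for all. *)
Lemma all_bddb z0 z v pv : (forall u p, sol z0 u p -> bddb u) -> (exists c, I c) ->
  sol z v pv -> bddb v.
Proof.
move=> H [c Ic] sv; have [B1 [P1 [B2 [P2 [s1 s2 W]]]]] := basis_wr z0 Ic.
apply: (weyl_b aI nI s1 s2 sv Ic (H _ _ s1) (H _ _ s2) ler01) => t It _.
by rewrite W// oner_eq0 n1_inv1.
Qed.

Lemma all_bdda z0 z v pv : (forall u p, sol z0 u p -> bdda u) -> (exists c, I c) ->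
  sol z v pv -> bdda v.
Proof.
move=> H [c Ic] sv; have [B1 [P1 [B2 [P2 [s1 s2 W]]]]] := basis_wr z0 Ic.
apply: (weyl_a aI nI s1 s2 sv Ic (H _ _ s1) (H _ _ s2) ler01) => t It _.
by rewrite W// oner_eq0 n1_inv1.
Qed.

End WeylSolutions.

(** * Square integrable functions *)

Section L2Tools.
Variable R : realType.
Local Notation C := (R[i]).
Local Notation Msr := {measure set R -> \bar R}.
Implicit Types (mu : Msr) (D E : set R) (f g u v w : R -> C).

Lemma measurable_Iab (a b : \bar R) : measurable (Iab a b).
Proof.
have -> : Iab a b = setT `&` EFin @^-1` [set` `]a, b[] .
  by apply/seteqP; split=> x; rewrite /Iab/= in_itv/=; [move=> [-> ->]|move=> [_ /andP[]]].
by apply: (@EFin_measurable R setT) => //; exact: emeasurable_itv.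
Qed.

Lemma set_gt_Iab (b : \bar R) (c : R) : [set x | c < x /\ (x%:E < b)%E] = Iab c%:E b.
Proof. by apply/seteqP; split=> x; rewrite /Iab/= lte_fin. Qed.

Lemma set_lt_Iab (a : \bar R) (c : R) : [set x | (a < x%:E)%E /\ x < c] = Iab a c%:E.
Proof. by apply/seteqP; split=> x; rewrite /Iab/= lte_fin. Qed.

Lemma L2on_cmeas mu D f : L2on mu D f -> cmeas D f.
Proof. by move=> [? []]. Qed.

Lemma cmeas_sqn D f : cmeas D f -> measurable_fun D (sqn f).
Proof. by move=> [mr mi]; apply: measurable_funD; apply: measurable_funX. Qed.

Lemma L2on_int mu D f : measurable D -> L2on mu D f -> mu.-integrable D (EFin \o sqn f).
Proof.
move=> mD [mr [mi fin]]; apply/integrableP; split.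
  by apply/measurable_EFinP; exact: cmeas_sqn.
apply: le_lt_trans fin; apply: ge0_le_integral => //.
- by apply: measurableT_comp => //; apply/measurable_EFinP; exact: cmeas_sqn.
- by apply/measurable_EFinP; exact: cmeas_sqn.
- by move=> x _ /=; rewrite lee_fin ger0_norm// sqn_ge0.
Qed.

Lemma int_L2on mu D f : measurable D -> cmeas D f ->
  mu.-integrable D (EFin \o sqn f) -> L2on mu D f.
Proof.
by move=> mD [mr mi] fi; do 2!split => //; rewrite Rint_EFin// ltry.
Qed.

Lemma L2onS mu D E f : measurable D -> measurable E -> D `<=` E -> L2on mu E f -> L2on mu D f.
Proof.
move=> mD mE DE fE; apply: int_L2on => //; first exact: cmeasS DE (L2on_cmeas fE).
exact: integrableS mE mD DE (L2on_int mE fE).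
Qed.

Lemma L2on_le mu D f g (M : R) : measurable D -> cmeas D f -> L2on mu D g ->
  (forall x, D x -> sqn f x <= M * sqn g x) -> L2on mu D f.
Proof.
move=> mD mf gL le; apply: int_L2on => //.
apply: (le_integrable mD _ _ (integrableZr' M mD (L2on_int mD gL))).
  by apply/measurable_EFinP; exact: cmeas_sqn.
by move=> x Dx /=; rewrite lee_fin ger0_norm ?sqn_ge0// (le_trans (le x Dx))// ler_norm.
Qed.

Lemma L2on_ext mu D f g : measurable D -> (forall x, D x -> f x = g x) ->
  L2on mu D f -> L2on mu D g.
Proof.
move=> mD e fL; apply: (L2on_le (M := 1) mD _ fL).
  exact: cmeas_ext e (L2on_cmeas fL).
by move=> x Dx; rewrite mul1r /sqn e.
Qed.

Lemma L2on_lin mu D f g (z w : C) : measurable D -> L2on mu D f -> L2on mu D g ->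
  L2on mu D (fun x => z * f x + w * g x).
Proof.
move=> mD fL gL; apply: int_L2on => //.
  exact: cmeasD (cmeasM (cmeas_cst D z) (L2on_cmeas fL)) (cmeasM (cmeas_cst D w) (L2on_cmeas gL)).
have i1 := integrableDr mD (integrableZr' (2 * n1 z ^+ 2) mD (L2on_int mD fL))
  (integrableZr' (2 * n1 w ^+ 2) mD (L2on_int mD gL)).
apply: (le_integrable mD _ _ i1).
  apply/measurable_EFinP; apply: cmeas_sqn.
  exact: cmeasD (cmeasM (cmeas_cst D z) (L2on_cmeas fL)) (cmeasM (cmeas_cst D w) (L2on_cmeas gL)).
move=> x Dx /=; rewrite lee_fin ger0_norm ?sqn_ge0//.
by apply: le_trans (sqn_lin z w f g x) (ler_norm _).
Qed.

(** Young's inequality with a free weight [t]. Integrated, it is linear in the two squared norms,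
    and the weight is adjusted where it is used. *)
Lemma n1_mul_le (z w : C) (t : R) : 0 < t ->
  n1 z * n1 w <= t * (complex.Re z ^+ 2 + complex.Im z ^+ 2)
    + t^-1 * (complex.Re w ^+ 2 + complex.Im w ^+ 2).
Proof.
move=> t0; have h1 := n1_sq_le z; have h2 := n1_sq_le w.
have tt : t * t^-1 = 1 by rewrite divff// gt_eqF.
have ti : 0 < t^-1 by rewrite invr_gt0.
have h3 : 0 <= t^-1 * (t * n1 z - n1 w) ^+ 2 by rewrite mulr_ge0 ?sqr_ge0// ltW.
have e : t^-1 * (t * n1 z - n1 w) ^+ 2 = (t * t^-1) * (t * n1 z ^+ 2) - 2 * (t * t^-1) * (n1 z * n1 w) + t^-1 * n1 w ^+ 2 by ring.
rewrite e tt in h3.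
have h4 : t * n1 z ^+ 2 <= t * (2 * (complex.Re z ^+ 2 + complex.Im z ^+ 2)) by rewrite ler_pM2l.
have h5 : t^-1 * n1 w ^+ 2 <= t^-1 * (2 * (complex.Re w ^+ 2 + complex.Im w ^+ 2)) by rewrite ler_pM2l.
lra.
Qed.

Lemma L2on_mul mu D f g : measurable D -> L2on mu D f -> L2on mu D g ->
  Cintegrable mu D (fun x => f x * (g x)^*%C).
Proof.
move=> mD fL gL.
have mm : cmeas D (fun x => f x * (g x)^*%C).
  by apply: cmeasM (L2on_cmeas fL) (cmeasJ (L2on_cmeas gL)).
apply: (Cintegrable_le mD mm (integrableDr mD (L2on_int mD fL) (L2on_int mD gL))) => x Dx.
apply: (le_trans (n1M _ _)); rewrite n1J.
by have := n1_mul_le (f x) (g x) (@ltr01 R); rewrite invr1 !mul1r.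
Qed.

Lemma L2on_mul_bound mu D f g (t : R) : measurable D -> L2on mu D f -> L2on mu D g -> 0 < t ->
  n1 (Cint mu D (fun x => f x * (g x)^*%C)) <=
    t * Rintegral mu D (sqn f) + t^-1 * Rintegral mu D (sqn g).
Proof.
move=> mD fL gL t0; have fg := L2on_mul mD fL gL.
apply: (le_trans (n1_Cint mD fg)).
have fi := L2on_int mD fL; have gi := L2on_int mD gL.
rewrite -(@RintegralZl _ _ _ mu D _ t)// -(@RintegralZl _ _ _ mu D _ t^-1)// -RintegralD//.
- apply: le_Rintegral => //.
  + exact: Cintegrable_n1.
  + by apply: integrableDr => //; exact: integrableZr'.
  + by move=> x Dx; apply: (le_trans (n1M _ _)); rewrite n1J; exact: n1_mul_le.
- exact: integrableZr'.
- exact: integrableZr'.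
Qed.

Lemma L2on_Cintegrable mu D f : measurable D -> (mu D < +oo)%E -> L2on mu D f ->
  Cintegrable mu D f.
Proof.
move=> mD fD fL; have i1 : mu.-integrable D (EFin \o (fun=> 1 : R)).
  by apply: (@integrable_bounded _ _ _ _ 1) => // x _; rewrite normr1.
apply: (Cintegrable_le mD (L2on_cmeas fL) (integrableDr mD i1 (L2on_int mD fL))) => x Dx.
have := n1_mul_le (f x) 1 (@ltr01 R); rewrite invr1 !mul1r /n1 /= normr1 normr0 addr0 mulr1.
by rewrite /sqn; lra.
Qed.

Lemma L2on_exhaust mu (E : (set R)^nat) f (M : R) :
  (forall n, measurable (E n)) -> (forall n k, (n <= k)%N -> E n `<=` E k) ->
  (forall n, cmeas (E n) f) -> (forall n, mu.-integrable (E n) (EFin \o sqn f)) ->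
  (forall n, Rintegral mu (E n) (sqn f) <= M) -> L2on mu (\bigcup_n E n) f.
Proof.
move=> mE Emono mf fi fM; split; last split.
- by apply/measurable_fun_bigcup => // n; have [] := mf n.
- by apply/measurable_fun_bigcup => // n; have [] := mf n.
apply: (@le_lt_trans _ _ M%:E); last exact: ltry.
apply: exhaust_le => //.
- by move=> n; exact: cmeas_sqn.
- by move=> t; exact: sqn_ge0.
- by move=> n; rewrite Rint_EFin// lee_fin.
Qed.

Lemma sqn_eq0 f x : sqn f x = 0 -> f x = 0.
Proof.
move=> /eqP; rewrite paddr_eq0 ?sqr_ge0// !sqrf_eq0 => /andP[/eqP h1 /eqP h2].
exact: Cext.
Qed.

Lemma Rintegral_sqn_eq0 mu D f : measurable D -> cmeas D f ->
  mu.-integrable D (EFin \o sqn f) -> Rintegral mu D (sqn f) = 0 ->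
  {ae mu, forall x, D x -> f x = 0}.
Proof.
move=> mD mf fi f0.
have me : measurable_fun D (EFin \o sqn f) by apply/measurable_EFinP; exact: cmeas_sqn.
have : (\int[mu]_(x in D) `|(EFin \o sqn f) x| = 0)%E.
  transitivity (\int[mu]_(x in D) (sqn f x)%:E)%E.
    by apply: eq_integral => x _ /=; rewrite ger0_norm ?sqn_ge0.
  by rewrite Rint_EFin// f0.
move=> /(ae_eq_integral_abs mu mD me); apply: filterS => x h Dx.
by apply: sqn_eq0; have /eqP := h Dx; rewrite eqe => /eqP.
Qed.

Lemma eq_ae_Rintegral_sqn mu D f g : measurable D -> cmeas D f -> cmeas D g ->
  {ae mu, forall x, D x -> f x = g x} -> Rintegral mu D (sqn f) = Rintegral mu D (sqn g).
Proof.
move=> mD mf mg fg; rewrite /Rintegral; congr fine.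
apply: ae_eq_integral => //; try (by apply/measurable_EFinP; exact: cmeas_sqn).
by apply: filterS fg => x h Dx; rewrite /sqn h.
Qed.

Lemma Cint_sqn mu D f : Cint mu D (fun x => f x * (f x)^*%C) = (Rintegral mu D (sqn f))%:C%C.
Proof.
apply: Cext; rewrite /=.
  by apply: eq_Rintegral => x _; rewrite !cE /sqn; ring.
rewrite (_ : (fun x => _) = (fun=> 0)); first by rewrite /Rintegral integral0.
by apply/funext => x; rewrite !cE; ring.
Qed.

Lemma Cint_indic mu D E f : E `<=` D -> measurable D -> measurable E ->
  Cint mu D (fun x => (\1_E x)%:C%C * f x) = Cint mu E f.
Proof.
move=> ED mD mE; have EE : D `&` E = E by apply: setIidr.
have aux (h : R -> R) : Rintegral mu D (fun x => \1_E x * h x) = Rintegral mu E h.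
  rewrite -{2}EE Rintegral_mkcondr; apply: eq_Rintegral => x _.
  by rewrite /patch indicE; case: ifP => _; rewrite ?mul1r ?mul0r.
by rewrite /Cint -!aux; congr (_ +i* _)%C; apply: eq_Rintegral => x _; rewrite !cE /=; ring.
Qed.

Lemma cmeas_indic D E : measurable E -> cmeas D (fun x => (\1_E x : R)%:C%C).
Proof. by move=> mE; split => //=; apply: measurable_indic. Qed.

Lemma n1_indic E x : n1 ((\1_E x : R)%:C%C) <= 1.
Proof. by rewrite /n1 /= normr0 addr0 indicE; case: (_ \in _); rewrite ?normr1 ?normr0. Qed.

End L2Tools.

(** * Uniform bounds on compact pieces and square integrability *)

Section L2Bounded.
Variable R : realType.
Local Notation C := (R[i]).
Local Notation Msr := {measure set R -> \bar R}.
Variables (a b : \bar R) (K : finType) (m : K -> Msr) (k0 : K).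
Local Notation I := (Iab a b).
Hypothesis aI : admissible m I.
Local Notation rho := (m k0).
Local Notation Qi := (Qi m k0).
Local Notation bddb := (bddb a b m k0).
Local Notation bdda := (bdda a b m k0).
Implicit Types (u : R -> C).
Let mI := @measurable_Ico R.

Lemma lbm_cmeas_Ico u x y : lbm I u -> I x -> I y -> cmeas (Ico x y) u.
Proof.
by move=> lu Ix Iy; apply: cmeasS (@Ico_sub_Icc R x y) (lu x y Ix Iy).1; exact: measurable_Icc.
Qed.

Lemma Iab_bigcup (xs ys : nat -> R) : (forall n, I (xs n)) -> (forall n, I (ys n)) ->
  {homo xs : n k / (n <= k)%N >-> k <= n} -> {homo ys : n k / (n <= k)%N >-> n <= k} ->
  (forall t, I t -> exists n, xs n < t) -> (forall t, I t -> exists n, t < ys n) ->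
  (forall n k, (n <= k)%N -> Ico (xs n) (ys n) `<=` Ico (xs k) (ys k)) /\
  \bigcup_n Ico (xs n) (ys n) = I.
Proof.
move=> Ix Iy hx hy ex ey; have mono n k : (n <= k)%N -> Ico (xs n) (ys n) `<=` Ico (xs k) (ys k).
  by move=> nk; apply: IcoS; [exact: hx|exact: hy].
split => //; apply/seteqP; split=> t.
  by move=> [n _ /andP[h1 /ltW h2]]; exact: Iab_conv (Ix n) (Iy n) h1 h2.
move=> It; have [n hn] := ex t It; have [k hk] := ey t It.
exists (maxn n k) => //; apply/andP; split.
  by apply: le_trans (ltW hn); apply: hx; exact: leq_maxl.
by apply: lt_le_trans hk _; apply: hy; exact: leq_maxr.
Qed.

Lemma bdd_L2on u c : I c -> lbm I u -> bdda u -> bddb u -> L2on rho I u.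
Proof.
move=> Ic lu ba bb.
have [xs [Ix xc hx ex]] := Iab_down Ic; have [ys [Iy cy hy ey]] := Iab_up Ic.
have [mono <-] := Iab_bigcup Ix Iy hx hy ex ey.
have [M1 H1] := ba c Ic; have [M2 H2] := bb c Ic.
apply: (L2on_exhaust (M := M1 + M2)) => // n.
- exact: lbm_cmeas_Ico.
- exact: (sqn_int k0 aI lu (Ix n) (Iy n)).
- rewrite -[Rintegral _ _ _]/(Qi u (xs n) (ys n)) (Qi_split k0 aI lu (Ix n) (Iy n) (xc n) (cy n)).
  by apply: lerD; [exact: H1|exact: H2].
Qed.

Lemma bddb_L2on u c : lbm I u -> bddb u -> I c -> L2on rho [set x | c < x /\ (x%:E < b)%E] u.
Proof.
move=> lu bb Ic; have [ys [Iy cy hy ey]] := Iab_up Ic; have [M H] := bb c Ic.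
have mono n k : (n <= k)%N -> Ico c (ys n) `<=` Ico c (ys k).
  by move=> nk; apply: IcoS => //; exact: hy.
apply: (@L2onS _ _ _ (\bigcup_n Ico c (ys n))).
- by rewrite set_gt_Iab; exact: measurable_Iab.
- exact: bigcup_measurable.
- move=> x [cx xb]; have Ix : I x by split => //; apply: lt_trans Ic.1 _; rewrite lte_fin.
  by have [n hn] := ey x Ix; exists n => //; rewrite /Ico/= (ltW cx).
- apply: (L2on_exhaust (M := M)) => // n.
  + exact: lbm_cmeas_Ico.
  + exact: (sqn_int k0 aI lu Ic (Iy n)).
  + exact: H.
Qed.

Lemma bdda_L2on u c : lbm I u -> bdda u -> I c -> L2on rho [set x | (a < x%:E)%E /\ x < c] u.
Proof.
move=> lu ba Ic; have [xs [Ix xc hx ex]] := Iab_down Ic; have [M H] := ba c Ic.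
have mono n k : (n <= k)%N -> Ico (xs n) c `<=` Ico (xs k) c.
  by move=> nk; apply: IcoS => //; exact: hx.
apply: (@L2onS _ _ _ (\bigcup_n Ico (xs n) c)).
- by rewrite set_lt_Iab; exact: measurable_Iab.
- exact: bigcup_measurable.
- move=> x [ax xc']; have Ix' : I x by split => //; apply: lt_trans Ic.2; rewrite lte_fin.
  by have [n hn] := ex x Ix'; exists n => //; rewrite /Ico/= (ltW hn).
- apply: (L2on_exhaust (M := M)) => // n.
  + exact: lbm_cmeas_Ico.
  + exact: (sqn_int k0 aI lu (Ix n) Ic).
  + exact: H.
Qed.

Lemma Qi_le_L2on u D x y : measurable D -> L2on rho D u -> Ico x y `<=` D ->
  Qi u x y <= Rintegral rho D (sqn u).
Proof.
move=> mD uD sub; apply: le_Rintegral_set => //; first exact: L2on_int.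
by move=> t _; exact: sqn_ge0.
Qed.

Lemma L2on_bddb u : (forall c, I c -> L2on rho [set x | c < x /\ (x%:E < b)%E] u) -> bddb u.
Proof.
(* The half-line of the hypothesis is open at its left end, so it must start at some [d < c] in
   order to contain [[c, y)]. *)
move=> H c Ic; have [d Id dc] := Iab_lt Ic.
exists (Rintegral rho [set x | d < x /\ (x%:E < b)%E] (sqn u)) => y Iy cy.
apply: Qi_le_L2on; [by rewrite set_gt_Iab; exact: measurable_Iab|exact: H|].
move=> t /andP[h1 h2]; split; first exact: lt_le_trans h1.
by apply: lt_trans Iy.2; rewrite lte_fin.
Qed.

Lemma L2on_bdda u : (forall c, I c -> L2on rho [set x | (a < x%:E)%E /\ x < c] u) -> bdda u.
Proof.
move=> H c Ic.
exists (Rintegral rho [set x | (a < x%:E)%E /\ x < c] (sqn u)) => y Iy cy.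
apply: Qi_le_L2on; [by rewrite set_lt_Iab; exact: measurable_Iab|exact: H|].
move=> t /andP[h1 h2]; split => //; apply: lt_le_trans Iy.1 _; by rewrite lee_fin.
Qed.

Lemma L2on_bdd u : L2on rho I u -> bdda u /\ bddb u.
Proof.
move=> uI; split=> c Ic; exists (Rintegral rho I (sqn u)) => y Iy cy;
  by apply: Qi_le_L2on => //; [exact: measurable_Iab|move=> t /andP[h1 /ltW h2]; exact: Iab_conv h1 h2].
Qed.

End L2Bounded.

(** * Orthogonal projection onto the span of two functions *)

Section L2Projection.
Variable R : realType.
Local Notation C := (R[i]).
Variables (mu : {measure set R -> \bar R}) (D : set R).
Hypothesis mD : measurable D.
Implicit Types (f g h w : R -> C) (z : C).

Definition l2prod f h := Cint mu D (fun x => f x * (h x)^*%C).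

Lemma l2prod_linl f g h z z' : L2on mu D f -> L2on mu D g -> L2on mu D h ->
  l2prod (fun x => z * f x + z' * g x) h = z * l2prod f h + z' * l2prod g h.
Proof.
move=> fL gL hL; have i1 := L2on_mul mD fL hL; have i2 := L2on_mul mD gL hL.
rewrite /l2prod -!CintZl// -CintD//; do ?exact: CintegrableZl.
by apply: eq_Cint => x _; ring.
Qed.

Lemma l2prod_conj f h : L2on mu D f -> L2on mu D h -> l2prod h f = ((l2prod f h)^*)%C.
Proof.
move=> fL hL; rewrite /l2prod -CintJ//; last exact: L2on_mul.
by apply: eq_Cint => x _; apply: Cext; rewrite !cE; ring.
Qed.

Lemma l2prod_eq0 f : L2on mu D f -> l2prod f f = 0 -> {ae mu, forall x, D x -> f x = 0}.
Proof.
move=> fL; rewrite /l2prod Cint_sqn => e.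
by apply: Rintegral_sqn_eq0 => //; [exact: L2on_cmeas fL|exact: L2on_int|case: e].
Qed.

(** Gram-Schmidt: [h] is [f2] made orthogonal to [f1]. Independence modulo null sets makes both
    squared norms nonzero, so the quotients defining the coefficients are meaningful. *)
Lemma l2_projection w f1 f2 : L2on mu D w -> L2on mu D f1 -> L2on mu D f2 ->
  (forall z1 z2, {ae mu, forall x, D x -> z1 * f1 x + z2 * f2 x = 0} -> z1 = 0 /\ z2 = 0) ->
  exists d1 d2, let g := fun x => 1 * w x + (-1) * (d1 * f1 x + d2 * f2 x) in
    l2prod g f1 = 0 /\ l2prod g f2 = 0.
Proof.
move=> wL L1 L2 ind.
have n1 : l2prod f1 f1 != 0.
  apply/eqP => /(l2prod_eq0 L1) e; have [|/eqP] := ind 1 0; last by rewrite oner_eq0.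
  by apply: filterS e => x h Dx; rewrite h// mulr0 mul0r addr0.
set N1 := l2prod f1 f1 in n1; set e := l2prod f2 f1 / N1.
pose h x := 1 * f2 x + (- e) * f1 x.
have hL : L2on mu D h by exact: L2on_lin.
have h1 : l2prod h f1 = 0 by rewrite /h l2prod_linl// -/N1 /e mul1r mulNr divfK// subrr.
have h1' : l2prod f1 h = 0 by rewrite l2prod_conj// h1 conjc0.
have n2 : l2prod h h != 0.
  apply/eqP => /(l2prod_eq0 hL) eh; have [|_ /eqP] := ind (- e) 1; last by rewrite oner_eq0.
  by apply: filterS eh => x hx Dx; rewrite addrC; exact: hx.
set N2 := l2prod h h in n2; set al := l2prod w f1 / N1; set be := l2prod w h / N2.
(* The projection [al * f1 + be * h], expanded back in [f1] and [f2]. *)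
exists (al - be * e), be => g.
have fL : L2on mu D (fun x => al * f1 x + be * h x) by exact: L2on_lin.
have eg : g = (fun x => 1 * w x + (-1) * (al * f1 x + be * h x)).
  by apply/funext => x; rewrite /g /h; ring.
have gL : L2on mu D g by rewrite eg; exact: L2on_lin.
have g1 : l2prod g f1 = 0.
  by rewrite eg (l2prod_linl _ _ wL fL L1) (l2prod_linl _ _ L1 hL L1) h1 -/N1 /al divfK//; ring.
have gh : l2prod g h = 0.
  by rewrite eg (l2prod_linl _ _ wL fL hL) (l2prod_linl _ _ L1 hL hL) h1' -/N2 /be divfK//; ring.
split => //; rewrite l2prod_conj//.
have -> : f2 = (fun x => 1 * h x + e * f1 x) by apply/funext => x; rewrite /h; ring.
rewrite l2prod_linl// (l2prod_conj gL hL) (l2prod_conj gL L1) g1 gh conjc0.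
by rewrite !mulr0 addr0 conjc0.
Qed.

End L2Projection.

(** * The deficiency space *)

Section Defect.
Variable R : realType.
Local Notation C := (R[i]).
Local Notation Msr := {measure set R -> \bar R}.
Variables (a b : \bar R) (rho sp sm cp cm : Msr).
Hypotheses (hab : (a < b)%E)
  (Hrho : loc_finite_on a b rho)
  (Hsp : loc_finite_on a b sp) (Hsm : loc_finite_on a b sm)
  (Hs : jordan_pair sp sm)
  (Hsupp : forall x, Iab a b x -> forall e : R, 0 < e ->
     (0 < measure_add sp sm (Ioo (x - e) (x + e)))%E)
  (Hcp : loc_finite_on a b cp) (Hcm : loc_finite_on a b cm)
  (Hc : jordan_pair cp cm)
  (H4chi : forall x : R,
     ((sp [set x] - sm [set x]) * (cp [set x] - cm [set x]) = 0)%E)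
  (H4rho : forall x : R, ((sp [set x] - sm [set x]) * rho [set x] = 0)%E)
  (H5 : gap_hyp a b rho sp sm cp cm).
Local Notation I := (Iab a b).
Local Notation M5 := (mfam rho sp sm cp cm).
Local Notation Qd := (qd M5 ord_max (scoef R) (qcoef R) I).
Local Notation sol z u p := (Qd u p (fun x => z * u x)).
Let aI : admissible M5 I := admissible_mfam Hrho Hsp Hsm Hcp Hcm.
Let nI : noatoms M5 ord_max (scoef R) (qcoef R) I := noatoms_mfam a b Hs Hc H4chi H4rho.
Let mI : measurable I := measurable_Iab a b.
Let mico := @measurable_Ico R.
Local Notation T0 := (T0 a b rho sp sm cp cm).
Local Notation Tmin := (Tmin a b rho sp sm cp cm).
Local Notation defect := (defect_space a b rho sp sm cp cm).

Lemma Cint_Iab_eq0 (F : R -> C) c d : I c -> I d -> Cintegrable rho I F ->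
  (forall x y, I x -> I y -> x < c -> d < y -> Cint rho (Ico x y) F = 0) -> Cint rho I F = 0.
Proof.
move=> Ic Id [fr fi] z.
have [c' Ic' cc] := Iab_lt Ic; have [d' Id' dd] := Iab_gt Id.
have [xs [Ix xc hx ex]] := Iab_down Ic'; have [ys [Iy cy hy ey]] := Iab_up Id'.
have [mono eI] := Iab_bigcup Ix Iy hx hy ex ey.
have zn n : Cint rho (Ico (xs n) (ys n)) F = 0.
  by apply: z => //; [exact: le_lt_trans (xc n) cc|exact: lt_le_trans (cy n)].
have aux (h : R -> R) : rho.-integrable I (EFin \o h) ->
    (forall n, Rintegral rho (Ico (xs n) (ys n)) h = 0) -> Rintegral rho I h = 0.
  move=> hi hn; have := @exhaust_cvg _ rho (fun n => Ico (xs n) (ys n)) h.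
  rewrite eI => /(_ (fun n => mico _ _) mono hi).
  rewrite (_ : (fun n => _) = fun=> 0); last by apply/funext.
  by move=> l0; apply/esym/(cvg_unique _ (cvg_cst 0) l0); exact: norm_hausdorff.
apply: Cext; rewrite /=; apply: aux => // n; first by have /(congr1 (@complex.Re R)) := zn n.
by have /(congr1 (@complex.Im R)) := zn n.
Qed.

Lemma conjNi : ((- 'i)^*)%C = 'i%C :> C.
Proof. by apply: Cext; rewrite /= ?oppr0 ?opprK. Qed.

(** Where [f] vanishes near the ends its quasi-derivative vanishes too, because sigma has full
    support. Both boundary terms of the Lagrange identity with the conjugate of [u], a solution for
    i, are therefore 0. *)
Lemma T0_orth f g u p : T0 f g -> sol (- 'i%C) u p -> L2on rho I u ->
  ip a b rho (fun x => g x - 'i%C * f x) u = 0.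
Proof.
move=> [tr [fL [gL [c [d [Ic [Id f0]]]]]]] su uL.
have [lg [pf qf]] := tau_rel_qd Hrho Hsp Hsm Hcp Hcm tr.
have FL : L2on rho I (fun x => g x - 'i%C * f x).
  apply: (L2on_ext mI _ (L2on_lin 1 (- 'i%C) mI gL fL)) => x _.
  by rewrite mul1r mulNr.
apply: (@Cint_Iab_eq0 _ (Num.min c d) (Num.max c d)).
- by rewrite /Num.min; case: ifP.
- by rewrite /Num.max; case: ifP.
- exact: L2on_mul.
move=> x y Ix Iy; rewrite lt_min gt_max => /andP[xc xd] /andP[cy dy].
have out t : I t -> t < c \/ d < t -> f t = 0.
  by move=> It [h|h]; apply: f0 => // /andP[h1 h2]; lra.
have px : pf x = 0.
  have [x' Ix' x'x] := Iab_lt Ix.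
  apply: (qd_zero_quasi Hrho Hsp Hsm Hs Hsupp Hcp Hcm qf Ix' Ic) => // t h1 h2.
  by apply: out; [exact: Iab_conv Ix' Ic (ltW h1) (ltW h2)|left].
have py : pf y = 0.
  have [y' Iy' y'y] := Iab_gt Iy.
  apply: (qd_zero_quasi Hrho Hsp Hsm Hs Hsupp Hcp Hcm qf Id Iy') => // t h1 h2.
  by apply: out; [exact: Iab_conv Id Iy' (ltW h1) (ltW h2)|right].
have := lagrange_int aI nI qf (sol_conj aI su) Ix Iy (ltW (lt_trans xc cy)).
rewrite /wr px py (out x Ix (or_introl xc)) (out y Iy (or_intror dy)) !mul0r subrr add0r => e.
rewrite e; apply: eq_Cint => t _; rewrite conjNi; ring.
Qed.

Lemma n1_i : n1 ('i%C : C) = 1.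
Proof. by rewrite /n1 /= normr0 normr1 add0r. Qed.

Lemma Tmin_orth U V u p : Tmin U V -> sol (- 'i%C) u p -> L2on rho I u ->
  ip a b rho (fun x => V x - 'i%C * U x) u = 0.
Proof.
move=> [UL [VL app]] su uL; set X := ip _ _ _ _ _.
set W := Rintegral rho I (sqn u).
have W0 : 0 <= W by apply: Rintegral_ge0 => x _; exact: sqn_ge0.
have bound t : 0 < t -> n1 X <= 2 * (t^-1 * (1 + W)).
  move=> t0; have ti : 0 < t^-1 by rewrite invr_gt0.
  (* A squared distance below [t^-2], combined with the weight [t] in Young's inequality, makes both
     terms of order [1/t]. *)
  have [f [g [T [d1 d2]]]] := app (t^-1 ^+ 2) (exprn_gt0 2 ti).
  have [_ [fL [gL _]]] := T.
  have dL (h k : R -> C) : L2on rho I h -> L2on rho I k -> L2on rho I (fun x => h x - k x).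
    move=> hL kL; apply: (L2on_ext mI _ (L2on_lin 1 (-1) mI hL kL)) => x _.
    by rewrite mul1r mulN1r.
  have e : X = l2prod rho I (fun x => V x - g x) u - 'i%C * l2prod rho I (fun x => U x - f x) u.
    have T0e := T0_orth T su uL.
    have := l2prod_linl mI 1 (- 'i%C) (dL _ _ VL gL) (dL _ _ UL fL) uL.
    rewrite mul1r mulNr => <-; rewrite -[LHS]subr0 -T0e /X /ip.
    rewrite -CintB//.
    - by rewrite /l2prod; apply: eq_Cint => x _; ring.
    - apply: L2on_mul => //; apply: (L2on_ext mI _ (L2on_lin 1 (- 'i%C) mI VL UL)) => x _.
      by rewrite mul1r mulNr.
    - apply: L2on_mul => //; apply: (L2on_ext mI _ (L2on_lin 1 (- 'i%C) mI gL fL)) => x _.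
      by rewrite mul1r mulNr.
  have B (h : R -> C) : L2on rho I h -> Rintegral rho I (sqn h) < t^-1 ^+ 2 ->
      n1 (l2prod rho I h u) <= t^-1 * (1 + W).
    move=> hL hs; apply: (le_trans (L2on_mul_bound mI hL uL t0)).
    have : t * Rintegral rho I (sqn h) <= t * t^-1 ^+ 2 by rewrite ler_pM2l// ltW.
    have -> : t * t^-1 ^+ 2 = t^-1 by rewrite expr2 mulrA divff ?gt_eqF// mul1r.
    rewrite -/W; lra.
  have B1 := B _ (dL _ _ VL gL) d2; have B2 := B _ (dL _ _ UL fL) d1.
  rewrite e; apply: (le_trans (n1B _ _)).
  have := n1M 'i%C (l2prod rho I (fun x => U x - f x) u); rewrite n1_i mul1r; lra.
apply: n1_eq0; apply/eqP; rewrite eq_le n1_ge0 andbT leNgt; apply/negP => X0.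
(* With this [t] the bound reads [n1 X <= n1 X / 2], which is impossible for [n1 X > 0]. *)
have Y0 : 0 < 4 * (1 + W) / n1 X by rewrite divr_gt0// mulr_gt0//; lra.
have := bound _ Y0; rewrite invf_div => h.
have e : 2 * (n1 X / (4 * (1 + W)) * (1 + W)) = n1 X / 2 by field; lra.
by rewrite e in h; lra.
Qed.

Lemma sol_defect u p : sol (- 'i%C) u p -> L2on rho I u -> defect u.
Proof. by move=> su uL; split => // U V UV; exact: Tmin_orth UV su uL. Qed.

Lemma T0_Tmin f g : T0 f g -> Tmin f g.
Proof.
move=> T; have [_ [fL [gL _]]] := T; split => //; split => // e e0; exists f, g; split => //.
have z (h : R -> C) : dist2 a b rho h h = 0.
  rewrite /dist2 (_ : sqn _ = fun=> 0); first by rewrite /Rintegral integral0.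
  by apply/funext => x; rewrite /sqn subrr /= expr0n addr0.
by rewrite !z.
Qed.

Section Fundamental.
Variables (c x1 x2 : R) (B1 P1 B2 P2 : R -> C).
Hypotheses (Ic : I c) (s1 : sol (- 'i%C) B1 P1) (s2 : sol (- 'i%C) B2 P2)
  (b1 : B1 c = 1) (p1 : P1 c = 0) (b2 : B2 c = 0) (p2 : P2 c = 1)
  (x12 : x1 < x2) (S1 : supp a b rho x1) (S2 : supp a b rho x2).

Lemma fundamental_indep al be z1 z2 : I al -> I be -> al < x1 -> x2 < be ->
  {ae rho, forall x, Ico al be x -> z1 * B1 x + z2 * B2 x = 0} -> z1 = 0 /\ z2 = 0.
Proof.
move=> Ial Ibe al1 be2 e.
have [] := sol_inj hab Hrho Hsp Hsm Hs Hsupp Hcp Hcm Hc H4chi H4rho H5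
  (sol_lin aI z1 z2 s1 s2) Ial Ibe e al1 x12 be2 S1 S2 Ic.
by rewrite b1 b2 p1 p2 !mulr0 !mulr1 addr0 add0r.
Qed.

Lemma rho_Ico_fin x y : I x -> I y -> (rho (Ico x y) < +oo)%E.
Proof. by move=> Ix Iy; exact: (admissible_Ico ord_max aI Ix Iy). Qed.

Lemma indic_lbm al be : lbm I (fun x => (\1_(Ico al be) x : R)%:C%C).
Proof.
move=> x y Ix Iy; split; first exact: cmeas_indic.
by exists 1 => t _; exact: n1_indic.
Qed.

Lemma indic_out (al be x : R) : x < al \/ be <= x -> \1_(Ico al be) x = 0 :> R.
Proof.
move=> h; rewrite indicE memNset// => /andP[h1 h2]; case: h => h.
  by have := lt_le_trans h h1; rewrite ltxx.
by have := le_lt_trans h h2; rewrite ltxx.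
Qed.

Lemma L2on_vanish u al be : lbm I u -> I al -> I be ->
  (forall x, I x -> x < al \/ be <= x -> u x = 0) -> L2on rho I u.
Proof.
move=> lu Ial Ibe u0; apply: (bdd_L2on aI (k0 := ord_max) Ial lu).
  apply: (bdda1 aI lu Ial (M := 0)) => x Ix xa.
  rewrite /Qi (_ : Rintegral _ _ _ = Rintegral (M5 ord_max) (Ico x al) (fun=> 0)).
    by rewrite /Rintegral integral0.
  apply: eq_Rintegral => t; rewrite inE => /andP[h1 h2].
  by rewrite /sqn u0 ?expr0n ?addr0//=; [exact: Iab_conv Ix Ial h1 (ltW h2)|left].
apply: (bddb1 aI lu Ibe (M := 0)) => x Ix xa.
rewrite /Qi (_ : Rintegral _ _ _ = Rintegral (M5 ord_max) (Ico be x) (fun=> 0)).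
  by rewrite /Rintegral integral0.
apply: eq_Rintegral => t; rewrite inE => /andP[h1 h2].
by rewrite /sqn u0 ?expr0n ?addr0//=; [exact: Iab_conv Ibe Ix h1 (ltW h2)|right].
Qed.

(** The equation tau f - i f = g is solved from [al] with zero data. Orthogonality of [g] to the two
    basic solutions supplies exactly the two conditions that make [f] and its quasi-derivative
    vanish at [be], so [f] is compactly supported and the pair lies in [T0]. *)
Lemma defect_interval w al be : defect w -> I al -> I be -> al < x1 -> x2 < be ->
  exists d1 d2, {ae rho, forall x, Ico al be x -> w x = d1 * B1 x + d2 * B2 x}.
Proof.
move=> [wL wD] Ial Ibe al1 be2.
have [alb1 alb2] := (qd_lbm aI s1, qd_lbm aI s2).
set J := Ico al be; have mJ : measurable J by exact: mico.
have JI : J `<=` I by move=> t /andP[h1 /ltW h2]; exact: Iab_conv Ial Ibe h1 h2.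
have loc (u : R -> C) : lbm I u -> L2on rho J u.
  move=> lu; apply: int_L2on => //; first exact: (lbm_cmeas_Ico lu Ial Ibe).
  exact: (sqn_int ord_max aI lu Ial Ibe).
have L1 := loc _ alb1.1; have L2 := loc _ alb2.1.
have wJ : L2on rho J w by exact: L2onS JI wL.
have [d1 [d2]] := l2_projection mJ wJ L1 L2 (fun z1 z2 => @fundamental_indep al be z1 z2 Ial Ibe al1 be2).
set g0 := (fun x => _) => -[g1 g2].
have cL : L2on rho J (fun x => d1 * B1 x + d2 * B2 x) by exact: L2on_lin.
have g0L : L2on rho J g0 by exact: L2on_lin.
pose ind x : C := (\1_J x : R)%:C%C.
pose g x := ind x * g0 x.
have ind0 x : x < al \/ be <= x -> ind x = 0 by move=> h; rewrite /ind indic_out.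
have indl : lbm I ind by exact: indic_lbm.
have iwL : L2on rho I (fun x => ind x * w x).
  apply: (L2on_le (M := 1) mI _ wL).
    exact: cmeasM (cmeas_indic _ mJ) (L2on_cmeas wL).
  move=> x _; rewrite mul1r /sqn /= /ind indicE; case: (x \in J) => /=.
    by rewrite mul1r.
  by rewrite mul0r /= expr0n addr0 addr_ge0 ?sqr_ge0.
have icL : L2on rho I (fun x => ind x * (d1 * B1 x + d2 * B2 x)).
  apply: (@L2on_vanish _ al be) => //.
    by apply: lbmM => //; apply: lbmD; apply: lbmZ; [exact: alb1.1|exact: alb2.1].
  by move=> x _ h; rewrite ind0// mul0r.
have gL : L2on rho I g.
  by apply: (L2on_ext mI _ (L2on_lin 1 (-1) mI iwL icL)) => x _; rewrite /g /g0; ring.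
have gloc x y : I x -> I y -> Cintegrable rho (Ico x y) g.
  move=> Ix Iy; apply: L2on_Cintegrable => //; first exact: rho_Ico_fin.
  apply: (L2onS _ mI _ gL) => // t /andP[h1 /ltW h2]; exact: Iab_conv Ix Iy h1 h2.
have [f [p [f0 p0 qf]]] := inh_exists (scoef R) (qcoef R) (k0 := ord_max) 'i%C aI Ial
  (fun x Ix _ => gloc al x Ial Ix) (fun x h => eq_trans (congr1 (fun z => z * g0 x) (ind0 x (or_introl h))) (mul0r _)).
have albe : al <= be by exact: ltW (lt_trans al1 (lt_trans x12 be2)).
(* The inner product of [g] with a solution for -i equals the boundary form at [be], since the form
   at [al] is 0. The two forms determine [f be] and [p be], because the conjugate basic solutions
   have Wronskian 1. *)
have wr0 B P : sol (- 'i%C) B P -> l2prod rho J g0 B = 0 ->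
    f be * (P be)^*%C - p be * (B be)^*%C = 0.
  move=> sB gB; have := lagrange_int aI nI qf (sol_conj aI sB) Ial Ibe albe.
  rewrite /wr (f0 al)// (p0 al)// !mul0r subrr add0r => ->.
  rewrite -[RHS]gB; apply: eq_Cint => t Jt; rewrite conjNi /g /ind indicE mem_set//=.
  ring.
have e1 := wr0 _ _ s1 g1; have e2 := wr0 _ _ s2 g2.
have W1 : B1 be * P2 be - P1 be * B2 be = 1.
  rewrite -[LHS]/(wr B1 P1 B2 P2 be) (wr_const aI nI s1 s2 Ibe Ic) /wr b1 b2 p1 p2.
  by rewrite mul1r mul0r subr0.
have W1' : (B1 be)^*%C * (P2 be)^*%C - (P1 be)^*%C * (B2 be)^*%C = 1.
  by rewrite -!rmorphM -rmorphB W1 rmorph1.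
have fbe : f be = 0.
  rewrite -[LHS]mulr1 -W1'.
  have -> : f be * ((B1 be)^*%C * (P2 be)^*%C - (P1 be)^*%C * (B2 be)^*%C) =
    (B1 be)^*%C * (f be * (P2 be)^*%C - p be * (B2 be)^*%C) -
    (B2 be)^*%C * (f be * (P1 be)^*%C - p be * (B1 be)^*%C) by ring.
  by rewrite e1 e2 !mulr0 subrr.
have pbe : p be = 0.
  rewrite -[LHS]mulr1 -W1'.
  have -> : p be * ((B1 be)^*%C * (P2 be)^*%C - (P1 be)^*%C * (B2 be)^*%C) =
    (P1 be)^*%C * (f be * (P2 be)^*%C - p be * (B2 be)^*%C) -
    (P2 be)^*%C * (f be * (P1 be)^*%C - p be * (B1 be)^*%C) by ring.
  by rewrite e1 e2 !mulr0 subrr.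
have fout x : I x -> x < al \/ be <= x -> f x = 0.
  move=> Ix [h|h]; first by rewrite f0// ltW.
  have qfb : qd M5 ord_max (scoef R) (qcoef R) (from I be) f p (fun x => 'i%C * f x).
    apply: (qd_ext (admissibleS be aI) (qdS (@fromS _ I be) qf)) => // t [_ h'].
    by rewrite /g ind0 ?mul0r ?addr0//; right.
  by have [] := fwd_unique aI Ibe qfb fbe pbe Ix h.
have lf := (qd_lbm aI qf).1.
have fL : L2on rho I f by exact: L2on_vanish lf Ial Ibe fout.
have GL : L2on rho I (fun x => 'i%C * f x + g x).
  by apply: (L2on_ext mI _ (L2on_lin 'i%C 1 mI fL gL)) => x _; rewrite mul1r.
have tf : T0 f (fun x => 'i%C * f x + g x).
  split; last first.
    split => //; split => //; exists al, be; do 2!split => //.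
    move=> x Ix h; apply: fout => //; case: (ltP x al) => h1; first by left.
    right; rewrite leNgt; apply/negP => h2; apply: h; rewrite h1 ltW//.
  apply: (qd_tau_rel hab Hrho Hsp Hsm Hcp Hcm qf) => x y Ix Iy xy.
  apply: L2on_Cintegrable; [exact: measurable_Icc|exact: Hrho.1|].
  apply: (L2onS _ mI _ GL); first exact: measurable_Icc.
  by move=> t /andP[h1 h2]; exact: Iab_conv Ix Iy h1 h2.
have gw : l2prod rho J g0 w = 0.
  have := wD _ _ (T0_Tmin tf); rewrite /ip => <-.
  rewrite /l2prod -(Cint_indic _ _ JI)//; apply: eq_Cint => x _; rewrite /g /ind; ring.
(* [g0] is a combination of [w], [B1] and [B2], and it is orthogonal to all three. *)
have gg : l2prod rho J g0 g0 = 0.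
  rewrite l2prod_conj// {1}/g0 l2prod_linl// l2prod_linl//.
  rewrite (l2prod_conj _ g0L L1)// (l2prod_conj _ g0L L2)// (l2prod_conj _ g0L wJ)//.
  by rewrite g1 g2 gw; apply: Cext; rewrite !cE /=; ring.
exists d1, d2; apply: filterS (l2prod_eq0 mJ g0L gg) => x h Jx.
by have /eqP := h Jx; rewrite /g0 mul1r mulN1r subr_eq0 => /eqP.
Qed.

(** Coefficients found on a larger interval must agree with those of the first one, since the basic
    solutions are already independent rho-a.e. there. One pair thus serves on a whole exhaustion of
    (a, b), up to a countable union of null sets, and the norm of [w] bounds that of the
    combination. *)
Lemma defect_sol (w : R -> C) : defect w -> exists d1 d2,
  Defs.ae_eq a b rho w (fun x => d1 * B1 x + d2 * B2 x) /\
  L2on rho I (fun x => d1 * B1 x + d2 * B2 x).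
Proof.
move=> wd; have [wL _] := wd.
have [al Ial al1] := Iab_lt S1.1; have [be Ibe be2] := Iab_gt S2.1.
have [d1 [d2 e0]] := defect_interval wd Ial Ibe al1 be2.
have loc x y : I x -> I y -> x <= al -> be <= y ->
    {ae rho, forall t, Ico x y t -> w t = d1 * B1 t + d2 * B2 t}.
  move=> Ix Iy xa yb.
  have [k1 [k2 e1]] := defect_interval wd Ix Iy (le_lt_trans xa al1) (lt_le_trans be2 yb).
  suff [] : d1 - k1 = 0 /\ d2 - k2 = 0.
    by move=> /eqP; rewrite subr_eq0 => /eqP -> /eqP; rewrite subr_eq0 => /eqP ->.
  apply: (fundamental_indep Ial Ibe al1 be2).
  apply: filterS2 e0 e1 => t h0 h1 Jt.
  have h1' := h1 (IcoS xa yb Jt); rewrite (h0 Jt) in h1'.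
  by rewrite !mulrBl addrACA h1' -opprD subrr.
have [xs [Ix xa hx ex]] := Iab_down Ial; have [ys [Iy yb hy ey]] := Iab_up Ibe.
have [mono eI] := Iab_bigcup Ix Iy hx hy ex ey.
have [alb1 alb2] := (qd_lbm aI s1, qd_lbm aI s2).
have lB : lbm I (fun x => d1 * B1 x + d2 * B2 x).
  by apply: lbmD; apply: lbmZ; [exact: alb1.1|exact: alb2.1].
exists d1, d2; split.
  have : rho.-negligible (\bigcup_n ~` (fun t => Ico (xs n) (ys n) t -> w t = d1 * B1 t + d2 * B2 t)).
    by apply: negligible_bigcup => n; exact: loc.
  apply: negligibleS => t /= h; rewrite -eI in h.
  by apply: contrapT => h2; apply: h => -[n _ h3]; apply: contrapT => h4; apply: h2; exists n => // /(_ h3).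
rewrite -eI; apply: (L2on_exhaust (M := Rintegral rho I (sqn w))) => // n.
- exact: (lbm_cmeas_Ico lB (Ix n) (Iy n)).
- exact: (sqn_int ord_max aI lB (Ix n) (Iy n)).
- have sub : Ico (xs n) (ys n) `<=` I.
    by move=> t /andP[h1 /ltW h2]; exact: Iab_conv (Ix n) (Iy n) h1 h2.
  rewrite -(@eq_ae_Rintegral_sqn _ rho _ w)//.
  + by apply: (Qi_le_L2on (k0 := ord_max) (m := M5)).
  + exact: cmeasS mI sub (L2on_cmeas wL).
  + exact: (lbm_cmeas_Ico lB (Ix n) (Iy n)).
  + exact: loc.
Qed.

End Fundamental.
End Defect.

(** * The dimension of the deficiency space in the three cases *)

Section Count.
Variable R : realType.
Local Notation C := (R[i]).
Local Notation Msr := {measure set R -> \bar R}.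
Variables (a b : \bar R) (rho sp sm cp cm : Msr).
Hypotheses (hab : (a < b)%E)
  (Hrho : loc_finite_on a b rho)
  (Hsp : loc_finite_on a b sp) (Hsm : loc_finite_on a b sm)
  (Hs : jordan_pair sp sm)
  (Hsupp : forall x, Iab a b x -> forall e : R, 0 < e ->
     (0 < measure_add sp sm (Ioo (x - e) (x + e)))%E)
  (Hcp : loc_finite_on a b cp) (Hcm : loc_finite_on a b cm)
  (Hc : jordan_pair cp cm)
  (H4chi : forall x : R,
     ((sp [set x] - sm [set x]) * (cp [set x] - cm [set x]) = 0)%E)
  (H4rho : forall x : R, ((sp [set x] - sm [set x]) * rho [set x] = 0)%E)
  (H5 : gap_hyp a b rho sp sm cp cm)
  (H6 : exists x y, x <> y /\ supp a b rho x /\ supp a b rho y).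
Local Notation I := (Iab a b).
Local Notation M5 := (mfam rho sp sm cp cm).
Local Notation Qd := (qd M5 ord_max (scoef R) (qcoef R) I).
Local Notation sol z u p := (Qd u p (fun x => z * u x)).
Local Notation bddb := (bddb a b M5 ord_max).
Local Notation bdda := (bdda a b M5 ord_max).
Let aI : admissible M5 I := admissible_mfam Hrho Hsp Hsm Hcp Hcm.
Let nI : noatoms M5 ord_max (scoef R) (qcoef R) I := noatoms_mfam a b Hs Hc H4chi H4rho.
Let mI : measurable I := measurable_Iab a b.
Local Notation defect := (defect_space a b rho sp sm cp cm).

Lemma supp_two_points : exists x1 x2, [/\ x1 < x2, supp a b rho x1 & supp a b rho x2].
Proof.
have [x [y [/eqP xy [Sx Sy]]]] := H6.
by move: xy; rewrite neq_lt => /orP[h|h]; [exists x, y|exists y, x].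
Qed.

Lemma sol_tau_rel z u p : sol z u p -> tau_rel a b rho sp sm cp cm u (fun x => z * u x).
Proof.
move=> su; apply: (qd_tau_rel hab Hrho Hsp Hsm Hcp Hcm su).
by apply: (lbm_loc_int Hrho Hsp Hsm Hcp Hcm ord_max); apply: lbmZ; exact: (qd_lbm aI su).1.
Qed.

(** The limit-circle definition speaks of [tau_rel] and [L2on] on open half-lines; this form speaks
    of the first order system and of bounds on compact pieces, where the Weyl estimates live. *)
Lemma lc_at_bP : lc_at_b a b rho sp sm cp cm <-> forall z u p, sol z u p -> bddb u.
Proof.
split=> [lc z u p su|H z u tu c Ic].
  by apply: L2on_bddb => c Ic; exact: lc (sol_tau_rel su) c Ic.
have [_ [p su]] := tau_rel_qd Hrho Hsp Hsm Hcp Hcm tu.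
exact: (bddb_L2on (k0 := ord_max) aI (qd_lbm aI su).1 (H _ _ _ su) Ic).
Qed.

Lemma lc_at_aP : lc_at_a a b rho sp sm cp cm <-> forall z u p, sol z u p -> bdda u.
Proof.
split=> [lc z u p su|H z u tu c Ic].
  by apply: L2on_bdda => c Ic; exact: lc (sol_tau_rel su) c Ic.
have [_ [p su]] := tau_rel_qd Hrho Hsp Hsm Hcp Hcm tu.
exact: (bdda_L2on (k0 := ord_max) aI (qd_lbm aI su).1 (H _ _ _ su) Ic).
Qed.

Lemma lc_at_b_Ni : (forall u p, sol (- 'i%C) u p -> bddb u) -> lc_at_b a b rho sp sm cp cm.
Proof.
by move=> H; apply/lc_at_bP => z u p su; exact: (all_bddb aI nI H (Iab_nonempty hab) su).
Qed.

Lemma lc_at_a_Ni : (forall u p, sol (- 'i%C) u p -> bdda u) -> lc_at_a a b rho sp sm cp cm.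
Proof.
by move=> H; apply/lc_at_aP => z u p su; exact: (all_bdda aI nI H (Iab_nonempty hab) su).
Qed.

Lemma Qi_ext (u v : R -> C) x y : (forall t, I t -> u t = v t) -> I x -> I y ->
  Qi M5 ord_max u x y = Qi M5 ord_max v x y.
Proof.
move=> e Ix Iy; apply: eq_Rintegral => t; rewrite inE => /andP[h1 /ltW h2].
by rewrite /sqn e//; exact: Iab_conv Ix Iy h1 h2.
Qed.

Lemma bdda_ext (u v : R -> C) : (forall t, I t -> u t = v t) -> bdda u -> bdda v.
Proof.
move=> e ub c Ic; have [M H] := ub c Ic; exists M => x Ix xc.
by rewrite -(Qi_ext e Ix Ic); exact: H.
Qed.

Lemma bddb_ext (u v : R -> C) : (forall t, I t -> u t = v t) -> bddb u -> bddb v.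
Proof.
move=> e ub c Ic; have [M H] := ub c Ic; exists M => x Ix xc.
by rewrite -(Qi_ext e Ic Ix); exact: H.
Qed.

Section Fundamental.
Variables (c : R) (B1 P1 B2 P2 : R -> C).
Hypotheses (Ic : I c) (s1 : sol (- 'i%C) B1 P1) (s2 : sol (- 'i%C) B2 P2)
  (b1 : B1 c = 1) (p1 : P1 c = 0) (b2 : B2 c = 0) (p2 : P2 c = 1).

Lemma comb_indep z1 z2 :
  Defs.ae_eq a b rho (fun x => z1 * B1 x + z2 * B2 x) (fun=> 0) -> z1 = 0 /\ z2 = 0.
Proof.
move=> e; have [x1 [x2 [x12 S1 S2]]] := supp_two_points.
have [al Ial al1] := Iab_lt S1.1; have [be Ibe be2] := Iab_gt S2.1.
apply: (fundamental_indep hab Hrho Hsp Hsm Hs Hsupp Hcp Hcm Hc H4chi H4rho H5 Ic s1 s2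
  b1 p1 b2 p2 x12 S1 S2 Ial Ibe al1 be2).
by apply: filterS e => x h /andP[h1 /ltW h2]; apply: h; exact: Iab_conv Ial Ibe h1 h2.
Qed.

Lemma comb_sol z1 z2 :
  sol (- 'i%C) (fun x => z1 * B1 x + z2 * B2 x) (fun x => z1 * P1 x + z2 * P2 x).
Proof. exact: sol_lin. Qed.

Lemma comb_defect z1 z2 : bdda (fun x => z1 * B1 x + z2 * B2 x) ->
  bddb (fun x => z1 * B1 x + z2 * B2 x) -> defect (fun x => z1 * B1 x + z2 * B2 x).
Proof.
move=> ba bb; have sz := comb_sol z1 z2.
apply: (sol_defect Hrho Hsp Hsm Hs Hsupp Hcp Hcm Hc H4chi H4rho sz).
exact: (bdd_L2on (k0 := ord_max) aI Ic (qd_lbm aI sz).1 ba bb).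
Qed.

Lemma defect_comb w : defect w -> exists d1 d2,
  [/\ Defs.ae_eq a b rho w (fun x => d1 * B1 x + d2 * B2 x),
    bdda (fun x => d1 * B1 x + d2 * B2 x) & bddb (fun x => d1 * B1 x + d2 * B2 x)].
Proof.
move=> wd; have [x1 [x2 [x12 S1 S2]]] := supp_two_points.
have [d1 [d2 [e L]]] := defect_sol hab Hrho Hsp Hsm Hs Hsupp Hcp Hcm Hc H4chi H4rho H5 Ic s1 s2
  b1 p1 b2 p2 x12 S1 S2 wd.
by exists d1, d2; have [] := L2on_bdd (k0 := ord_max) (m := M5) L.
Qed.

(** [X] stands for [bdda] or [bddb]. If the two coefficient vectors were independent, the two
    combinations would span all solutions for -i, and the linear property [X] would hold for each of
    them, against the hypothesis. *)
Lemma comb_proportional (X : (R -> C) -> Prop) al be d1 d2 :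
  (forall z w u v, lbm I u -> lbm I v -> X u -> X v -> X (fun t => z * u t + w * v t)) ->
  (forall u v, (forall t, I t -> u t = v t) -> X u -> X v) ->
  ~ (forall u p, sol (- 'i%C) u p -> X u) -> ~ (al = 0 /\ be = 0) ->
  X (fun x => al * B1 x + be * B2 x) -> X (fun x => d1 * B1 x + d2 * B2 x) ->
  exists k, d1 = k * al /\ d2 = k * be.
Proof.
move=> Xlin Xext nX nz Xu Xv.
have [det|det] := eqVneq (al * d2 - be * d1) 0.
  have {}det : al * d2 = be * d1 by apply/eqP; rewrite -subr_eq0 det.
  have [al0|al0] := eqVneq al 0.
    have be0 : be != 0 by apply/eqP => be0; exact: nz.
    exists (d2 / be); rewrite divfK// al0 mulr0; split => //.
    by move/eqP: det; rewrite al0 mul0r eq_sym mulf_eq0 (negbTE be0) => /eqP.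
  exists (d1 / al); rewrite divfK//; split => //.
  by rewrite mulrAC (mulrC d1) -det mulrC mulKf.
exfalso; apply: nX => u p su.
set D := al * d2 - be * d1 in det.
(* Cramer's rule for the data [(u c, p c)] with determinant [D]. *)
have := Xlin ((u c * d2 - p c * d1) / D) ((al * p c - be * u c) / D) _ _
  (qd_lbm aI (comb_sol al be)).1 (qd_lbm aI (comb_sol d1 d2)).1 Xu Xv.
apply: Xext => t It; have [-> _] := sol_repr aI nI Ic su s1 s2 b1 p1 b2 p2 It.
by rewrite /D; field.
Qed.

Lemma index_one (al be : C) : ~ (al = 0 /\ be = 0) ->
  bdda (fun x => al * B1 x + be * B2 x) -> bddb (fun x => al * B1 x + be * B2 x) ->
  (forall d1 d2, bdda (fun x => d1 * B1 x + d2 * B2 x) -> bddb (fun x => d1 * B1 x + d2 * B2 x) ->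
    exists k, d1 = k * al /\ d2 = k * be) ->
  deficiency_index a b rho sp sm cp cm 1.
Proof.
move=> nz ba bb prop; exists (fun _ x => al * B1 x + be * B2 x).
split; [by move=> _; exact: comb_defect|split].
  move=> cs e k; have [h1 h2] : cs ord0 * al = 0 /\ cs ord0 * be = 0.
    apply: comb_indep; apply: filterS e => x h Ix.
    by rewrite -{}h// big_ord_recl big_ord0 addr0 mulrDr !mulrA.
  rewrite (ord1 k); apply: contrapT => cs0; apply: nz.
  by split; [move/eqP: h1|move/eqP: h2]; rewrite mulf_eq0 => /orP[/eqP//|/eqP].
move=> w /defect_comb[d1 [d2 [e ba' bb']]].
have [k [e1 e2]] := prop _ _ ba' bb'.
exists (fun=> k); apply: filterS e => x h Ix.
by rewrite h// big_ord_recl big_ord0 addr0 mulrDr !mulrA e1 e2.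
Qed.

Lemma index_zero : ~ lc_at_a a b rho sp sm cp cm -> ~ lc_at_b a b rho sp sm cp cm ->
  deficiency_index a b rho sp sm cp cm 0.
Proof.
move=> na nb; exists (fun _ _ => 0); split; [by case|split; [by move=> ? _ []|]].
move=> w /defect_comb[d1 [d2 [e ba bb]]]; exists (fun=> 0).
have sv := comb_sol d1 d2; set v := (fun x => _) in ba bb e sv; set pv := (fun x => _) in sv.
have J0 x : I x -> Jf v pv x = 0.
  move=> Ix; apply/eqP; rewrite eq_le; apply/andP; split; rewrite leNgt; apply/negP => J.
    by apply: na; apply: lc_at_a_Ni => u p su; exact: (Jf_pos_bdda aI nI sv ba Ix J su).
  by apply: nb; apply: lc_at_b_Ni => u p su; exact: (Jf_neg_bddb aI nI sv bb Ix J su).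
have lv := (qd_lbm aI sv).1.
have z x y : I x -> I y -> x <= y -> {ae rho, forall t, Ico x y t -> v t = 0}.
  move=> Ix Iy xy; apply: Rintegral_sqn_eq0; first exact: measurable_Ico.
  - exact: (lbm_cmeas_Ico lv Ix Iy).
  - exact: (sqn_int ord_max aI lv Ix Iy).
  - by have := Jf_eq aI nI sv Ix Iy xy; rewrite !J0// /Qi => /esym/eqP; rewrite sub0r oppr_eq0 => /eqP.
have [x1 [x2 [x12 S1 S2]]] := supp_two_points.
have [al Ial al1] := Iab_lt S1.1; have [be Ibe be2] := Iab_gt S2.1.
have [d10 d20] : d1 = 0 /\ d2 = 0.
  apply: (fundamental_indep hab Hrho Hsp Hsm Hs Hsupp Hcp Hcm Hc H4chi H4rho H5 Ic s1 s2
    b1 p1 b2 p2 x12 S1 S2 Ial Ibe al1 be2).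
  by apply: z => //; exact: ltW (lt_trans al1 (lt_trans x12 be2)).
apply: filterS e => x h Ix; rewrite h// big_ord0 /v d10 d20.
by rewrite !mul0r addr0.
Qed.

End Fundamental.

(** With exactly one limit-circle endpoint, every solution is square integrable near it. Near the
    other endpoint a nonzero solution with this property exists by [exists_bddb] or [exists_bdda],
    and it is unique up to a factor, since two independent ones would make that endpoint
    limit-circle as well. *)
Lemma deficiency_index_count :
  (~ lc_at_a a b rho sp sm cp cm /\ ~ lc_at_b a b rho sp sm cp cm ->
     deficiency_index a b rho sp sm cp cm 0) /\
  ((lc_at_a a b rho sp sm cp cm /\ ~ lc_at_b a b rho sp sm cp cm) \/
   (~ lc_at_a a b rho sp sm cp cm /\ lc_at_b a b rho sp sm cp cm) ->
     deficiency_index a b rho sp sm cp cm 1) /\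
  (lc_at_a a b rho sp sm cp cm /\ lc_at_b a b rho sp sm cp cm ->
     deficiency_index a b rho sp sm cp cm 2).
Proof.
have [c Ic] := Iab_nonempty hab.
have [B1 [P1 [b1 p1 s1]]] := sol_exists (- 'i%C) 1 0 aI nI Ic.
have [B2 [P2 [b2 p2 s2]]] := sol_exists (- 'i%C) 0 1 aI nI Ic.
split; [by move=> [na nb]; exact: (index_zero Ic s1 s2 b1 p1 b2 p2)|split].
  move=> [[/lc_at_aP la nb]|[na /lc_at_bP lb]].
    have [u [p [su nz ub]]] := exists_bddb aI nI Ic.
    have {}ub : bddb (fun x => u c * B1 x + p c * B2 x).
      by apply: bddb_ext ub => t It; have [] := sol_repr aI nI Ic su s1 s2 b1 p1 b2 p2 It.
    apply: (index_one Ic s1 s2 b1 p1 b2 p2 nz _ ub).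
      exact: la (comb_sol s1 s2 _ _).
    move=> d1 d2 _ vb; apply: (comb_proportional Ic s1 s2 b1 p1 b2 p2 _ _ _ nz ub vb).
    - by move=> *; exact: bddb_lin.
    - exact: bddb_ext.
    - by move=> H; apply: nb; exact: lc_at_b_Ni.
  have [u [p [su nz ub]]] := exists_bdda aI nI Ic.
  have {}ub : bdda (fun x => u c * B1 x + p c * B2 x).
    by apply: bdda_ext ub => t It; have [] := sol_repr aI nI Ic su s1 s2 b1 p1 b2 p2 It.
  apply: (index_one Ic s1 s2 b1 p1 b2 p2 nz ub).
    exact: lb (comb_sol s1 s2 _ _).
  move=> d1 d2 vb _; apply: (comb_proportional Ic s1 s2 b1 p1 b2 p2 _ _ _ nz ub vb).
  - by move=> *; exact: bdda_lin.
  - exact: bdda_ext.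
  - by move=> H; apply: na; exact: lc_at_a_Ni.
move=> [/lc_at_aP la /lc_at_bP lb].
(* The family [B1], [B2] is written through Kronecker coefficients, so that its members are
   combinations to which [comb_defect] applies. *)
pose al (k : 'I_2) : C := (k == ord0)%:R; pose be (k : 'I_2) : C := (k != ord0)%:R.
have sumE (cs : 'I_2 -> C) x : \sum_(k < 2) cs k * (al k * B1 x + be k * B2 x) =
    cs ord0 * B1 x + cs (lift ord0 ord0) * B2 x.
  by rewrite !big_ord_recl big_ord0 /al /be /=; ring.
exists (fun k x => al k * B1 x + be k * B2 x); split; last split.
- move=> k; apply: (comb_defect Ic s1 s2); [exact: la (comb_sol s1 s2 _ _)|exact: lb (comb_sol s1 s2 _ _)].
- move=> cs e k; have [h1 h2] : cs ord0 = 0 /\ cs (lift ord0 ord0) = 0.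
    by apply: (comb_indep Ic s1 s2 b1 p1 b2 p2); apply: filterS e => x; rewrite sumE.
  by case: (unliftP ord0 k) => [j|] ->; rewrite ?(ord1 j).
- move=> w /(defect_comb Ic s1 s2 b1 p1 b2 p2)[d1 [d2 [e _ _]]].
  exists (fun k => if k == ord0 then d1 else d2).
  by apply: filterS e => x h Ix; rewrite sumE h.
Qed.

End Count.

Unset Implicit Arguments.
Theorem theorem5p8 (R : realType) (a b : \bar R)
  (rho sp sm cp cm : {measure set R -> \bar R})
  (hab : (a < b)%E)
  (* (H1) rho positive, locally finite Borel measure on (a,b) *)
  (Hrho : loc_finite_on a b rho)
  (* (H3) varsigma = sp - sm real-valued, locally finite, supp varsigma = (a,b) *)
  (Hsp : loc_finite_on a b sp) (Hsm : loc_finite_on a b sm)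
  (Hs : jordan_pair sp sm)
  (Hsupp : forall x, Iab a b x -> forall e : R, 0 < e ->
     (0 < measure_add sp sm (Ioo (x - e) (x + e)))%E)
  (* (H2) chi = cp - cm real-valued, locally finite *)
  (Hcp : loc_finite_on a b cp) (Hcm : loc_finite_on a b cm)
  (Hc : jordan_pair cp cm)
  (* (H4) *)
  (H4chi : forall x : R,
     ((sp [set x] - sm [set x]) * (cp [set x] - cm [set x]) = 0)%E)
  (H4rho : forall x : R, ((sp [set x] - sm [set x]) * rho [set x] = 0)%E)
  (* (H5) *)
  (H5 : gap_hyp a b rho sp sm cp cm)
  (* (H6) *)
  (H6 : exists x y, x <> y /\ supp a b rho x /\ supp a b rho y) :
  (~ lc_at_a a b rho sp sm cp cm /\ ~ lc_at_b a b rho sp sm cp cm ->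
     deficiency_index a b rho sp sm cp cm 0) /\
  ((lc_at_a a b rho sp sm cp cm /\ ~ lc_at_b a b rho sp sm cp cm) \/
   (~ lc_at_a a b rho sp sm cp cm /\ lc_at_b a b rho sp sm cp cm) ->
     deficiency_index a b rho sp sm cp cm 1) /\
  (lc_at_a a b rho sp sm cp cm /\ lc_at_b a b rho sp sm cp cm ->
     deficiency_index a b rho sp sm cp cm 2).

Proof. exact: deficiency_index_count. Qed.
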